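(* Let $L>0$ with $L\notin\mathcal N$. Then there exists a functional $W:L^2(0,L)\to\mathbb R_+$ such that the function $V(w):=W(w)+E(w)$, where $E(w):=\int_0^L w(x)^2\,dx$, is (a) an exponentially ISS Lyapunov functional for the linear KdV system $$w_t+w_x+w_{xxx}=d_1(t,x),\quad w(t,0)=w(t,L)=0,\quad w_x(t,L)=d_2(t),\quad w(0,x)=w_0(x);$$ (b) a locally exponentially ISS Lyapunov functional for the nonlinear KdV system $$w_t+w_x+w_{xxx}+ww_x=d_1(t,x),\quad w(t,0)=w(t,L)=0,\quad w_x(t,L)=d_2(t),\quad w(0,x)=w_0(x),$$ where $(t,x)\in\mathbb R_+\times[0,L]$. Moreover, the functional $W$ is given by $W(w):=\|\Pi(w)\|_{L^2}^2$ with $\Pi$ a continuous linear operator from $L^2(0,L)$ to $L^2(0,L)$ with a continuous inverse.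
   Context: $\mathcal N:=\left\{2\pi\sqrt{\tfrac{k^2+kl+l^2}{3}}: k,l\in\mathbb N\right\}$, with $\mathbb N=\{1,2,\dots\}$. $\mathbb R_+=[0,\infty)$ and $\|\cdot\|_{L^2}$ is the norm of $L^2(0,L)$. The functions $d_1$ (distributed) and $d_2$ (boundary) are external inputs (disturbances). Definition (exponentially ISS Lyapunov functional). A function $V:L^2(0,L)\to\mathbb R$ is an exponentially ISS Lyapunov functional for one of the systems above if there exist positive constants $\underline\alpha,\bar\alpha,\alpha,\sigma_1,\sigma_2$ such that: (i) for all $w\in L^2(0,L)$, $\underline\alpha\|w\|_{L^2}^2\le V(w)\le\bar\alpha\|w\|_{L^2}^2$; (ii) the time derivative of $V$ along the trajectories of the system satisfies $\dot V(w)\le-\alpha\|w\|_{L^2}^2+\sigma_1\|d_1\|_{L^2}^2+\sigma_2|d_2|^2$ for any $w\in L^2(0,L)$, $d_1\in L^2(0,L)$, $d_2\in\mathbb R$. If there exists $\delta>0$ such that (ii) holds only for $\|w\|_{L^2}+\|d_1\|_{L^2}+|d_2|\le3\delta$, then $V$ is called a locally exponentially ISS Lyapunov functional. Convention on derivatives: $\dot V(w)=D_V(w)w_t$, where $D_V(w)$ is the Fréchet derivative of $V$ at $w$ and $w_t$ is replaced by the expression given by the PDE (e.g. $w_t=-w_x-w_{xxx}+d_1$ in the linear case and $w_t=-w_x-w_{xxx}-ww_x+d_1$ in the nonlinear case). It is computed along regular solutions, i.e. with states $w\in H^3(0,L)$ satisfying $w(0)=w(L)=0$, $w'(L)=d_2$;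 the extension to less regular states and inputs is understood by density of regular data. *)

(* Defs.v *)
From HB Require Import structures.
From mathcomp Require Import all_boot all_order all_algebra.
From mathcomp Require Import all_classical all_reals all_analysis.
From mathcomp Require Import measurable_realfun ess_sup_inf.

Set Implicit Arguments.
Unset Strict Implicit.
Unset Printing Implicit Defensive.
Import Order.TTheory GRing.Theory Num.Theory.
Import numFieldNormedType.Exports.

Local Open Scope classical_set_scope.
Local Open Scope ring_scope.

(* [LspaceType mu p1] is the quotient of the p-integrable functions by equality
   mu-a.e., but comes with no algebraic or topological structure; this section
   equips it with its normed-module structure. *)
Section Lspace_normed.
Context d (T : measurableType d) (R : realType).
Variables (mu : {measure set T -> \bar R}) (p : \bar R) (p1 : (1 <= p)%E).

Local Notation Lf := (LfunType mu p1).
Local Notation Ls := (LspaceType mu p1).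

Lemma ae_eq_Lnorm (f g : T -> R) :
  measurable_fun setT f -> measurable_fun setT g -> f = g %[ae mu] ->
  Lnorm mu p (EFin \o f) = Lnorm mu p (EFin \o g).
Proof.
move=> mf mg fg; rewrite unlock; case: p p1 => [r r1|_|//].
  apply: (congr1 (fun t => t `^ r^-1)%E); apply: ae_eq_integral => //; [| |].
  - apply: (@measurableT_comp _ _ _ _ _ _ (@poweR R ^~ r)) => //.
      exact: measurable_poweR.
    apply: measurableT_comp => //; exact/measurable_EFinP.
  - apply: (@measurableT_comp _ _ _ _ _ _ (@poweR R ^~ r)) => //.
      exact: measurable_poweR.
    apply: measurableT_comp => //; exact/measurable_EFinP.
  - by apply: filterS fg => x /(_ Logic.I) /= ->.
case: ifPn => // mu0; apply: eq_ess_sup.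
by apply: filterS fg => x /(_ Logic.I) /= ->.
Qed.

Lemma Lspace_Lfun (f : Ls) : (f : T -> R) \in Lfun mu p.
Proof.
apply/andP; split; rewrite inE /=.
  exact: (@measurable_funPT _ _ _ _
    (repr (f : {mfun_ mu, T >-> measurableTypeR R}))).
exact: Lebesgue_finite.
Qed.

Definition Lspace_repr (f : Ls) : Lf := Lfun_Sub p1 (Lspace_Lfun f).

Lemma Lspace_eqP (f g : Ls) : (f : T -> R) = g %[ae mu] <-> f = g.
Proof.
split=> [fg|-> //]; last exact: aeW.
case: f g fg => [f [[fP]]] [g [[gP]]] /= fg.
have fgE : f = g.
  have : (f == g %[mod {mfun_ mu, T >-> measurableTypeR R}])%qT by apply/ae_eqP.
  by rewrite !reprK => /eqP.
by subst g; rewrite (Prop_irrelevance fP gP).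
Qed.

Section class.
Variable g : Lf.

Let g' : T -> measurableTypeR R := g.

Let mg' : measurable_fun setT g'.
Proof. exact: (@measurable_funPT _ _ _ _ g). Qed.

HB.instance Definition _ :=
  @isMeasurableFun.Build _ _ T (measurableTypeR R) g' mg'.

Definition Lclass_mfun : {mfun_ mu, T >-> measurableTypeR R} :=
  (\pi_({mfun_ mu, T >-> measurableTypeR R})
    (g' : {mfun T >-> measurableTypeR R}))%qT.

Lemma Lclass_mfunE : (Lclass_mfun : T -> R) = g %[ae mu].
Proof.
have /eqP := reprK Lclass_mfun.
by rewrite /Lclass_mfun eqmodE => /asboolP.
Qed.

Lemma Lclass_finite : finite_norm mu p (Lclass_mfun : T -> R).
Proof.
rewrite /finite_norm (@ae_eq_Lnorm _ g) //.
- exact: Lfunction_finite.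
- exact: (@measurable_funPT _ _ _ _ (repr Lclass_mfun)).
- exact: Lclass_mfunE.
Qed.

HB.instance Definition _ :=
  @isFinLebesgue.Build d T R mu p p1 Lclass_mfun Lclass_finite.

Definition Lclass : Ls := locked [the Ls of Lclass_mfun].

Lemma LclassE : (Lclass : T -> R) = g %[ae mu].
Proof. by rewrite /Lclass -lock; exact: Lclass_mfunE. Qed.

End class.

HB.instance Definition _ := gen_eqMixin Ls.
HB.instance Definition _ := gen_choiceMixin Ls.

Let zeroL : Ls := Lclass 0.
Let oppL (f : Ls) : Ls := Lclass (- Lspace_repr f).
Let addL (f g : Ls) : Ls := Lclass (Lspace_repr f + Lspace_repr g).
Let scaleL (a : R) (f : Ls) : Ls := Lclass (a *: Lspace_repr f).

Let zeroLE : (zeroL : T -> R) = cst 0 %[ae mu]. Proof. exact: LclassE. Qed.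
Let oppLE f : (oppL f : T -> R) = (fun x => - f x) %[ae mu].
Proof. exact: LclassE. Qed.
Let addLE f g : (addL f g : T -> R) = (fun x => f x + g x) %[ae mu].
Proof. exact: LclassE. Qed.
Let scaleLE a f : (scaleL a f : T -> R) = (fun x => a * f x) %[ae mu].
Proof. exact: LclassE. Qed.

Let addLA : associative addL.
Proof.
move=> f g h; apply/Lspace_eqP.
apply: filterS2 (filterI (addLE f (addL g h)) (addLE g h))
  (filterI (addLE (addL f g) h) (addLE f g)) => x [+ +] [+ +] _.
by do 4 move=> /(_ Logic.I) ->; rewrite addrA.
Qed.

Let addLC : commutative addL.
Proof.
move=> f g; apply/Lspace_eqP.
apply: filterS2 (addLE f g) (addLE g f) => x + + _.
by do 2 move=> /(_ Logic.I) ->; rewrite addrC.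
Qed.

Let add0L : left_id zeroL addL.
Proof.
move=> f; apply/Lspace_eqP.
apply: filterS2 (addLE zeroL f) zeroLE => x + + _.
by do 2 move=> /(_ Logic.I) ->; rewrite add0r.
Qed.

Let addNL : left_inverse zeroL oppL addL.
Proof.
move=> f; apply/Lspace_eqP.
apply: filterS2 (addLE (oppL f) f) (filterI (oppLE f) zeroLE) => x + [+ +] _.
by do 3 move=> /(_ Logic.I) ->; rewrite addNr.
Qed.

HB.instance Definition _ := GRing.isZmodule.Build Ls addLA addLC add0L addNL.

Let scaleLA a b f : scaleL a (scaleL b f) = scaleL (a * b) f.
Proof.
apply/Lspace_eqP.
apply: filterS2 (filterI (scaleLE a (scaleL b f)) (scaleLE b f))
  (scaleLE (a * b) f) => x [e1 e2] e3 _.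
apply: etrans (e1 Logic.I) (etrans _ (esym (e3 Logic.I))).
by apply: etrans (congr1 ( *%R a) (e2 Logic.I)) _; rewrite mulrA.
Qed.

Let scale1L : left_id 1 scaleL.
Proof.
move=> f; apply/Lspace_eqP; apply: filterS (scaleLE 1 f) => x + _.
by move=> /(_ Logic.I) ->; rewrite mul1r.
Qed.

Let scaleLDr : right_distributive scaleL +%R.
Proof.
move=> a f g; apply/Lspace_eqP.
apply: filterS2 (filterI (scaleLE a (addL f g)) (addLE f g))
  (filterI (addLE (scaleL a f) (scaleL a g))
     (filterI (scaleLE a f) (scaleLE a g))) => x [e1 e2] [e3 [e4 e5]] _.
apply: etrans (e1 Logic.I) (etrans _ (esym (e3 Logic.I))).
apply: etrans (congr1 ( *%R a) (e2 Logic.I)) _.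
rewrite mulrDr; apply: esym.
exact: (congr2 +%R (e4 Logic.I) (e5 Logic.I)).
Qed.

Let scaleLDl f : {morph scaleL^~ f : a b / a + b}.
Proof.
move=> a b; apply/Lspace_eqP.
apply: filterS2 (scaleLE (a + b) f)
  (filterI (addLE (scaleL a f) (scaleL b f))
     (filterI (scaleLE a f) (scaleLE b f))) => x e1 [e2 [e3 e4]] _.
apply: etrans (e1 Logic.I) (etrans _ (esym (e2 Logic.I))).
by rewrite mulrDl; apply: esym; exact: (congr2 +%R (e3 Logic.I) (e4 Logic.I)).
Qed.

HB.instance Definition _ :=
  GRing.Zmodule_isLmodule.Build R Ls scaleLA scale1L scaleLDr scaleLDl.

Lemma Lspace0E : ((0 : Ls) : T -> R) = cst 0 %[ae mu].
Proof. exact: zeroLE. Qed.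

Lemma LspaceNE (f : Ls) : (- f : T -> R) = (fun x => - f x) %[ae mu].
Proof. exact: oppLE. Qed.

Lemma LspaceDE (f g : Ls) : (f + g : T -> R) = (fun x => f x + g x) %[ae mu].
Proof. exact: addLE. Qed.

Lemma LspaceZE a (f : Ls) : (a *: f : T -> R) = (fun x => a * f x) %[ae mu].
Proof. exact: scaleLE. Qed.

Let normL (f : Ls) : R := fine (Lnorm mu p (EFin \o f)).

Let normL_class (g : Lf) : normL (Lclass g) = fine (Lnorm mu p (EFin \o g)).
Proof.
rewrite /normL (@ae_eq_Lnorm _ g) //; last exact: LclassE.
exact: (@measurable_funPT _ _ _ _ (Lspace_repr (Lclass g))).
Qed.

Let ler_normLD (f g : Ls) : normL (f + g) <= normL f + normL g.
Proof.
by rewrite normL_class; exact: (ler_LnormD (Lspace_repr f) (Lspace_repr g)).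
Qed.

Let normLZ a (f : Ls) : normL (a *: f) = `|a| * normL f.
Proof.
rewrite normL_class.
have -> : EFin \o (a *: Lspace_repr f : Lf) = EFin \o (a \*: Lspace_repr f) by [].
by rewrite LnormZ -finite_norm_fine.
Qed.

Let normL_eq0 (f : Ls) : normL f = 0 -> f = 0.
Proof.
move=> f0; apply/Lspace_eqP.
have := @fine_Lnormr_eq0 _ _ _ mu p p1 (Lspace_repr f) f0.
apply: filterS2 Lspace0E => x e0 ef _.
exact: etrans (ef Logic.I) (esym (e0 Logic.I)).
Qed.

HB.instance Definition _ :=
  Lmodule_isNormed.Build R Ls ler_normLD normLZ normL_eq0.

Lemma Lspace_normE (f : Ls) : `|f| = fine (Lnorm mu p (EFin \o f)).
Proof. by []. Qed.

End Lspace_normed.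

Section kdv.
Variable R : realType.
Implicit Types L : R.

Definition critical_length L : Prop :=
  exists k l : nat, [/\ (0 < k)%N, (0 < l)%N &
    L = 2 * pi * Num.sqrt ((k ^ 2 + k * l + l ^ 2)%:R / 3)].

Definition interval_measure L : {measure set (measurableTypeR R) -> \bar R} :=
  mrestr (@lebesgue_measure R) (measurable_itv `]0, L[).

Definition L2 L := LspaceType2 (interval_measure L).

HB.instance Definition _ L := NormedModule.on (L2 L).

Definition test_function L (phi : R -> R) : Prop :=
  [/\ forall x, derivable phi x 1, continuous (derive1 phi) &
    exists a b : R, [/\ 0 < a, b < L & forall x, x \notin `[a, b] -> phi x = 0]].

(* Weak derivative in L2(0, L); the test functions are C^1 with compact support
   in ]0, L[, as is usual in dimension one (C^oo_c gives the same notion). Hence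
   w is in H^3(0, L) iff it has weak derivatives w1, w2, w3 up to order 3. *)
Definition is_weak_derivative L (f g : L2 L) : Prop :=
  forall phi, test_function L phi ->
    \int[lebesgue_measure]_(x in `]0, L[) (f x * derive1 phi x) =
    - \int[lebesgue_measure]_(x in `]0, L[) (g x * phi x).

(* f(x) = v, pointwise values being those of the continuous representative. *)
Definition has_value L (f : L2 L) (x v : R) : Prop :=
  exists u : R -> R, [/\ {within `[0, L], continuous u},
    (f : R -> R) = u %[ae interval_measure L] & u x = v].

(* w is in H^3(0, L), with successive derivatives w1, w2, w3, and satisfies
   w(0) = w(L) = 0 and w'(L) = d2. *)
Definition regular_state L (w w1 w2 w3 : L2 L) (d2 : R) : Prop :=
  [/\ is_weak_derivative w w1, is_weak_derivative w1 w2 &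
      is_weak_derivative w2 w3] /\
  [/\ has_value w 0 0, has_value w L 0 & has_value w1 L d2].

(* [S w d1 d2 wt]: at the regular state w, with inputs d1 and d2, the PDE
   prescribes the time derivative wt. *)
Definition control_system L := L2 L -> L2 L -> R -> L2 L -> Prop.

Definition kdv_linear L : control_system L := fun w d1 d2 wt =>
  exists w1 w2 w3 : L2 L, regular_state w w1 w2 w3 d2 /\
    (wt : R -> R) = (fun x => - w1 x - w3 x + d1 x) %[ae interval_measure L].

(* The product w * w1 is square integrable, since w in H^3 is bounded. *)
Definition kdv_nonlinear L : control_system L := fun w d1 d2 wt =>
  exists w1 w2 w3 : L2 L, regular_state w w1 w2 w3 d2 /\
    (wt : R -> R) = (fun x => - w1 x - w3 x - w x * w1 x + d1 x)
      %[ae interval_measure L].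

(* The dissipation inequality is only required where P w d1 d2 holds; the
   derivative of V along S is the Frechet differential of V at w applied to wt. *)
Definition ISS_Lyapunov_on L (P : L2 L -> L2 L -> R -> Prop)
    (S : control_system L) (V : L2 L -> R) : Prop :=
  exists alo ahi a s1 s2 : R,
  [/\ [/\ 0 < alo, 0 < ahi, 0 < a, 0 < s1 & 0 < s2],
      forall w, alo * `|w| ^+ 2 <= V w <= ahi * `|w| ^+ 2,
      forall w, differentiable V w &
      forall w d1 d2 wt, P w d1 d2 -> S w d1 d2 wt ->
        'd V w wt <= - a * `|w| ^+ 2 + s1 * `|d1| ^+ 2 + s2 * `|d2| ^+ 2].

Definition exp_ISS_Lyapunov L (S : control_system L) (V : L2 L -> R) : Prop :=
  ISS_Lyapunov_on (fun _ _ _ => True) S V.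

Definition local_exp_ISS_Lyapunov L (S : control_system L) (V : L2 L -> R) :
    Prop :=
  exists2 delta : R, 0 < delta &
    ISS_Lyapunov_on (fun w d1 d2 => `|w| + `|d1| + `|d2| <= 3 * delta) S V.

Definition energy L (w : L2 L) : R :=
  \int[lebesgue_measure]_(x in `[0, L]) (w x ^+ 2).

End kdv.

(* Main.v *)
(* Let A u = - (u' + u''') with u(0) = u(L) = u'(L) = 0. The energy identity
   (|w|^2)' = d2^2 - w'(0)^2 + 2 <w, d1> (plain, and weighted by the square of
   1 + eps x) yields - 2 w'(0)^2 - 6 eps |w_x|^2, but also + O(eps) |w|^2, which
   has to be dominated. Let g_0 solve g' + g''' = 0 with g(0) = g(L) = 0 and
   g'(0) = 1, and let g_(n+1) solve g' + g''' = g_n with g(0) = g(L) = g'(0) = 0.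
   The moments m_n = <w, g_n> satisfy m_0' = - w'(0) and m_(n+1)' = m_n up to
   inputs and quadratic terms, so that the derivative of - gamma_n m_n m_(n+1)
   contains - gamma_n m_n^2: choosing gamma_n by induction, the finite rank
   operator F w = - sum_(n < N) gamma_n m_n g_(n+1) dissipates the first N moments.
   We take Pi = (1 + eps x) + eps F, which is invertible for small eps, being a
   finite rank perturbation of a multiplication.

   Finitely many moments suffice: |w|^2 <= |w_x|^2 + C sum_(n < N) m_n^2. Otherwise,
   by compactness, some w <> 0 is orthogonal to all g_n; on the space of such w
   the operator A^-1 is compact and skew-symmetric, because w'(0) = 0 there. It thus
   has an eigenvector, which satisfies four boundary conditions at once, and testing
   it with exponentials forces L to be critical. *)

Require Import Defs.
From HB Require Import structures.
From mathcomp Require Import all_boot all_order all_algebra.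
From mathcomp Require Import all_classical all_reals all_analysis.
From mathcomp Require Import measurable_realfun ring lra.
Import Order.TTheory GRing.Theory Num.Theory.
Import numFieldNormedType.Exports.
Local Open Scope classical_set_scope.
Local Open Scope ring_scope.
Set Implicit Arguments.
Unset Strict Implicit.
Unset Printing Implicit Defensive.

(** * Calculus on the real line *)

Section calculus.
Variable R : realType.
Implicit Types f g u v : R -> R.

(** The weight applied to w^2 is 1 + (1 + eps x)^2, which equals 2 at x = 0: the dissipation - 2
    w'(0)^2 carries no factor eps, whereas every w'(0) created by eps F does. So w'(0) can be
    handled as one more input, absorbed once eps is small. The gain from the moments and the loss
    9/4 eps |w|^2 are both of order eps; the gamma_n are therefore fixed before eps, and all that is
    left over is of order eps^2. This remainder involves w_t only through its pairings with g_n and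
    x g_n, which vanish at 0 and L, and never through |w_t|, which has no bound. A parameter [th],
    equal to 0 or 1, treats both equations at once; the smallness condition bears on th |w| and is
    void for the linear equation. Smooth functions are defined and differentiable on all of R, which
    avoids one-sided derivatives; identities on [0, L] come from explicit primitives. A regular
    state is first replaced by its C^2 representative, its third derivative being kept only through
    integration by parts. *)

Definition has_deriv f g := forall x : R, is_derive x (1 : R) f (g x).

Lemma has_derivD f f' g g' : has_deriv f f' -> has_deriv g g' ->
  has_deriv (fun x => f x + g x) (fun x => f' x + g' x).
Proof. by move=> df dg x; exact: is_deriveD. Qed.

Lemma has_derivN f f' : has_deriv f f' ->
  has_deriv (fun x => - f x) (fun x => - f' x).
Proof. by move=> df x; exact: is_deriveN. Qed.

Lemma has_derivM f f' g g' : has_deriv f f' -> has_deriv g g' ->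
  has_deriv (fun x => f x * g x) (fun x => f' x * g x + f x * g' x).
Proof.
move=> df dg x; apply: is_derive_eq; first exact: is_deriveM (df x) (dg x).
by rewrite /GRing.scale /= addrC [g x * _]mulrC.
Qed.

Lemma has_deriv_cst (c : R) : has_deriv (fun=> c) (fun=> 0).
Proof. by move=> x; exact: is_derive_cst. Qed.

Lemma has_deriv_id : has_deriv (fun x => x) (fun=> 1).
Proof. by move=> x; exact: is_derive_id. Qed.

Lemma has_deriv_comp f f' g g' : has_deriv f f' -> has_deriv g g' ->
  has_deriv (fun x => f (g x)) (fun x => f' (g x) * g' x).
Proof. by move=> df dg x; exact: is_derive1_comp (df (g x)) (dg x). Qed.

Lemma has_deriv_eq f g h : has_deriv f g -> g =1 h -> has_deriv f h.
Proof. by move=> df gh x; apply: is_derive_eq (gh x); exact: df. Qed.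

Lemma has_deriv_cont f g : has_deriv f g -> continuous f.
Proof.
move=> df x; apply: differentiable_continuous; apply/derivable1_diffP.
by have [] := df x.
Qed.

Lemma contD f g : continuous f -> continuous g ->
  continuous (fun x => f x + g x).
Proof. by move=> cf cg x; apply: continuousD; [exact: cf|exact: cg]. Qed.

Lemma contN f : continuous f -> continuous (fun x => - f x).
Proof. by move=> cf x; apply: continuousN; exact: cf. Qed.

Lemma contM f g : continuous f -> continuous g ->
  continuous (fun x => f x * g x).
Proof. by move=> cf cg x; apply: continuousM; [exact: cf|exact: cg]. Qed.

Lemma contX f n : continuous f -> continuous (fun x => f x ^+ n).
Proof.
move=> cf; elim: n => [|n ih]; first by move=> x; exact: cst_continuous.
by under eq_fun do rewrite exprS; exact: contM.
Qed.

Lemma contC (c : R) : continuous (fun _ : R => c).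
Proof. by move=> x; exact: cst_continuous. Qed.

Lemma cont_id : continuous (fun x : R => x).
Proof. by move=> x; exact: cvg_id. Qed.

Lemma has_derivX f f' n : has_deriv f f' ->
  has_deriv (fun x => f x ^+ n) (fun x => n%:R * f x ^+ n.-1 * f' x).
Proof.
move=> df; elim: n => [|n ih].
  by apply: has_deriv_eq (has_deriv_cst 1) _ => x; rewrite !mul0r.
under eq_fun do rewrite exprS.
refine (has_deriv_eq (has_derivM df ih) _) => x /=.
case: n {ih} => [|n]; first by rewrite /= expr0; ring.
by rewrite /= exprS -[n.+2]addn1 natrD; ring.
Qed.

Lemma has_deriv_nondecr F f (a b : R) : has_deriv F f -> a <= b ->
  (forall x, a <= x <= b -> 0 <= f x) -> F a <= F b.
Proof.
move=> dF; rewrite le_eqVlt => /predU1P[->//|ab] f0.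
have [c /itvP cab] := MVT ab (fun x _ => dF x)
  (continuous_subspaceT (has_deriv_cont dF)).
move=> /eqP; rewrite -subr_ge0 => /eqP ->.
by rewrite mulr_ge0 ?subr_ge0 ?(ltW ab)// f0// !cab.
Qed.

Lemma has_deriv_unique F G f (x y : R) : has_deriv F f -> has_deriv G f ->
  F y - F x = G y - G x.
Proof.
move=> dF dG.
have d0 : has_deriv (fun t => F t - G t) (fun=> 0).
  refine (has_deriv_eq (has_derivD dF (has_derivN dG)) _) => t /=.
  by rewrite subrr.
by have := is_derive_0_is_cst x y d0; lra.
Qed.

(** The signed integral from 0 to x, so that negative x is covered too and the result is a primitive
    on the whole line. *)
Definition prim f (x : R) : R :=
  \int[lebesgue_measure]_(t in `[0, x]) f t -
  \int[lebesgue_measure]_(t in `[x, 0]) f t.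

Let cont_itg f (a b : R) : continuous f ->
  lebesgue_measure.-integrable `[a, b] (EFin \o f).
Proof.
move=> cf; apply: continuous_compact_integrable; first exact: segment_compact.
exact: continuous_subspaceT.
Qed.

Lemma prim0 f : prim f 0 = 0.
Proof. by rewrite /prim subrr. Qed.

Lemma has_deriv_prim f : continuous f -> has_deriv (prim f) f.
Proof.
(* The base point lies to the left of both x and 0, so that near x the signed integral differs by a
   constant from the integral started at [a]. *)
move=> cf x; pose a := Num.min x 0 - 1.
have ax : a < x by rewrite /a ltrBlDr gt_min ltrDl ltr01.
have a0 : a < 0 by rewrite /a ltrBlDr gt_min add0r ltr01 orbT.
pose G y := \int[lebesgue_measure]_(t in `[a, y]) f t.
have [dG G'] : derivable G x 1 /\ G^`()%classic x = f x.
  apply: (@continuous_FTC1_closed _ f a x (x + 1)) => //.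
  - by rewrite ltrDl.
  - exact: cont_itg.
  - exact: cf.
have itvB s t : a < s -> s <= t ->
    \int[lebesgue_measure]_(r in `[s, t]) f r = G t - G s.
  move=> as' st.
  rewrite /G (@Rintegral_itvB _ f (BLeft a) (BRight t) s) ?bnd_simp//.
  - rewrite Rintegral_itv_obnd_cbnd//; apply: integrableS (cont_itg s t cf) => //.
    exact: subset_itv_oc_cc.
  - exact: cont_itg.
  - exact: ltW.
have pE y : a < y -> prim f y = G y - G 0.
  move=> ay; rewrite /prim; have [y0|y0] := leP y 0.
    have -> : \int[lebesgue_measure]_(t in `[0, y]) f t = 0.
      move: y0; rewrite le_eqVlt => /predU1P[->|y0].
        by rewrite set_itv1 Rintegral_set1.
      by rewrite set_itv_ge ?Rintegral_set0// bnd_simp -ltNge.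
    rewrite sub0r -[RHS]opprB; by rewrite itvB.
  rewrite [X in _ - X](_ : _ = 0) ?subr0; last first.
    by rewrite set_itv_ge ?Rintegral_set0// bnd_simp -ltNge.
  by rewrite itvB// ltW.
have dGx : is_derive x (1 : R) G (f x) by apply: (DeriveDef dG); rewrite -derive1E.
have : is_derive x (1 : R) (fun y => G y - G 0) (f x).
  apply: is_derive_eq (subr0 _); exact: is_deriveB dGx (is_derive_cst _ _ _).
apply: near_eq_is_derive.
near=> y; rewrite pE//; near: y.
exact: lt_nbhsr.
Unshelve. all: by end_near. Qed.

Lemma cont_sin : continuous (@sin R).
Proof. exact: continuous_sin. Qed.

Lemma cont_cos : continuous (@cos R).
Proof. exact: continuous_cos. Qed.

Lemma has_deriv_sin : has_deriv (@sin R) cos.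
Proof. by move=> x; exact: is_derive_sin. Qed.

Lemma has_deriv_cos : has_deriv (@cos R) (fun x => - sin x).
Proof. by move=> x; exact: is_derive_cos. Qed.

End calculus.

Ltac cont := first
  [ assumption
  | lazymatch goal with
    | |- continuous (fun _ => ?c) => exact: contC
    | |- continuous (fun x => x) => exact: cont_id
    | |- continuous (fun x => @?f x + @?g x) => apply: (@contD _ f g); cont
    | |- continuous (fun x => @?f x * @?g x) => apply: (@contM _ f g); cont
    | |- continuous (fun x => - @?f x) => apply: (@contN _ f); cont
    | |- continuous (fun x => @?f x ^+ ?n) => apply: (@contX _ f n); cont
    | |- continuous (fun x => sin x) => exact: cont_sin
    | |- continuous (fun x => cos x) => exact: cont_cos
    | H : has_deriv ?f _ |- continuous ?f => exact: has_deriv_cont H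
    | H : has_deriv ?f _ |- continuous (fun x => ?f x) => exact: has_deriv_cont H
    end ].

(** Meant for goals whose derivative is still an existential variable: the syntax of the function
    determines it, and [has_deriv_eq] then compares it with the wanted expression by [ring]. *)
Ltac deriv := first
  [ eassumption
  | lazymatch goal with
    | |- has_deriv (fun _ => ?c) _ => exact: has_deriv_cst
    | |- has_deriv (fun x => x) _ => exact: has_deriv_id
    | |- has_deriv (fun x => @?f x + @?g x) _ => eapply (@has_derivD _ f _ g); deriv
    | |- has_deriv (fun x => @?f x * @?g x) _ => eapply (@has_derivM _ f _ g); deriv
    | |- has_deriv (fun x => - @?f x) _ => eapply (@has_derivN _ f); deriv
    | |- has_deriv (fun x => @?f x ^+ ?n) _ => eapply (@has_derivX _ f _ n); deriv
    | |- has_deriv (fun x => sin x) _ => exact: has_deriv_sin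
    | |- has_deriv (fun x => cos x) _ => exact: has_deriv_cos
    end ].

(** * Integration of continuous functions over [0, L] *)

Section integral_on_segment.
Variable R : realType.
Implicit Types f g u v : R -> R.

Definition intL (L : R) f : R := \int[lebesgue_measure]_(t in `[0, L]) f t.

Variable L : R.
Hypothesis L_gt0 : 0 < L.

Lemma intL_prim f : intL L f = prim f L.
Proof.
rewrite /prim [X in _ - X](_ : _ = 0) ?subr0//.
by rewrite set_itv_ge ?Rintegral_set0// bnd_simp -ltNge.
Qed.

Lemma intL_FTC F f : has_deriv F f -> continuous f -> intL L f = F L - F 0.
Proof.
move=> dF cf; rewrite intL_prim -(has_deriv_unique _ _ (has_deriv_prim cf) dF).
by rewrite prim0 subr0.
Qed.

Lemma eq_intL f g : (forall x, 0 <= x <= L -> f x = g x) -> intL L f = intL L g.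
Proof.
move=> fg; apply: eq_Rintegral => x; rewrite inE/= in_itv/=; exact: fg.
Qed.

Lemma intLD f g : continuous f -> continuous g ->
  intL L (fun x => f x + g x) = intL L f + intL L g.
Proof.
move=> cf cg.
rewrite (intL_FTC (has_derivD (has_deriv_prim cf) (has_deriv_prim cg))).
  by rewrite !prim0 !intL_prim; ring.
exact: contD.
Qed.

Lemma intLZ (c : R) f : continuous f ->
  intL L (fun x => c * f x) = c * intL L f.
Proof.
move=> cf; have d : has_deriv (fun x => c * prim f x) (fun x => c * f x).
  refine (has_deriv_eq (has_derivM (has_deriv_cst c) (has_deriv_prim cf)) _).
  by move=> x; rewrite mul0r add0r.
rewrite (intL_FTC d); first by rewrite prim0 intL_prim; ring.
by apply: contM => //; exact: contC.
Qed.

Lemma intLN f : continuous f -> intL L (fun x => - f x) = - intL L f.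
Proof.
move=> cf; rewrite -mulN1r -intLZ//; apply: eq_intL => x _.
by rewrite mulN1r.
Qed.

Lemma intL0 : intL L (fun=> 0) = 0.
Proof. by rewrite (intL_FTC (has_deriv_cst 0))// ?subrr//; exact: contC. Qed.

Lemma intL_ge0 f : (forall x, 0 <= x <= L -> 0 <= f x) -> 0 <= intL L f.
Proof.
by move=> f0; apply: Rintegral_ge0 => x /=; rewrite in_itv/=; exact: f0.
Qed.

Lemma le_intL f g : continuous f -> continuous g ->
  (forall x, 0 <= x <= L -> f x <= g x) -> intL L f <= intL L g.
Proof.
move=> cf cg fg; have := @intL_ge0 (fun x => g x + - f x).
rewrite intLD//; last exact: contN.
by rewrite intLN// subr_ge0; apply => x /fg; rewrite subr_ge0.
Qed.

Lemma has_deriv_const_eq0 F f (k : R) : has_deriv F f -> continuous f ->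
  (forall x, 0 <= x <= L -> F x = k) -> forall x, 0 <= x <= L -> f x = 0.
Proof.
move=> dF cf FE x /andP[x0 xL].
(* F is constant on one side only of an endpoint: the mean value theorem is applied on a short
   interval ending or starting at x, and L > 0 leaves room on at least one side. *)
wlog : / x != 0 \/ x != L; last move=> xx.
  by apply; have [->|] := eqVneq x 0; [right; rewrite lt_eqF|left].
apply/eqP/negPn/negP => fx0.
have : \forall t \near x, 0 < `|f t|.
  have cn : continuous (fun t => `|f t|).
    by move=> t; apply: cvg_norm; exact: cf.
  by apply: (cvgr_gt _ (cn x)); rewrite normr_gt0.
move=> /nbhs_ballP[e /= e0 fe].
have pos a b : 0 <= a -> a < b -> b <= L -> `|a - x| < e -> `|b - x| < e -> False.
  move=> a0 ab bL ae be.
  have [c] := MVT ab (fun x _ => dF x)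
    (continuous_subspaceT (has_deriv_cont dF)).
  rewrite in_itv/= => /andP[ac cb].
  rewrite !FE ?a0 ?bL ?(le_trans a0 (ltW ab)) ?(le_trans (ltW ab))// subrr.
  apply/eqP; rewrite eq_sym mulf_neq0 ?subr_eq0 ?(gt_eqF ab)//.
  rewrite -normr_gt0; apply: fe; rewrite /ball/= distrC.
  move: ae be; rewrite !ltr_norml => /andP[? ?] /andP[? ?].
  by apply/andP; split; lra.
case: xx => [x_neq0|x_neqL].
  apply: (pos (Num.max 0 (x - e / 2)) x) => //.
  - by rewrite le_max lexx.
  - by rewrite gt_max lt_neqAle eq_sym x_neq0 x0/= ltrBlDr ltrDl divr_gt0.
  - by rewrite ler0_norm ?subr_le0 ?ge_max ?x0/= ?lerBlDr ?lerDl ?divr_ge0 ?(ltW e0)//;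
      rewrite opprB ltrBlDl -ltrBlDr lt_max; apply/orP; right; lra.
  - by rewrite subrr normr0.
apply: (pos x (Num.min L (x + e / 2))) => //.
- by rewrite lt_min ltrDl divr_gt0// lt_neqAle x_neqL xL.
- by rewrite ge_min lexx.
- by rewrite subrr normr0.
- rewrite ger0_norm ?subr_ge0 ?le_min ?xL/= ?lerDl ?divr_ge0 ?(ltW e0)//.
  by rewrite ltrBlDl gt_min; apply/orP; right; lra.
Qed.

Lemma intL_eq0 f : continuous f -> (forall x, 0 <= x <= L -> 0 <= f x) ->
  intL L f = 0 -> forall x, 0 <= x <= L -> f x = 0.
Proof.
move=> cf f0; rewrite intL_prim => pL.
have dp := has_deriv_prim cf.
have p0 y : 0 <= y <= L -> prim f y = 0.
  move=> /andP[y0 yL].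
  have h1 : prim f y <= prim f L.
    apply: (has_deriv_nondecr dp) => // t /andP[t1 t2]; apply: f0.
    by rewrite t2 (le_trans y0).
  have h2 : prim f 0 <= prim f y.
    apply: (has_deriv_nondecr dp) => // t /andP[t1 t2]; apply: f0.
    by rewrite t1 (le_trans t2).
  by apply/eqP; rewrite eq_le -{1}pL h1 -[X in X <= _](prim0 f) h2.
by have := has_deriv_const_eq0 dp cf p0.
Qed.

(** Common core of the Cauchy-Schwarz inequalities for continuous functions and for L2 classes. *)
Lemma discriminant_le0 (a b c : R) : 0 <= c ->
  (forall s t, 0 <= s ^+ 2 * a + 2 * s * t * b + t ^+ 2 * c) -> b ^+ 2 <= a * c.
Proof.
move=> c0 q.
have [c_gt0|c_le0] := ltP 0 c.
  rewrite -subr_ge0 -(pmulr_rge0 _ c_gt0).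
  by have := q c (- b); lra.
have c_eq0 : c = 0 by lra.
rewrite c_eq0 mulr0; have [->|b0] := eqVneq b 0; first by rewrite expr0n.
(* With c = 0 the form is affine in t; this t gives it the value -1. *)
have := q 1 (- (a + 1) / b / 2); rewrite c_eq0 mulr0.
have -> : 2 * 1 * (- (a + 1) / b / 2) * b = - (a + 1) by field.
by lra.
Qed.

Lemma cauchy_schwarz f g : continuous f -> continuous g ->
  (intL L (fun x => f x * g x)) ^+ 2 <=
  intL L (fun x => f x ^+ 2) * intL L (fun x => g x ^+ 2).
Proof.
move=> cf cg.
have cff : continuous (fun x => f x ^+ 2) by exact: contX.
have cgg : continuous (fun x => g x ^+ 2) by exact: contX.
have cfg : continuous (fun x => f x * g x) by exact: contM.
set a := intL L (fun x => f x ^+ 2); set b := intL L _.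
set c := intL L (fun x => g x ^+ 2).
have a0 : 0 <= a by apply: intL_ge0 => x _; exact: sqr_ge0.
have c0 : 0 <= c by apply: intL_ge0 => x _; exact: sqr_ge0.
have q s t : 0 <= s ^+ 2 * a + t ^+ 2 * c + 2 * s * t * b.
  rewrite /a /b /c -!intLZ// -!intLD; try by cont.
  by apply: intL_ge0 => x _; have := sqr_ge0 (s * f x + t * g x); lra.
by apply: discriminant_le0 => // s t; have := q s t; lra.
Qed.

End integral_on_segment.

(** * The equation h' + h''' = z *)

Section bvp.
Variables (R : realType) (L : R).
Hypothesis L_gt0 : 0 < L.
Hypothesis cosL : cos L != 1.
Implicit Types (z h u : R -> R) (x : R).

Let cosL' : 1 - cos L != 0.
Proof. by rewrite subr_eq0 eq_sym. Qed.

Definition smooth3 h h1 h2 h3 :=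
  [/\ has_deriv h h1, has_deriv h1 h2, has_deriv h2 h3 & continuous h3].

Definition dirichlet h := h 0 = 0 /\ h L = 0.

(** The Dirichlet conditions kill the boundary terms with second derivatives; what remains is the
    defect of skew-symmetry of the operator, carried by the slopes at the two ends. *)
Lemma green u u1 u2 u3 h h1 h2 h3 :
  smooth3 u u1 u2 u3 -> smooth3 h h1 h2 h3 -> dirichlet u -> dirichlet h ->
  intL L (fun x => (u1 x + u3 x) * h x) + intL L (fun x => u x * (h1 x + h3 x))
  = u1 0 * h1 0 - u1 L * h1 L.
Proof.
move=> [du du1 du2 cu3] [dh dh1 dh2 ch3] [u0 uL] [h0 hL].
rewrite -intLD//; try by cont.
have d : has_deriv
    (fun x => u x * h x + u x * h2 x + u2 x * h x - u1 x * h1 x)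
    (fun x => (u1 x + u3 x) * h x + u x * (h1 x + h3 x)).
  by eapply has_deriv_eq; [deriv|move=> x /=; ring].
rewrite (intL_FTC L_gt0 d); last by cont.
by rewrite u0 uL h0 hL; ring.
Qed.

(** Duhamel's formula: h' + h''' = z is integrated once into h'' + h = [prim z], and this is the
    integral of sin(x - t) [prim z t] over [0, x], expanded to keep x out of the integrand. *)
Definition bvp_q z x :=
  sin x * prim (fun t => cos t * prim z t) x -
  cos x * prim (fun t => sin t * prim z t) x.

Definition bvp_q1 z x :=
  cos x * prim (fun t => cos t * prim z t) x +
  sin x * prim (fun t => sin t * prim z t) x.

(** The homogeneous solution 1 - cos has zero value and slope at 0; its coefficient is fixed by h(L)
    = 0, which is where cos L <> 1 enters. *)
Definition bvp_c z := - (bvp_q z L / (1 - cos L)).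

Definition bvp z x := bvp_c z * (1 - cos x) + bvp_q z x.
Definition bvp1 z x := bvp_c z * sin x + bvp_q1 z x.
Definition bvp2 z x := bvp_c z * cos x - bvp_q z x + prim z x.
Definition bvp3 z x := z x - bvp1 z x.

Lemma bvp_smooth z : continuous z ->
  smooth3 (bvp z) (bvp1 z) (bvp2 z) (bvp3 z).
Proof.
move=> cz.
have dP := has_deriv_prim cz.
have dC : has_deriv (prim (fun t => cos t * prim z t)) (fun t => cos t * prim z t).
  by apply: has_deriv_prim; cont.
have dS : has_deriv (prim (fun t => sin t * prim z t)) (fun t => sin t * prim z t).
  by apply: has_deriv_prim; cont.
split.
- eapply has_deriv_eq; first by rewrite /bvp /bvp_q; deriv.
  by move=> x /=; rewrite /bvp1 /bvp_q1; ring.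
- eapply has_deriv_eq; first by rewrite /bvp1 /bvp_q1; deriv.
  move=> x /=; rewrite /bvp2 /bvp_q; have := cos2Dsin2 x => e.
  rewrite -[prim z x in RHS]mul1r -e; ring.
- eapply has_deriv_eq; first by rewrite /bvp2 /bvp_q; deriv.
  by move=> x /=; rewrite /bvp3 /bvp1 /bvp_q1; ring.
- by rewrite /bvp3 /bvp1 /bvp_q1; cont.
Qed.

Lemma bvp_eq z x : bvp1 z x + bvp3 z x = z x.
Proof. by rewrite /bvp3; ring. Qed.

Lemma bvp_bc z : [/\ bvp z 0 = 0, bvp z L = 0 & bvp1 z 0 = 0].
Proof.
rewrite /bvp /bvp1 /bvp_q1 /bvp_q !prim0 sin0 cos0; split; try ring.
by rewrite /bvp_c /bvp_q; field.
Qed.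

Lemma prim_linear (a : R) z h x : continuous z -> continuous h ->
  prim (fun t => a * z t + h t) x = a * prim z x + prim h x.
Proof.
move=> cz ch; have dz := has_deriv_prim cz; have dh := has_deriv_prim ch.
have d : has_deriv (fun x => a * prim z x + prim h x) (fun t => a * z t + h t).
  by eapply has_deriv_eq; [deriv|move=> t /=; ring].
have d' : has_deriv (prim (fun t => a * z t + h t)) (fun t => a * z t + h t).
  by apply: has_deriv_prim; cont.
by have := has_deriv_unique 0 x d' d; rewrite !prim0; lra.
Qed.

Lemma bvp_linear (a : R) z h x : continuous z -> continuous h ->
  bvp (fun t => a * z t + h t) x = a * bvp z x + bvp h x.
Proof.
move=> cz ch.
have dz := has_deriv_prim cz; have dh := has_deriv_prim ch.
have pE (k : R -> R) y : continuous k ->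
    prim (fun t => k t * prim (fun t => a * z t + h t) t) y =
    a * prim (fun t => k t * prim z t) y + prim (fun t => k t * prim h t) y.
  move=> ck; rewrite -prim_linear; [|by cont..].
  by congr prim; apply/funext => t; rewrite prim_linear//; ring.
have qE y : bvp_q (fun t => a * z t + h t) y = a * bvp_q z y + bvp_q h y.
  rewrite /bvp_q !pE; [|exact: cont_sin|exact: cont_cos].
  move: (prim _ y) (prim _ y) (prim _ y) (prim _ y) => p1 p2 p3 p4; ring.
rewrite /bvp /bvp_c !qE.
move: (bvp_q z L) (bvp_q h L) (bvp_q z x) (bvp_q h x) => q1 q2 q3 q4; ring.
Qed.

(** Cauchy-Schwarz on [x, y], read off from a primitive of (l - u1)^2, where l is the mean slope:
    this primitive is nondecreasing. *)
Lemma holder_half u u1 x y : has_deriv u u1 -> continuous u1 ->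
  0 <= x -> x <= y -> y <= L ->
  (u y - u x) ^+ 2 <= (y - x) * intL L (fun t => u1 t ^+ 2).
Proof.
move=> du cu x0; rewrite le_eqVlt => /predU1P[->|xy] yL.
  by rewrite !subrr mul0r expr0n.
have dJ : has_deriv (prim (fun t => u1 t ^+ 2)) (fun t => u1 t ^+ 2).
  by apply: has_deriv_prim; cont.
have J0 : prim (fun t => u1 t ^+ 2) 0 <= prim (fun t => u1 t ^+ 2) x.
  by apply: (has_deriv_nondecr dJ) => // t _; exact: sqr_ge0.
have JL : prim (fun t => u1 t ^+ 2) y <= prim (fun t => u1 t ^+ 2) L.
  by apply: (has_deriv_nondecr dJ) => // t _; exact: sqr_ge0.
rewrite prim0 in J0; rewrite (intL_prim L_gt0).
pose l := (u y - u x) / (y - x).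
have yx : y - x != 0 by lra.
have lE : u y - u x = l * (y - x) by rewrite /l; field.
have d : has_deriv
    (fun t => l ^+ 2 * t + prim (fun t => u1 t ^+ 2) t + (- (2 * l)) * u t)
    (fun t => (l - u1 t) ^+ 2).
  by eapply has_deriv_eq; [deriv|move=> t /=; ring].
have := has_deriv_nondecr d (ltW xy) (fun t _ => sqr_ge0 _).
have e : l ^+ 2 * y - l ^+ 2 * x = l * u y - l * u x.
  by rewrite -!mulrBr lE; ring.
have -> : (u y - u x) ^+ 2 = (y - x) * ((u y - u x) * l).
  by rewrite expr2 {2}lE; ring.
move=> h; apply: ler_wpM2l; first by lra.
by move: h J0 JL e; lra.
Qed.

Lemma prim_bound (F : R -> R) (B : R) x : continuous F -> 0 <= B ->
  (forall t, 0 <= t <= L -> `|F t| <= B) -> 0 <= x <= L -> `|prim F x| <= L * B.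
Proof.
move=> cF B0 FB /andP[x0 xL]; have dF := has_deriv_prim cF.
have d1 : has_deriv (fun t => B * t + prim F t) (fun t => B + F t).
  by eapply has_deriv_eq; [deriv|move=> t /=; ring].
have d2 : has_deriv (fun t => B * t + - prim F t) (fun t => B - F t).
  by eapply has_deriv_eq; [deriv|move=> t /=; ring].
have h t : 0 <= t <= x -> - B <= F t <= B.
  by move=> /andP[t0 tx]; rewrite -ler_norml; apply: FB; rewrite t0 (le_trans tx).
have h1 := has_deriv_nondecr d1 x0 (fun t tx =>
  ltac:(move: (h t tx) => /andP[? ?]; lra)).
have h2 := has_deriv_nondecr d2 x0 (fun t tx =>
  ltac:(move: (h t tx) => /andP[? ?]; lra)).
have xB : B * x <= L * B by rewrite mulrC ler_wpM2r.
move: h1 h2; rewrite prim0 ler_norml => h1 h2.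
by apply/andP; split; lra.
Qed.

Lemma bvp_bound : exists2 K : R, 0 <= K & forall z (B : R), continuous z ->
  0 <= B -> intL L (fun x => z x ^+ 2) <= B ^+ 2 ->
  forall x, 0 <= x <= L -> `|bvp z x| <= K * B /\ `|bvp1 z x| <= K * B.
Proof.
have sL0 : 0 <= Num.sqrt L by exact: sqrtr_ge0.
have L0 := ltW L_gt0.
(* [Q * B] bounds the two terms of [bvp_q] together: |prim z| is at most sqrt L times B, and one
   more integration costs a factor L. *)
pose Q := 2 * (L * Num.sqrt L); have Q0 : 0 <= Q by rewrite /Q !mulr_ge0.
pose D := `|1 - cos L|^-1; have D0 : 0 <= D by rewrite /D invr_ge0.
exists (2 * (Q * D) + Q); first by rewrite addr_ge0// mulr_ge0// mulr_ge0.
move=> z B cz B0 zB x xL.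
have dz := has_deriv_prim cz.
have SB0 : 0 <= Num.sqrt L * B by rewrite mulr_ge0.
have PB t : 0 <= t <= L -> `|prim z t| <= Num.sqrt L * B.
  move=> /andP[t0 tL]; rewrite -ler_sqr ?nnegrE// real_normK ?num_real//.
  rewrite exprMn sqr_sqrtr//.
  have := holder_half dz cz (lexx 0) t0 tL; rewrite prim0 !subr0 => /le_trans; apply.
  by apply: ler_pM => //; apply: intL_ge0 => *; exact: sqr_ge0.
have kB (k : R -> R) : continuous k -> (forall t, `|k t| <= 1) ->
    forall t, 0 <= t <= L -> `|prim (fun t => k t * prim z t) t| <= L * (Num.sqrt L * B).
  move=> ck k1 t tL; apply: prim_bound => //; first by cont.
  move=> s sL'; rewrite normrM -[leRHS]mul1r.
  by apply: ler_pM => //; exact: PB.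
have s1 t : `|sin t : R| <= 1 by rewrite ler_norml sin_geN1 sin_le1.
have c1 t : `|cos t : R| <= 1 by rewrite ler_norml cos_geN1 cos_le1.
have Cb := kB _ (@cont_cos R) c1; have Sb := kB _ (@cont_sin R) s1.
have comb (a b c d : R) : `|a| <= 1 -> `|b| <= 1 -> `|c| <= L * (Num.sqrt L * B) ->
    `|d| <= L * (Num.sqrt L * B) -> `|a * c + b * d| <= Q * B.
  move=> a1 b1 cb db; apply: (le_trans (ler_normD _ _)); rewrite !normrM.
  have : `|a| * `|c| <= 1 * (L * (Num.sqrt L * B)) by exact: ler_pM.
  have : `|b| * `|d| <= 1 * (L * (Num.sqrt L * B)) by exact: ler_pM.
  by rewrite /Q; lra.
have qB t : 0 <= t <= L -> `|bvp_q z t| <= Q * B.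
  move=> tL; rewrite /bvp_q -mulNr; apply: comb => //; [|exact: Cb|exact: Sb].
  by rewrite normrN.
have q1B t : 0 <= t <= L -> `|bvp_q1 z t| <= Q * B.
  by move=> tL; rewrite /bvp_q1; apply: comb => //; [exact: Cb|exact: Sb].
have cB : `|bvp_c z| <= Q * D * B.
  rewrite /bvp_c normrN normrM normfV -/D mulrAC ler_wpM2r// qB// lexx.
  by rewrite L0.
have cB0 := le_trans (normr_ge0 _) cB.
split; rewrite /bvp /bvp1; apply: (le_trans (ler_normD _ _)); rewrite normrM.
  have : `|bvp_c z| * `|1 - cos x| <= Q * D * B * 2.
    apply: ler_pM => //; rewrite ler_norml; have := cos_geN1 x; have := cos_le1 x.
    by move=> *; apply/andP; split; lra.
  by have := qB x xL; lra.
have : `|bvp_c z| * `|sin x| <= Q * D * B * 1 by exact: ler_pM.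
by have := q1B x xL; lra.
Qed.

End bvp.

(** * Compactness *)

Section compactness.
Variables (R : realType) (L : R).
Hypothesis L_gt0 : 0 < L.

Lemma holder_continuous (w : R -> R) (C : R) : 0 < C ->
  (forall x y, x <= y -> (w y - w x) ^+ 2 <= C * (y - x)) -> continuous w.
Proof.
move=> C0 wC x; apply/cvgrPdist_le => /= e e0.
near=> t.
rewrite -ler_sqr ?nnegrE ?(ltW e0)// real_normK ?num_real//.
have h : (w x - w t) ^+ 2 <= C * `|x - t|.
  have [xt|/ltW tx] := leP x t; last by rewrite ger0_norm ?subr_ge0 ?wC.
  by rewrite distrC ger0_norm ?subr_ge0// -sqrrN opprB wC.
apply: (le_trans h); rewrite mulrC -ler_pdivlMr//.
near: t; apply/nbhs_ballP; exists (e ^+ 2 / C) => /=; first by rewrite divr_gt0// exprn_gt0.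
by move=> t /=; rewrite /ball/= => /ltW.
Unshelve. all: by end_near. Qed.

Lemma ultra_bounded_cvg (U : set_system nat) (UU : UltraFilter U)
    (s : nat -> R) (M : R) : (forall n, `|s n| <= M) ->
  exists p : R, forall e : R, 0 < e -> U [set n | `|s n - p| <= e].
Proof.
move=> sM.
have UF : ProperFilter U by exact: ultra_proper.
have [|p [_ clp]] := @segment_compact R (- M) M (s @ U) _.
  by apply: (@filterE _ U _ (s @^-1` _)) => n; rewrite /= in_itv/= -ler_norml.
exists p => e e0.
have [//|Uc] := in_ultra_setVsetC [set n | `|s n - p| <= e] UU.
have [q [/= qc qe]] : ([set x | e < `|x - p| ] `&` ball p e) !=set0.
  apply: clp; last exact: nbhsx_ballx.
  by apply: (@filterS _ U _ _ (s @^-1` _) _ Uc) => n /= /negP; rewrite -ltNge.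
by move: qe; rewrite /ball/= distrC => /(lt_trans qc); rewrite ltxx.
Qed.

(** Arzela-Ascoli for equi-Hoelder functions. An ultrafilter finer than the filter at infinity gives
    the limits at all points at once, without diagonal extraction; the Hoelder bound passes to the
    limit and makes the convergence uniform on a finite grid. *)
Lemma equiholder_compact (u : nat -> R -> R) (C : R) : 0 < C ->
  (forall n, u n 0 = 0) ->
  (forall n x y, 0 <= x -> x <= y -> y <= L ->
     (u n y - u n x) ^+ 2 <= C * (y - x)) ->
  exists w : R -> R, [/\ continuous w, w 0 = 0 &
    forall (e : R) N, 0 < e -> exists2 n, (N <= n)%N &
      forall x, 0 <= x <= L -> `|u n x - w x| <= e].
Proof.
move=> C0 u0 uC.
have [U [UU oU]] := @ultraFilterLemma nat \oo _.
have UF : ProperFilter U by exact: ultra_proper.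
(* The bounds hold on [0, L] only; composing with the projection onto [0, L] makes the limit
   continuous on R. *)
pose clamp (x : R) := Num.max 0 (Num.min x L).
have clampP x : 0 <= clamp x <= L.
  by rewrite /clamp le_max lexx ge_max (ltW L_gt0) ge_min lexx orbT.
have clampE x : 0 <= x <= L -> clamp x = x.
  by move=> /andP[x0 xL]; rewrite /clamp (min_idPl xL) (max_idPr x0).
have clamp_lip x y : x <= y -> 0 <= clamp y - clamp x <= y - x.
  move=> xy; rewrite /clamp /Num.max /Num.min.
  by repeat case: ifPn; rewrite -?leNgt => *; apply/andP; split; lra.
have ptw x : exists p : R, forall e : R, 0 < e -> U [set n | `|u n (clamp x) - p| <= e].
  apply: (@ultra_bounded_cvg _ _ _ (C * L + 1)) => n.
  have /andP[c0 cL] := clampP x.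
  have := uC n 0 (clamp x) (lexx 0) c0 cL; rewrite u0 !subr0 => h.
  have h2 : u n (clamp x) ^+ 2 <= C * L by apply: (le_trans h); rewrite ler_pM2l.
  have CL : 0 < C * L by exact: mulr_gt0.
  have := sqr_ge0 (u n (clamp x) - 1); have := sqr_ge0 (u n (clamp x) + 1).
  by rewrite ler_norml => *; apply/andP; split; lra.
pose w x := sval (cid (ptw x)).
have wP x e : 0 < e -> U [set n | `|u n (clamp x) - w x| <= e].
  by rewrite /w; case: (cid _) => p /= /[apply].
have w_hold x y : x <= y -> (w y - w x) ^+ 2 <= C * (y - x).
  move=> xy; rewrite leNgt; apply/negP => lt.
  pose d := (w y - w x) ^+ 2 - C * (y - x).
  have d0 : 0 < d by rewrite subr_gt0.
  pose B := `|w y - w x|.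
  have B0 : 0 <= B by exact: normr_ge0.
  (* Replacing w by u_n at both points lowers the square of the difference by at most 4 e B, which
     is less than the excess d. *)
  pose e := d / (4 * (B + 1)).
  have e0 : 0 < e by rewrite divr_gt0// mulr_gt0// ltr_pwDr.
  have eB : 4 * e * (B + 1) = d by rewrite /e; field; lra.
  have [n [/= n1 n2]] := filter_ex (filterI (wP x _ e0) (wP y _ e0)).
  have /andP[cd0 cd1] := clamp_lip x y xy.
  have /andP[c0 _] := clampP x; have /andP[_ cL] := clampP y.
  have hn : (u n (clamp y) - u n (clamp x)) ^+ 2 <= C * (y - x).
    apply: le_trans (uC n _ _ c0 _ cL) _; first by rewrite -subr_ge0.
    by rewrite ler_pM2l.
  have hB : `|w y - w x| <= `|u n (clamp y) - u n (clamp x)| + 2 * e.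
    have -> : w y - w x = (u n (clamp y) - u n (clamp x)) +
      ((u n (clamp x) - w x) - (u n (clamp y) - w y)) by ring.
    apply: (le_trans (ler_normD _ _)); rewrite lerD2l.
    by apply: (le_trans (ler_normB _ _)); lra.
  rewrite -[X in X <= _]real_normK ?num_real// in hn.
  have dE : d = B ^+ 2 - C * (y - x) by rewrite /B real_normK ?num_real.
  have := normr_ge0 (u n (clamp y) - u n (clamp x)).
  move: hn hB; rewrite -/B; move: (`|u n _ - _|) => A hn hB A0.
  have [BA|AB] := leP B A.
    have : B ^+ 2 <= A ^+ 2 by rewrite ler_sqr ?nnegrE.
    by lra.
  have : (B - A) * (B + A) <= 2 * e * (2 * B).
    by apply: ler_pM; lra.
  by lra.
have w_cont := holder_continuous C0 w_hold.
exists w; split => //.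
  apply/eqP; rewrite -normr_le0; apply/ler_addgt0Pl => e e0.
  have [n /=] := filter_ex (wP 0 _ e0).
  rewrite clampE ?u0 ?lexx ?(ltW L_gt0)//.
  by rewrite sub0r normrN addr0.
move=> e N e0.
(* Over one cell of length h both u_n and w vary by at most e / 3; the last third is the error at
   the left grid point. *)
pose h := (e / 3) ^+ 2 / C.
have e3 : 0 < e / 3 by lra.
have h0 : 0 < h by rewrite divr_gt0// exprn_gt0.
have Ch : C * h = (e / 3) ^+ 2 by rewrite /h; field; lra.
have unif (j : nat) : U [set n | forall x, 0 <= x <= L -> x <= h * j%:R ->
    `|u n x - w x| <= e].
  elim: j => [|j ih].
    apply: filterS (wP 0 _ e0) => n /= n0 x /andP[x0 xL]; rewrite mulr0 => x0'.
    have -> : x = 0 by apply/eqP; rewrite eq_le x0'.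
    by move: n0; rewrite clampE// lexx ltW.
  have hj0 : 0 <= h * j%:R by rewrite mulr_ge0// ltW.
  apply: filterS2 ih (wP (h * j%:R) _ e3) => n /= n1 n2 x xL xj.
  have [xj'|xj'] := leP x (h * j%:R); first exact: n1.
  have /andP[x0 xL'] := xL.
  move: n2; rewrite clampE; last by rewrite hj0 (le_trans (ltW xj')).
  move=> n2.
  have xh : x - h * j%:R <= h by move: xj; rewrite -natr1 mulrDr mulr1; lra.
  have small (a : R) : a ^+ 2 <= C * (x - h * j%:R) -> `|a| <= e / 3.
    move=> ah; rewrite -ler_sqr ?nnegrE// ?(ltW e3)// real_normK ?num_real//.
    by rewrite -Ch (le_trans ah)// ler_pM2l.
  have k1 := small _ (uC n _ _ hj0 (ltW xj') xL').
  have k2 := small _ (w_hold _ _ (ltW xj')).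
  have -> : u n x - w x = (u n x - u n (h * j%:R)) +
     ((u n (h * j%:R) - w (h * j%:R)) - (w x - w (h * j%:R))) by ring.
  apply: (le_trans (ler_normD _ _)).
  by have := ler_normB (u n (h * j%:R) - w (h * j%:R)) (w x - w (h * j%:R)); lra.
have [j Lj] : exists j : nat, L <= h * j%:R.
  exists (Num.truncn (L / h)).+1; rewrite mulrC -ler_pdivrMr//.
  by rewrite ltW// truncnS_gt.
have [n [/= n1 n2]] := filter_ex (filterI (unif j) (oU _ (nbhs_infty_ge N))).
exists n => // x xL; apply: n1 => //.
by rewrite (le_trans _ Lj)//; case/andP: xL.
Qed.

End compactness.

(** * Overdetermined eigenfunctions exist only for critical lengths *)

Section critical_lengths.
Variables (R : realType) (L : R).
Hypothesis L_gt0 : 0 < L.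

Lemma has_deriv_lin (c : R) : has_deriv (fun x => c * x) (fun=> c).
Proof. by eapply has_deriv_eq; [deriv|move=> x /=; ring]. Qed.

Lemma has_deriv_exp_lin (c : R) :
  has_deriv (fun x => expR (c * x)) (fun x => expR (c * x) * c).
Proof.
exact: (has_deriv_comp (fun s => is_derive_expR s) (has_deriv_lin c)).
Qed.

Lemma cos_eq1 (x : R) : 0 < x -> cos x = 1 ->
  exists2 k : nat, (0 < k)%N & x = 2 * pi * k%:R.
Proof.
move=> x0 cx.
have pi0 := pi_gt0 R.
pose k := Num.truncn (x / (2 * pi)).
have /andP[k1 k2] : k%:R <= x / (2 * pi) < k.+1%:R.
  by apply: truncn_itv; rewrite divr_ge0// ltW// mulr_gt0.
rewrite ler_pdivlMr ?mulr_gt0// in k1; rewrite ltr_pdivrMr ?mulr_gt0// -natr1 in k2.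
pose y := x - (pi *+ 2) *+ k.
have kE : (pi *+ 2) *+ k = k%:R * (2 * pi) :> R.
  by rewrite -mulrnA -[LHS]mulr_natl natrM; move: (pi : R) => p; ring.
have cy : cos y = 1.
  have := periodicn (@cosD2pi R) k y.
  by rewrite /y subrK cx => <-.
have y0 : 0 <= y by rewrite /y kE; lra.
have y2 : y < 2 * pi by rewrite /y kE; lra.
have [ypi|piy] := leP y pi.
  have yE : y = 0.
    by apply: cos_inj; rewrite ?in_itv/= ?y0 ?ypi ?lexx ?(ltW pi0)// cy cos0.
  have xE : x = 2 * pi * k%:R by move: yE; rewrite /y kE; lra.
  exists k => //; rewrite lt0n; apply/negP => /eqP k_eq0.
  by move: x0; rewrite xE k_eq0 mulr0 ltxx.
have /eqP : 2 * pi - y = 0.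
  apply: cos_inj; rewrite ?in_itv/= ?lexx ?(ltW pi0)//; first by apply/andP; split; lra.
  rewrite cos0 -[LHS]cosN opprB -[LHS]cosD2pi -[RHS]cy.
  by congr cos; rewrite -mulr_natl; lra.
by rewrite subr_eq0 => /eqP yE; move: y2; rewrite yE ltxx.
Qed.

(** The length 2 pi k is the critical one with l = k, since (k^2 + k k + k^2) / 3 = k^2. Away from
    critical lengths the boundary value problem above is thus solvable. *)
Lemma critical_cos : cos L = 1 -> critical_length L.
Proof.
move=> /(cos_eq1 L_gt0)[k k0 ->]; exists k, k; split => //.
have -> : (k ^ 2 + k * k + k ^ 2)%:R / 3 = k%:R ^+ 2 :> R.
  by rewrite !natrD ?natrX ?natrM; field.
by rewrite sqrtr_sqr ger0_norm.
Qed.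

(** Real and imaginary parts of a complex eigenfunction y = u + i v, with y' + y''' = - i mu y on
    [0, L] and y, y' vanishing at both ends. *)
Variables (u u1 u2 u3 v v1 v2 v3 : R -> R) (mu : R).
Hypotheses (su : smooth3 u u1 u2 u3) (sv : smooth3 v v1 v2 v3).
Hypotheses (Eu : forall x, 0 <= x <= L -> u1 x + u3 x = mu * v x)
           (Ev : forall x, 0 <= x <= L -> v1 x + v3 x = - mu * u x).
Hypotheses (bu : [/\ u 0 = 0, u1 0 = 0, u L = 0 & u1 L = 0])
           (bv : [/\ v 0 = 0, v1 0 = 0, v L = 0 & v1 L = 0]).
Hypothesis uv_neq0 : exists2 x, 0 <= x <= L & u x != 0.

(** Uniqueness for the Cauchy problem at 0. In the derivative of E, the sum of the squares of u, v
    and their first two derivatives, the equation cancels the products u1 u2 and v1 v2, leaving E'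
    <= (1 + |mu|) E, so that exp(- K t) E does not increase. *)
Lemma initial_curvature_neq0 : 0 < u2 0 ^+ 2 + v2 0 ^+ 2.
Proof.
have [du du1 du2 cu3] := su; have [dv dv1 dv2 cv3] := sv.
have [u00 u10 _ _] := bu; have [v00 v10 _ _] := bv.
rewrite lt_neqAle addr_ge0 ?sqr_ge0// andbT eq_sym.
apply/negP; rewrite paddr_eq0 ?sqr_ge0// !sqrf_eq0 => /andP[/eqP u20 /eqP v20].
have [x /andP[x0 xL] ux] := uv_neq0.
pose K := 3 + `|mu|.
pose E t := u t ^+ 2 + u1 t ^+ 2 + u2 t ^+ 2 + v t ^+ 2 + v1 t ^+ 2 + v2 t ^+ 2.
pose E' t := 2 * (u t * u1 t + u1 t * u2 t + u2 t * u3 t +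
  v t * v1 t + v1 t * v2 t + v2 t * v3 t).
have dexp := has_deriv_exp_lin (- K).
have dE : has_deriv (fun t => - (expR (- K * t) * E t))
    (fun t => expR (- K * t) * (K * E t - E' t)).
  by rewrite /E; eapply has_deriv_eq; [deriv|move=> t /=; rewrite /E'; ring].
have E0 : E 0 = 0 by rewrite /E u00 u10 u20 v00 v10 v20; ring.
have : - (expR (- K * 0) * E 0) <= - (expR (- K * x) * E x).
  apply: (has_deriv_nondecr dE x0) => t /andP[t0 tx].
  rewrite mulr_ge0 ?expR_ge0// subr_ge0.
  have tL : 0 <= t <= L by rewrite t0 (le_trans tx).
  have eu : u3 t = mu * v t - u1 t by rewrite -Eu//; ring.
  have ev : v3 t = - mu * u t - v1 t by rewrite -Ev//; ring.
  have am (a b : R) : `|2 * (a * b)| <= a ^+ 2 + b ^+ 2.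
    rewrite ler_norml; have := sqr_ge0 (a - b); have := sqr_ge0 (a + b).
    by move=> ? ?; apply/andP; split; lra.
  have amu (a b : R) : `|2 * (mu * (a * b))| <= `|mu| * (a ^+ 2 + b ^+ 2).
    by rewrite mulrCA normrM ler_wpM2l.
  rewrite /E' /E /K eu ev.
  have := am (u t) (u1 t); have := am (v t) (v1 t).
  have := amu (v t) (u2 t); have := amu (u t) (v2 t); have := normr_ge0 mu.
  rewrite !ler_norml.
  move: (u t) (u1 t) (u2 t) (v t) (v1 t) (v2 t) `|mu| => a a1 a2 b b1 b2 m m0.
  have := sqr_ge0 a; have := sqr_ge0 b; have := sqr_ge0 a1; have := sqr_ge0 b1.
  have := sqr_ge0 a2; have := sqr_ge0 b2.
  have := mulr_ge0 m0 (sqr_ge0 a1); have := mulr_ge0 m0 (sqr_ge0 b1).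
  move=> ? ? ? ? ? ? ? ? /andP[? ?] /andP[? ?] /andP[? ?] /andP[? ?].
  by lra.
rewrite E0 mulr0 oppr0 oppr_ge0 pmulr_rle0 ?expR_gt0// /E => Ex.
have := sqr_ge0 (u1 x); have := sqr_ge0 (u2 x); have := sqr_ge0 (v x).
have := sqr_ge0 (v1 x); have := sqr_ge0 (v2 x).
have : 0 < u x ^+ 2 by rewrite exprn_even_gt0.
by lra.
Qed.

(** The test function p + i q solves the same equation as y, so the integrals cancel by
    skew-symmetry; the boundary conditions on y leave only the real part of y'' times the conjugate
    of p + i q. *)
Lemma uv_test p p1 p2 p3 q q1 q2 q3 :
  smooth3 p p1 p2 p3 -> smooth3 q q1 q2 q3 ->
  (forall x, p1 x + p3 x = mu * q x) -> (forall x, q1 x + q3 x = - mu * p x) ->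
  u2 L * p L + v2 L * q L = u2 0 * p 0 + v2 0 * q 0.
Proof.
move=> [dp dp1 dp2 cp3] [dq dq1 dq2 cq3] Ep Eq.
have [du du1 du2 cu3] := su; have [dv dv1 dv2 cv3] := sv.
have [u00 u10 uL u1L] := bu; have [v00 v10 vL v1L] := bv.
have d : has_deriv
    (fun x => u x * p x + u x * p2 x + u2 x * p x - u1 x * p1 x +
              (v x * q x + v x * q2 x + v2 x * q x - v1 x * q1 x))
    (fun x => (u1 x + u3 x) * p x + u x * (p1 x + p3 x) +
              ((v1 x + v3 x) * q x + v x * (q1 x + q3 x))).
  by eapply has_deriv_eq; [deriv|move=> x /=; ring].
have := intL_FTC L_gt0 d.
rewrite (@eq_intL _ _ _ (fun=> 0)); last first.
  by move=> x xL; rewrite Eu// Ev// Ep Eq; ring.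
rewrite intL0// u00 u10 uL u1L v00 v10 vL v1L => /(_ _)/esym.
have c : continuous (fun x => (u1 x + u3 x) * p x + u x * (p1 x + p3 x) +
              ((v1 x + v3 x) * q x + v x * (q1 x + q3 x))) by cont.
by move=> /(_ c); lra.
Qed.

Let U0 := u2 0. Let UL := u2 L. Let V0 := v2 0. Let VL := v2 L.

(* [p + i q = exp((al + i be) x)], where [r = al + i be] solves
   [r^3 + r + i mu = 0]. *)
Lemma exp_test (al be : R) : al ^+ 3 - 3 * al * be ^+ 2 + al = 0 ->
  3 * al ^+ 2 * be - be ^+ 3 + be = - mu ->
  expR (al * L) * (UL * cos (be * L) + VL * sin (be * L)) = U0 /\
  expR (al * L) * (VL * cos (be * L) - UL * sin (be * L)) = V0.
Proof.
move=> re im.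
have dexp := has_deriv_exp_lin al; have dbe := has_deriv_lin be.
have ds : has_deriv (fun x => sin (be * x)) (fun x => cos (be * x) * be).
  exact: (has_deriv_comp (@has_deriv_sin R) dbe).
have dc : has_deriv (fun x => cos (be * x)) (fun x => - sin (be * x) * be).
  exact: (has_deriv_comp (@has_deriv_cos R) dbe).
(* the functions [exp(al x) (a cos(be x) + b sin(be x))] are stable by derivation *)
pose F (ab : R * R) x := expR (al * x) * (ab.1 * cos (be * x) + ab.2 * sin (be * x)).
pose D (ab : R * R) := (al * ab.1 + be * ab.2, al * ab.2 - be * ab.1).
have dF ab : has_deriv (F ab) (F (D ab)).
  rewrite /F; eapply has_deriv_eq; [deriv|move=> x /=].
  by move: (expR _) (cos _) (sin _) => e c s; ring.
have sF ab : smooth3 (F ab) (F (D ab)) (F (D (D ab))) (F (D (D (D ab)))).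
  by split; [exact: dF|exact: dF|exact: dF|exact: has_deriv_cont (dF _)].
have key a b x : F (D (a, b)) x + F (D (D (D (a, b)))) x = mu * F (- b, a) x.
  rewrite /F /D /=; move: (expR _) (cos _) (sin _) => e c s.
  transitivity (e * (c * ((al ^+ 3 - 3 * al * be ^+ 2 + al) * a +
     (3 * al ^+ 2 * be - be ^+ 3 + be) * b) +
     s * ((al ^+ 3 - 3 * al * be ^+ 2 + al) * b -
     (3 * al ^+ 2 * be - be ^+ 3 + be) * a))); first by ring.
  by rewrite re im; ring.
have FN a b x : F (- a, - b) x = - F (a, b) x by rewrite /F /=; ring.
have F0 ab : F ab 0 = ab.1 by rewrite /F !mulr0 expR0 cos0 sin0; ring.
have t1 := uv_test (sF (1, 0)) (sF (0, 1)).
have t2 := uv_test (sF (0, -1)) (sF (1, 0)).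
rewrite /UL /VL /U0 /V0; split.
  transitivity (u2 L * F (1, 0) L + v2 L * F (0, 1) L); first by rewrite /F /=; ring.
  rewrite t1 ?F0 /=; [ring| |] => x; first by rewrite key oppr0.
  by rewrite key mulNr -mulrN -FN oppr0.
transitivity (u2 L * F (0, -1) L + v2 L * F (1, 0) L); first by rewrite /F /=; ring.
rewrite t2 ?F0 /=; [ring| |] => x; first by rewrite key opprK.
by rewrite key mulNr -mulrN -FN oppr0 opprK.
Qed.

(** Characteristic equation for a purely imaginary exponent r = i rho. *)
Definition char_root (rho : R) := rho ^+ 3 - rho = mu.

Lemma root_test rho : char_root rho ->
  UL * cos (rho * L) + VL * sin (rho * L) = U0 /\
  VL * cos (rho * L) - UL * sin (rho * L) = V0.
Proof.
rewrite /char_root => rr; have := @exp_test 0 rho.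
by rewrite mul0r expR0 !mul1r; apply; [ring|rewrite -rr; ring].
Qed.

Lemma norm_L rho : char_root rho -> UL ^+ 2 + VL ^+ 2 = U0 ^+ 2 + V0 ^+ 2.
Proof.
move=> /root_test[<- <-]; have e := cos2Dsin2 (rho * L).
transitivity ((UL ^+ 2 + VL ^+ 2) * (cos (rho * L) ^+ 2 + sin (rho * L) ^+ 2)).
  by rewrite e mulr1.
by move: (cos _) (sin _) => c s; ring.
Qed.

(** At a double root x exp(i rho x) is a solution as well. It vanishes at 0, so testing with it
    gives y''(L) = 0 up to a phase, hence y''(0) = 0 by [root_test]: a contradiction. *)
Lemma simple_root rho : char_root rho -> 3 * rho ^+ 2 != 1.
Proof.
move=> rr; apply/eqP => r1.
have dbe := has_deriv_lin rho.
have ds : has_deriv (fun x => sin (rho * x)) (fun x => cos (rho * x) * rho).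
  exact: (has_deriv_comp (@has_deriv_sin R) dbe).
have dc : has_deriv (fun x => cos (rho * x)) (fun x => - sin (rho * x) * rho).
  exact: (has_deriv_comp (@has_deriv_cos R) dbe).
pose F (a : R * R * (R * R)) x :=
  (a.1.1 + a.2.1 * x) * cos (rho * x) + (a.1.2 + a.2.2 * x) * sin (rho * x).
pose D (a : R * R * (R * R)) := ((a.2.1 + rho * a.1.2, a.2.2 - rho * a.1.1),
  (rho * a.2.2, - rho * a.2.1)).
have dF a : has_deriv (F a) (F (D a)).
  rewrite /F; eapply has_deriv_eq; [deriv|move=> x /=].
  by move: (cos _) (sin _) => co si; ring.
have sF a : smooth3 (F a) (F (D a)) (F (D (D a))) (F (D (D (D a)))).
  by split; [exact: dF|exact: dF|exact: dF|exact: has_deriv_cont (dF _)].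
have key c d x : F (D (0, 0, (c, d))) x + F (D (D (D (0, 0, (c, d))))) x =
    mu * F (0, 0, (- d, c)) x.
  rewrite -rr /F /D /=; move: (cos _) (sin _) => co si.
  transitivity ((1 - 3 * rho ^+ 2) * (c * co + d * si) +
    x * (rho ^+ 3 - rho) * (c * si - d * co)); first by ring.
  by rewrite r1; ring.
have FN c d x : F (0, 0, (- c, - d)) x = - F (0, 0, (c, d)) x.
  by rewrite /F /=; ring.
have F0 c d : F (0, 0, (c, d)) 0 = 0 by rewrite /F /= !mulr0; ring.
have t1 := uv_test (sF (0, 0, (1, 0))) (sF (0, 0, (0, 1))).
have t2 := uv_test (sF (0, 0, (0, -1))) (sF (0, 0, (1, 0))).
have N0 := initial_curvature_neq0.
have {}t1 : L * (UL * cos (rho * L) + VL * sin (rho * L)) = 0.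
  transitivity (u2 L * F (0, 0, (1, 0)) L + v2 L * F (0, 0, (0, 1)) L).
    by rewrite /F /UL /VL /=; ring.
  rewrite t1 ?F0; [ring| |] => x; first by rewrite key oppr0.
  by rewrite key mulNr -mulrN -FN oppr0.
have {}t2 : L * (VL * cos (rho * L) - UL * sin (rho * L)) = 0.
  transitivity (u2 L * F (0, 0, (0, -1)) L + v2 L * F (0, 0, (1, 0)) L).
    by rewrite /F /UL /VL /=; ring.
  rewrite t2 ?F0; [ring| |] => x; first by rewrite key opprK.
  by rewrite key mulNr -mulrN -FN oppr0 opprK.
have [e e'] := root_test rr.
move: t1 t2; rewrite e e' => /eqP; rewrite mulf_eq0 gt_eqF//= => /eqP u00.
move=> /eqP; rewrite mulf_eq0 gt_eqF//= => /eqP v00.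
by move: N0; rewrite -/U0 -/V0 u00 v00 expr0n addr0 ltxx.
Qed.

(** By [root_test], y''(0) = exp(- i rho L) y''(L) for every real root, with y''(L) <> 0; so exp(i
    rho L) is the same for all of them. *)
Lemma roots_cos rho rho' : char_root rho -> char_root rho' ->
  cos ((rho - rho') * L) = 1.
Proof.
move=> r r'; have [e1 e2] := root_test r; have [e1' e2'] := root_test r'.
have N := norm_L r; have N0 := initial_curvature_neq0.
rewrite -/U0 -/V0 -N in N0.
rewrite mulrBl cosB.
have := cos2Dsin2 (rho * L); have := cos2Dsin2 (rho' * L).
move: e1 e2 e1' e2'.
move: (cos (rho * L)) (sin (rho * L)) (cos (rho' * L)) (sin (rho' * L)) => c s c' s'.
move=> e1 e2 e1' e2' n' n.
have : (UL ^+ 2 + VL ^+ 2) * ((c - c') ^+ 2 + (s - s') ^+ 2) = 0.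
  transitivity (((UL * c + VL * s) - (UL * c' + VL * s')) ^+ 2 +
    ((VL * c - UL * s) - (VL * c' - UL * s')) ^+ 2); first by ring.
  by rewrite e1 e2 e1' e2' !subrr expr0n addr0.
move=> /eqP; rewrite mulf_eq0 gt_eqF//= => /eqP; lra.
Qed.

(** The gaps b - a and c - b are 2 pi k / L and 2 pi l / L, while Vieta's relations give (b - a)^2 +
    (b - a)(c - b) + (c - b)^2 = 3. *)
Lemma critical_of_roots (a b c : R) : char_root a -> char_root b -> char_root c ->
  a < b -> b < c -> a + b + c = 0 -> a * b + b * c + c * a = -1 ->
  critical_length L.
Proof.
move=> ra rb rc ab bc s1 s2.
have baL : 0 < (b - a) * L by rewrite mulr_gt0// subr_gt0.
have cbL : 0 < (c - b) * L by rewrite mulr_gt0// subr_gt0.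
have [k k0 kE] := cos_eq1 baL (roots_cos rb ra).
have [l l0 lE] := cos_eq1 cbL (roots_cos rc rb).
exists k, l; split => //.
have pi0 := pi_gt0 R.
have E : L ^+ 2 = (2 * pi) ^+ 2 * ((k ^ 2 + k * l + l ^ 2)%:R / 3).
  have e3 : (b - a) ^+ 2 + (b - a) * (c - b) + (c - b) ^+ 2 = 3.
    transitivity ((a + b + c) ^+ 2 - 3 * (a * b + b * c + c * a)); first by ring.
    by rewrite s1 s2; ring.
  have e3L : L ^+ 2 * 3 = ((b - a) * L) ^+ 2 + (b - a) * L * ((c - b) * L) +
      ((c - b) * L) ^+ 2.
    by rewrite -[in LHS]e3; ring.
  rewrite kE lE in e3L.
  rewrite !natrD !natrX natrM; move: e3L; move: (pi : R) => p e3L.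
  transitivity (L ^+ 2 * 3 / 3); first by field.
  by rewrite e3L; field.
rewrite -[LHS]ger0_norm ?(ltW L_gt0)// -sqrtr_sqr E sqrtrM ?sqr_ge0//.
by rewrite sqrtr_sqr ger0_norm// mulr_ge0// ltW.
Qed.

Lemma char_root_exists : exists rho, char_root rho.
Proof.
have m0 := normr_ge0 mu; have := ler_norm mu; have := ler_norm (- mu).
rewrite normrN => m1 m2.
pose M := `|mu| + 2.
have c : continuous (fun x : R => x ^+ 3 - x) by cont.
have h : M <= M ^+ 3 - M.
  have : 0 <= M * (M ^+ 2 - 4) by rewrite mulr_ge0// /M; nra.
  by rewrite /M; nra.
have [||r _ rE] := @IVT _ (fun x => x ^+ 3 - x) (- M) M mu _
  (continuous_subspaceT c); first by rewrite /M; lra.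
  rewrite ge_min le_max; apply/andP; split; apply/orP; [left|right].
    by rewrite /M in h *; lra.
  by rewrite /M in h *; lra.
by exists r.
Qed.

Lemma unobservable_critical : critical_length L.
Proof.
have [r rr] := char_root_exists.
have N := norm_L rr; have N0 := initial_curvature_neq0; rewrite -/U0 -/V0 in N0.
have rS := simple_root rr.
have quad x : x ^+ 2 + r * x + r ^+ 2 = 1 -> char_root x.
  move=> xE; rewrite /char_root -rr.
  transitivity ((x - r) * (x ^+ 2 + r * x + r ^+ 2) - x + r ^+ 3); first by ring.
  by rewrite xE; ring.
(* Discriminant of x^2 + r x + r^2 - 1, whose zeros are the other two roots of the cubic. *)
pose disc := 4 - 3 * r ^+ 2.
have [d0|d0] := ltP disc 0.
  pose b := Num.sqrt (- disc / 4).
  have b0 : 0 < b by rewrite sqrtr_gt0; lra.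
  have b2 : b ^+ 2 = - disc / 4 by rewrite sqr_sqrtr//; lra.
  (* A root off the real axis gives an exponential with modulus exp(b L) > 1 at L, against |y''(L)|
     = |y''(0)|, which the real root r provides. *)
  have [||e1 e2] := @exp_test b (- r / 2).
  - transitivity (b * (b ^+ 2 - 3 * (- r / 2) ^+ 2 + 1)); first by ring.
    by rewrite b2 /disc; field.
  - transitivity (- r / 2 * (3 * b ^+ 2 - (- r / 2) ^+ 2 + 1)); first by ring.
    by rewrite b2 -rr /disc; field.
  have e_gt1 : 1 < expR (b * L) by rewrite expR_gt1 mulr_gt0.
  have := cos2Dsin2 (- r / 2 * L).
  move: e1 e2 e_gt1; move: (expR _) (cos _) (sin _) => e co si e1 e2 e_gt1 cs.
  have : U0 ^+ 2 + V0 ^+ 2 = e ^+ 2 * (U0 ^+ 2 + V0 ^+ 2).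
    rewrite -[in RHS]N -[X in _ = _ * X]mulr1 -cs -e1 -e2; ring.
  move=> eN; have : 0 < (e ^+ 2 - 1) * (U0 ^+ 2 + V0 ^+ 2).
    by rewrite mulr_gt0// subr_gt0 exprn_egt1.
  by move: eN N0; lra.
pose s := Num.sqrt disc; have s0 : 0 <= s by exact: sqrtr_ge0.
have sE : s ^+ 2 = disc by rewrite sqr_sqrtr.
pose p := (- r + s) / 2; pose m := (- r - s) / 2.
have rp : char_root p.
  apply: quad; transitivity ((s ^+ 2 + 3 * r ^+ 2) / 4); first by rewrite /p; field.
  by rewrite sE /disc; field.
have rm : char_root m.
  apply: quad; transitivity ((s ^+ 2 + 3 * r ^+ 2) / 4); first by rewrite /m; field.
  by rewrite sE /disc; field.
(* If s = 0, then p is a double root. *)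
have s_neq0 : s != 0.
  apply: contraNneq (simple_root rp) => s_eq0.
  have : 3 * r ^+ 2 = 4 by move: sE; rewrite s_eq0 expr0n /disc/=; lra.
  by rewrite /p s_eq0 => r4; apply/eqP; lra.
have s_gt0 : 0 < s by rewrite lt_neqAle eq_sym s_neq0.
have mp : m < p by rewrite /m /p; lra.
have sum : m + p + r = 0 by rewrite /m /p; field.
have prod : m * p + p * r + r * m = -1.
  transitivity (- (s ^+ 2 + 3 * r ^+ 2) / 4); first by rewrite /m /p; field.
  by rewrite sE /disc; field.
have rp_neq : r != p.
  apply: contraNneq rS => rpE.
  have mE : m = - (2 * r) by move: sum; rewrite -rpE; lra.
  by move: prod; rewrite mE -rpE => h; apply/eqP; lra.
have rm_neq : r != m.
  apply: contraNneq rS => rmE.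
  have pE : p = - (2 * r) by move: sum; rewrite -rmE; lra.
  by move: prod; rewrite pE -rmE => h; apply/eqP; lra.
move: sum prod mp rp rm rp_neq rm_neq; move: p m => p m sum prod mp rp rm rp_neq rm_neq.
have [rlm|mlr] := ltP r m; first by apply: (critical_of_roots rr rm rp) => //; lra.
have {}mlr : m < r by rewrite lt_neqAle eq_sym rm_neq.
have [rlp|plr] := ltP r p; first by apply: (critical_of_roots rm rr rp) => //; lra.
have {}plr : p < r by rewrite lt_neqAle eq_sym rp_neq.
by apply: (critical_of_roots rm rp rr).
Qed.

End critical_lengths.

(** * Observability by finitely many moments *)

Section inner_product.
Variables (R : realType) (L : R).
Hypothesis L_gt0 : 0 < L.
Implicit Types (f g z h u w : R -> R) (x : R).

Definition ip u w := intL L (fun x => u x * w x).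

Lemma ipC u w : ip u w = ip w u.
Proof. by apply: eq_intL => x _; rewrite mulrC. Qed.

Lemma ipD u w h (a : R) : continuous u -> continuous w -> continuous h ->
  ip (fun x => a * u x + w x) h = a * ip u h + ip w h.
Proof.
move=> cu cw ch; rewrite /ip -intLZ//; last by cont.
rewrite -intLD//; try by cont.
by apply: eq_intL => x _; ring.
Qed.

Lemma ipZ u h (a : R) : continuous u -> continuous h ->
  ip (fun x => a * u x) h = a * ip u h.
Proof.
move=> cu ch; rewrite /ip -intLZ//; last by cont.
by apply: eq_intL => x _; ring.
Qed.

Lemma ip_ge0 u : 0 <= ip u u.
Proof. by apply: intL_ge0 => x _; rewrite -expr2 sqr_ge0. Qed.

Lemma ip_eq0 u : continuous u -> ip u u = 0 -> forall x, 0 <= x <= L -> u x = 0.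
Proof.
move=> cu uu x xL.
have cuu : continuous (fun x => u x * u x) by cont.
have := intL_eq0 L_gt0 cuu (fun y _ => _) uu xL.
move=> /(_ (fun y => ltac:(by rewrite -expr2 sqr_ge0))) /eqP.
by rewrite mulf_eq0 orbb => /eqP.
Qed.

Lemma intL_sqr u : intL L (fun x => u x ^+ 2) = ip u u.
Proof. by apply: eq_intL => x _; rewrite expr2. Qed.

Lemma ip_cs u w : continuous u -> continuous w -> ip u w ^+ 2 <= ip u u * ip w w.
Proof.
move=> cu cw; by have := cauchy_schwarz L_gt0 cu cw; rewrite !intL_sqr.
Qed.

Lemma ip_small u (e : R) : continuous u ->
  (forall x, 0 <= x <= L -> `|u x| <= e) -> ip u u <= e ^+ 2 * L.
Proof.
move=> cu ue; apply: (@le_trans _ _ (intL L (fun=> e ^+ 2))).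
  apply: le_intL => //; try by cont.
  by move=> x xL; rewrite -expr2 -real_normK ?num_real// lerXn2r ?nnegrE// ?(le_trans _ (ue x xL)) ?ue.
have d : has_deriv (fun x => e ^+ 2 * x) (fun=> e ^+ 2) by exact: has_deriv_lin.
by rewrite (intL_FTC L_gt0 d) ?mulr0 ?subr0//; cont.
Qed.

Lemma le0_small (x C : R) : 0 <= C -> (forall e, 0 < e -> e < 1 -> x <= C * e) -> x <= 0.
Proof.
move=> C0 xC; rewrite leNgt; apply/negP => x0.
pose e := x / (C + x + 1).
have D0 : 0 < C + x + 1 by lra.
have e0 : 0 < e by rewrite divr_gt0.
have eE : e * (C + x + 1) = x by rewrite /e; field; lra.
have e1 : e < 1 by rewrite /e ltr_pdivrMr//; lra.
by have := xC e e0 e1; have := mulr_gt0 e0 x0; lra.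
Qed.

Lemma ip_sub_small u w (e : R) : continuous u -> continuous w ->
  (forall x, 0 <= x <= L -> `|u x - w x| <= e) ->
  ip (fun x => -1 * u x + w x) (fun x => -1 * u x + w x) <= e ^+ 2 * L.
Proof.
move=> cu cw h; apply: ip_small => [|x /h]; first by cont.
by rewrite distrC; apply: le_trans; rewrite mulN1r addrC.
Qed.

Lemma ip_near u w h (e : R) : continuous u -> continuous w -> continuous h ->
  (forall x, 0 <= x <= L -> `|u x - w x| <= e) ->
  (ip w h - ip u h) ^+ 2 <= e ^+ 2 * L * ip h h.
Proof.
move=> cu cw ch ue.
have -> : ip w h - ip u h = ip (fun x => -1 * u x + w x) h by rewrite ipD//; ring.
have cd : continuous (fun x => -1 * u x + w x) by cont.
apply: (le_trans (ip_cs cd ch)); rewrite ler_wpM2r ?ip_ge0//.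
exact: ip_sub_small.
Qed.

Lemma ip_sum2 f g : continuous f -> continuous g ->
  ip (fun x => f x + g x) (fun x => f x + g x) <= 2 * ip f f + 2 * ip g g.
Proof.
move=> cf cg; have cfg : continuous (fun x => f x + g x) by cont.
have cfg' : continuous (fun x => f x - g x) by cont.
have h := ip_ge0 (fun x => -1 * g x + f x).
have cN : continuous (fun x => -1 * g x + f x) by cont.
have cP : continuous (fun x => 1 * g x + f x) by cont.
have -> : (fun x => f x + g x) = (fun x => 1 * g x + f x).
  by apply/funext => x; rewrite mul1r addrC.
move: h; rewrite !ipD// !(ipC _ (fun x => _ * g x + f x)) !ipD// (ipC f g).
by move: (ip g g) (ip g f) (ip f f) => X Y Z; lra.
Qed.

End inner_product.

(** * The functions g_n and the inverse of A *)

Section chains.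
Variables (R : realType) (L : R).
Hypothesis L_gt0 : 0 < L.
Hypothesis cosL : cos L != 1.
Implicit Types (f g z h u w : R -> R) (x : R).

Let cosL' : 1 - cos L != 0.
Proof. by rewrite subr_eq0 eq_sym. Qed.

(** Makes sin x + beta (1 - cos x), which is g_0, vanish at L. *)
Let beta : R := - sin L / (1 - cos L).

Fixpoint chain (n : nat) : R -> R :=
  if n is m.+1 then bvp L (chain m) else fun x => sin x + beta * (1 - cos x).

Definition chain1 n : R -> R :=
  if n is m.+1 then bvp1 L (chain m) else fun x => cos x + beta * sin x.

Definition chain2 n : R -> R :=
  if n is m.+1 then bvp2 L (chain m) else fun x => - sin x + beta * cos x.

Definition chain3 n : R -> R :=
  if n is m.+1 then bvp3 L (chain m) else fun x => - cos x - beta * sin x.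

Lemma chain_smooth n : smooth3 (chain n) (chain1 n) (chain2 n) (chain3 n).
Proof.
elim: n => [|n [dn _ _ _]] /=; last by apply: bvp_smooth; exact: has_deriv_cont dn.
split; last by rewrite /chain3; cont.
- by eapply has_deriv_eq; [deriv|move=> x /=; ring].
- by rewrite /chain1; eapply has_deriv_eq; [deriv|move=> x /=; ring].
- by rewrite /chain2; eapply has_deriv_eq; [deriv|move=> x /=; ring].
Qed.

Lemma chain_dirichlet n : dirichlet L (chain n).
Proof.
case: n => [|n]; last by have [? ? _] := bvp_bc cosL (chain n).
by split; rewrite /= ?sin0 ?cos0 /beta; [ring|field].
Qed.

Lemma chain1_0 n : chain1 n 0 = (n == 0)%:R.
Proof.
case: n => [|n] /=; last by have [_ _ ->] := bvp_bc cosL (chain n).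
by rewrite sin0 cos0 mulr0 addr0.
Qed.

Lemma chain_eq n x : chain1 n x + chain3 n x = if n is m.+1 then chain m x else 0.
Proof. by case: n => [|n] /=; [ring|rewrite bvp_eq]. Qed.

(** The inverse of A. Its derivative condition sits at L instead of 0, and the reflection x -> L -
    x, which changes the sign of odd derivatives, reduces it to [bvp]. *)
Definition rbvp z x := bvp L (fun t => z (L - t)) (L - x).
Definition rbvp1 z x := - bvp1 L (fun t => z (L - t)) (L - x).
Definition rbvp2 z x := bvp2 L (fun t => z (L - t)) (L - x).
Definition rbvp3 z x := - bvp3 L (fun t => z (L - t)) (L - x).

Let d_refl : has_deriv (fun x => L - x) (fun=> -1).
Proof. by eapply has_deriv_eq; [deriv|move=> x /=; ring]. Qed.

Let cont_refl z : continuous z -> continuous (fun x => z (L - x)).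
Proof.
move=> cz x; apply: continuous_comp; last exact: cz.
exact: (has_deriv_cont d_refl).
Qed.

Lemma intL_refl z : continuous z -> intL L (fun x => z (L - x)) = intL L z.
Proof.
move=> cz; have d : has_deriv (fun x => - prim z (L - x)) (fun x => z (L - x)).
  refine (has_deriv_eq (has_derivN (has_deriv_comp (has_deriv_prim cz) d_refl)) _).
  by move=> x /=; ring.
rewrite (intL_FTC L_gt0 d); last exact: cont_refl.
by rewrite subrr subr0 prim0 intL_prim//; ring.
Qed.

Lemma rbvp_smooth z : continuous z -> smooth3 (rbvp z) (rbvp1 z) (rbvp2 z) (rbvp3 z).
Proof.
move=> cz; have [d0 d1 d2 c3] := bvp_smooth L (cont_refl cz); split.
- refine (has_deriv_eq (has_deriv_comp d0 d_refl) _) => x; by rewrite mulrN1.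
- refine (has_deriv_eq (has_derivN (has_deriv_comp d1 d_refl)) _) => x.
  by rewrite mulrN1 opprK.
- refine (has_deriv_eq (has_deriv_comp d2 d_refl) _) => x; by rewrite mulrN1.
- by apply: contN; exact: cont_refl c3.
Qed.

Lemma rbvp_eq z x : rbvp1 z x + rbvp3 z x = - z x.
Proof.
by rewrite /rbvp1 /rbvp3 -opprD bvp_eq opprB addrC subrK.
Qed.

Lemma rbvp_bc z : [/\ rbvp z 0 = 0, rbvp z L = 0 & rbvp1 z L = 0].
Proof.
have [b0 bL b1] := bvp_bc cosL (fun t => z (L - t)).
by rewrite /rbvp /rbvp1 subr0 subrr b0 bL b1 oppr0.
Qed.

Lemma rbvp_linear (a : R) z h x : continuous z -> continuous h ->
  rbvp (fun t => a * z t + h t) x = a * rbvp z x + rbvp h x.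
Proof. by move=> cz ch; rewrite /rbvp bvp_linear//; exact: cont_refl. Qed.

Lemma rbvp_bound : exists2 K : R, 0 < K &
  forall z, continuous z -> ip L (rbvp z) (rbvp z) <= K * ip L z z /\
    ip L (rbvp1 z) (rbvp1 z) <= K * ip L z z.
Proof.
have [K0 K00 KP] := bvp_bound L_gt0.
exists (K0 ^+ 2 * L + 1) => [|z cz]; first by rewrite ltr_wpDl// mulr_ge0 ?sqr_ge0// ltW.
pose B := Num.sqrt (ip L z z).
have B0 : 0 <= B by exact: sqrtr_ge0.
have BE : B ^+ 2 = ip L z z by rewrite sqr_sqrtr// ip_ge0.
have zB : intL L (fun x => z (L - x) ^+ 2) <= B ^+ 2.
  rewrite (@intL_refl (fun x => z x ^+ 2)); last by cont.
  by rewrite BE intL_sqr.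
have h x : 0 <= x <= L -> `|rbvp z x| <= K0 * B /\ `|rbvp1 z x| <= K0 * B.
  move=> /andP[x0 xL]; rewrite /rbvp /rbvp1 normrN.
  by apply: (KP _ _ (cont_refl cz) B0 zB); rewrite subr_ge0 xL gerBl.
have [d0 d1 _ _] := rbvp_smooth cz.
have c0 := has_deriv_cont d0; have c1 := has_deriv_cont d1.
have le : (K0 * B) ^+ 2 * L <= (K0 ^+ 2 * L + 1) * ip L z z.
  by rewrite exprMn BE mulrDl mul1r; have := ip_ge0 L z; lra.
by split; apply: le_trans le; apply: ip_small => // x xL; have [] := h x xL.
Qed.

End chains.

(** * Skew-symmetry and compactness on the unobservable space *)

Section observability.
Variables (R : realType) (L : R).
Hypothesis L_gt0 : 0 < L.
Implicit Types (f g z h u w : R -> R) (x : R).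

(* [rbvp] and [chain] abstract the operator of the same name and the functions
   built above, which keeps unification from unfolding them. *)
Variables rbvp rbvp1 rbvp2 rbvp3 : (R -> R) -> R -> R.
Hypothesis rbvp_smooth : forall z, continuous z ->
  smooth3 (rbvp z) (rbvp1 z) (rbvp2 z) (rbvp3 z).
Hypothesis rbvp_eq : forall z x, rbvp1 z x + rbvp3 z x = - z x.
Hypothesis rbvp_bc : forall z, [/\ rbvp z 0 = 0, rbvp z L = 0 & rbvp1 z L = 0].
Hypothesis rbvp_linear : forall (a : R) z h x, continuous z -> continuous h ->
  rbvp (fun t => a * z t + h t) x = a * rbvp z x + rbvp h x.
Hypothesis rbvp_bound : exists2 K : R, 0 < K &
  forall z, continuous z -> ip L (rbvp z) (rbvp z) <= K * ip L z z /\
    ip L (rbvp1 z) (rbvp1 z) <= K * ip L z z.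

Variables chain chain1 chain2 chain3 : nat -> R -> R.
Hypothesis chain_smooth : forall n,
  smooth3 (chain n) (chain1 n) (chain2 n) (chain3 n).
Hypothesis chain_dirichlet : forall n, dirichlet L (chain n).
Hypothesis chain1_0 : forall n, chain1 n 0 = (n == 0%N)%:R.
Hypothesis chain_eq : forall n x,
  chain1 n x + chain3 n x = if n is m.+1 then chain m x else 0.

Local Notation ip := (ip L).

Lemma chain_cont n : continuous (chain n).
Proof. by have [dn _ _ _] := chain_smooth n; exact: has_deriv_cont dn. Qed.

Lemma rbvp_cont z : continuous z -> continuous (rbvp z).
Proof. by move=> /rbvp_smooth[d _ _ _]; exact: has_deriv_cont d. Qed.

Lemma rbvpZ (a : R) z x : continuous z -> rbvp (fun t => a * z t) x = a * rbvp z x.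
Proof.
move=> cz; have := @rbvp_linear a z (fun=> 0) x cz (@contC R 0).
have -> : (fun t => a * z t + 0) = (fun t => a * z t) by apply/funext => t; rewrite addr0.
have -> : rbvp (fun=> 0) x = 0.
  have := @rbvp_linear 1 (fun=> 0) (fun=> 0) x (@contC R 0) (@contC R 0).
  have -> : (fun t : R => 1 * (0 : R) + 0) = (fun=> 0) by apply/funext => t; ring.
  by lra.
by rewrite addr0.
Qed.

Lemma rbvp_inj z : continuous z -> (forall x, 0 <= x <= L -> rbvp z x = 0) ->
  forall x, 0 <= x <= L -> z x = 0.
Proof.
move=> cz w0; have [d0 d1 d2 c3] := rbvp_smooth cz.
have w1 := has_deriv_const_eq0 L_gt0 d0 (has_deriv_cont d1) w0.
have w2 := has_deriv_const_eq0 L_gt0 d1 (has_deriv_cont d2) w1.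
have w3 := has_deriv_const_eq0 L_gt0 d2 c3 w2.
by move=> x xL; have := rbvp_eq z x; rewrite w1// w3//; lra.
Qed.

Definition unobservable z := continuous z /\ forall n, ip z (chain n) = 0.

(** Green's formula against g_n relates the moments of z and A^-1 z: g_0 yields the slope of A^-1 z
    at 0, and g_(n+1) turns the moment of z of order n + 1 into the moment of A^-1 z of order n. *)
Lemma unobservable_rbvp z : unobservable z ->
  unobservable (rbvp z) /\ rbvp1 z 0 = 0.
Proof.
move=> [cz zg]; have sw := rbvp_smooth cz; have [w0 wL w1L] := rbvp_bc z.
have key n : - ip z (chain n) + ip (rbvp z) (fun x => chain1 n x + chain3 n x) =
    rbvp1 z 0 * chain1 n 0.
  have := green L_gt0 sw (chain_smooth n) (conj w0 wL) (chain_dirichlet n).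
  rewrite w1L mul0r subr0 => <-; congr (_ + _).
  rewrite /ip -intLN//; last by apply: contM => //; exact: chain_cont.
  by apply: eq_intL => x _; rewrite rbvp_eq; ring.
split; last first.
  have := key 0; rewrite zg chain1_0 mulr1 oppr0 add0r => <-.
  by rewrite -[RHS](intL0 L_gt0); apply: eq_intL => x _; rewrite chain_eq mulr0.
split; first exact: rbvp_cont.
move=> n; have := key n.+1; rewrite zg oppr0 add0r chain1_0 mulr0 => <-.
by apply: eq_intL => x _; rewrite chain_eq.
Qed.

(** The boundary term in Green's formula is a product of slopes at 0, and the factor coming from z
    vanishes. *)
Lemma rbvp_skew z h : unobservable z -> continuous h ->
  ip (rbvp z) h = - ip z (rbvp h).
Proof.
move=> uz ch; have [_ w10] := unobservable_rbvp uz; have [cz _] := uz.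
have [w0 wL w1L] := rbvp_bc z; have [h0 hL h1L] := rbvp_bc h.
have := green L_gt0 (rbvp_smooth cz) (rbvp_smooth ch) (conj w0 wL) (conj h0 hL).
rewrite w10 h1L mul0r mulr0 subrr.
rewrite (_ : intL _ _ = - ip z (rbvp h)); last first.
  rewrite /ip -intLN//; last by apply: contM => //; exact: rbvp_cont.
  by apply: eq_intL => x _; rewrite rbvp_eq; ring.
rewrite [X in _ + X](_ : _ = - ip (rbvp z) h); first by move=> /eqP; rewrite subr_eq0 => /eqP ->.
rewrite /ip -intLN//; last by apply: contM => //; exact: rbvp_cont.
by apply: eq_intL => x _; rewrite rbvp_eq; ring.
Qed.

(** Serves both compactness arguments: with exactly vanishing moments for the eigenvector, and with
    merely vanishing limits for the coercivity estimate. *)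
Lemma unobservable_limit w (a_ : nat -> R -> R) :
  continuous w -> (forall n, continuous (a_ n)) ->
  (forall m n, (m <= n)%N -> ip (a_ n) (chain m) ^+ 2 <= n.+1%:R^-1) ->
  (forall (e : R) N, 0 < e -> exists2 n, (N <= n)%N &
     forall x, 0 <= x <= L -> `|a_ n x - w x| <= e) ->
  unobservable w.
Proof.
move=> cw ca small lim; split=> // m; have cg := @chain_cont m.
apply/eqP; rewrite -sqrf_eq0 eq_le sqr_ge0 andbT.
apply: (@le0_small _ _ (2 * (L * ip (chain m) (chain m)) + 2)).
  by rewrite addr_ge0// mulr_ge0// mulr_ge0 ?ip_ge0// ltW.
move=> e e0 e1.
have [n] := lim e (maxn m (Num.truncn e^-1)) e0.
rewrite geq_max => /andP[mn en] ne.
have h1 := ip_near L_gt0 (ca n) cw cg ne.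
have h2 := small m n mn.
have h3 : n.+1%:R^-1 <= e.
  rewrite -[leRHS]invrK lef_pV2 ?posrE ?invr_gt0//.
  by apply: ltW; apply: (lt_le_trans (truncnS_gt _)); rewrite ler_nat ltnS.
have e2 : e ^+ 2 <= e by rewrite expr2 ler_piMl// ltW.
have N0 : 0 <= L * ip (chain m) (chain m) by rewrite mulr_ge0 ?ip_ge0// ltW.
have h4 : e ^+ 2 * (L * ip (chain m) (chain m)) <= e * (L * ip (chain m) (chain m)).
  by rewrite ler_wpM2r.
rewrite mulrA in h4.
have := sqr_ge0 (ip w (chain m) - 2 * ip (a_ n) (chain m)).
move: (le_trans h2 h3) h1 h4 => {h2 h3 N0}.
move: (ip w _) (ip (a_ n) _) (ip (chain m) _) => X Y Z; rewrite -!mulrA; lra.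
Qed.

Lemma unobservableZ (a : R) z : unobservable z -> unobservable (fun x => a * z x).
Proof.
move=> [cz zg]; split; first by cont.
by move=> n; rewrite ipZ ?zg ?mulr0//; exact: chain_cont.
Qed.

(** M + A^-2: with M the largest value of |A^-1 z|^2 on the unit ball, its kernel is the eigenspace
    looked for. *)
Definition shift_inv2 (M : R) f x := M * f x + rbvp (rbvp f) x.

Lemma shift_inv2_cont M f : continuous f -> continuous (shift_inv2 M f).
Proof.
by move=> cf; have ci := rbvp_cont (rbvp_cont cf); rewrite /shift_inv2; cont.
Qed.

Lemma shift_inv2_linear M f g (c : R) x : continuous f -> continuous g ->
  shift_inv2 M (fun x => c * f x + g x) x =
  c * shift_inv2 M f x + shift_inv2 M g x.
Proof.
move=> cf cg; rewrite /shift_inv2.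
have -> : rbvp (fun x => c * f x + g x) = (fun x => c * rbvp f x + rbvp g x).
  by apply/funext => t; rewrite rbvp_linear.
rewrite (@rbvp_linear c (rbvp f) (rbvp g)); [|exact: rbvp_cont..].
by move: (rbvp (rbvp f) x) (rbvp (rbvp g) x) => X Y; ring.
Qed.

Lemma rbvp2_shift M f : continuous f ->
  rbvp (rbvp (shift_inv2 M f)) = shift_inv2 M (rbvp (rbvp f)).
Proof.
move=> cf; have ci := rbvp_cont cf; have cii := rbvp_cont ci.
apply/funext => y; rewrite /shift_inv2.
have -> : rbvp (fun x => M * f x + rbvp (rbvp f) x) =
    (fun x => M * rbvp f x + rbvp (rbvp (rbvp f)) x).
  by apply/funext => t; rewrite rbvp_linear.
by rewrite (@rbvp_linear M (rbvp f) (rbvp (rbvp (rbvp f))))//; exact: rbvp_cont.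
Qed.

Lemma ip_shift_inv2 M f : continuous f ->
  ip (shift_inv2 M f) (shift_inv2 M f) = M ^+ 2 * ip f f +
    2 * M * ip (rbvp (rbvp f)) f + ip (rbvp (rbvp f)) (rbvp (rbvp f)).
Proof.
move=> cf; have ciif := rbvp_cont (rbvp_cont cf).
have cT : continuous (shift_inv2 M f) by exact: shift_inv2_cont.
rewrite {1}/shift_inv2 ipD// !(ipC L _ (shift_inv2 M f)) /shift_inv2 !ipD//.
rewrite (ipC L f (rbvp (rbvp f))).
by move: (ip f f) (ip _ f) (ip _ _) => X Y Z; ring.
Qed.

(* On the unobservable space [rbvp] is skew-symmetric and compact, so that
   [- rbvp \o rbvp] has an eigenvector where [ip (rbvp z) (rbvp z)] is maximal on the
   unit ball. *)
Lemma unobservable_eigen z0 : unobservable z0 ->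
  (exists2 x, 0 <= x <= L & z0 x != 0) ->
  exists a M, [/\ unobservable a, 0 < M, exists2 x, 0 <= x <= L & a x != 0 &
    forall x, 0 <= x <= L -> rbvp (rbvp a) x = - M * a x].
Proof.
move=> uz0 [x0 x0L z0x0].
have [K K0 KP] := rbvp_bound.
pose q z := ip (rbvp z) (rbvp z).
pose A := [set r : R | exists z, [/\ unobservable z, ip z z <= 1 & r = q z]].
have zz0 : 0 < ip z0 z0.
  rewrite lt_neqAle ip_ge0 andbT eq_sym; apply: contraNneq z0x0 => e.
  by rewrite (ip_eq0 L_gt0 (proj1 uz0) e).
have qZ (c : R) z : unobservable z -> q (fun x => c * z x) = c ^+ 2 * q z.
  move=> [cz _]; rewrite /q; have ciz := rbvp_cont cz.
  have -> : rbvp (fun x => c * z x) = (fun x => c * rbvp z x).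
    by apply/funext => x; rewrite rbvpZ.
  rewrite ipZ 1?ipC 1?ipZ; [|by cont..]; move: (ip _ _) => *; ring.
have nZ (c : R) z : unobservable z ->
    ip (fun x => c * z x) (fun x => c * z x) = c ^+ 2 * ip z z.
  move=> [cz _]; rewrite ipZ 1?ipC 1?ipZ; [|by cont..]; move: (ip _ _) => *; ring.
have unit z : unobservable z -> 0 < ip z z -> A (q z / ip z z).
  move=> uz z0'; exists (fun x => (Num.sqrt (ip z z))^-1 * z x); split.
  - exact: unobservableZ.
  - by rewrite nZ// exprVn sqr_sqrtr ?ip_ge0// mulVf ?gt_eqF.
  - by rewrite qZ// exprVn sqr_sqrtr ?ip_ge0// mulrC.
have supA : has_sup A.
  split; first by exists (q z0 / ip z0 z0); exact: unit.
  exists K => _ [z [uz z1 ->]]; have [h _] := KP z (proj1 uz).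
  by apply: (le_trans h); rewrite -[leRHS]mulr1 ler_pM2l.
pose M := sup A.
have qM z : unobservable z -> q z <= M * ip z z.
  move=> uz; have [z0'|] := ltP 0 (ip z z).
    by rewrite -ler_pdivrMr//; apply: sup_ubound; [exact: (proj2 supA)|exact: unit].
  move=> zle; have z0' : ip z z = 0 by apply/eqP; rewrite eq_le zle ip_ge0.
  have [h _] := KP z (proj1 uz).
  by move: h; rewrite z0' !mulr0.
have qz0 : 0 < q z0.
  rewrite lt_neqAle ip_ge0 andbT eq_sym; apply: contraNneq z0x0 => e.
  apply/eqP; apply: (rbvp_inj (proj1 uz0)) x0L.
  exact: (ip_eq0 L_gt0 (rbvp_cont (proj1 uz0)) e).
have M0 : 0 < M by have := qM z0 uz0; rewrite -ler_pdivrMr// => /(lt_le_trans (divr_gt0 qz0 zz0)).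
have ex n : exists z, [/\ unobservable z, ip z z <= 1 & M - n.+1%:R^-1 < q z].
  have n0 : 0 < n.+1%:R^-1 :> R by rewrite invr_gt0.
  have [r [z [uz z1 ->]] lt] := sup_adherent n0 supA.
  by exists z.
pose z_ n := sval (cid (ex n)).
have uz n : unobservable (z_ n) by rewrite /z_; case: (cid _) => /= ? [].
have z1 n : ip (z_ n) (z_ n) <= 1 by rewrite /z_; case: (cid _) => /= ? [].
have zM n : M - n.+1%:R^-1 < q (z_ n) by rewrite /z_; case: (cid _) => /= ? [].
(* The maximising sequence itself need not converge. Its image under A^-2 is equi-Hoelder, and a
   uniform limit of it is the eigenvector. *)
pose a_ n := rbvp (rbvp (z_ n)).
have uiz n : unobservable (rbvp (z_ n)) by have [] := unobservable_rbvp (uz n).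
have ua n : unobservable (a_ n) by have [] := unobservable_rbvp (uiz n).
have ca n : continuous (a_ n) := proj1 (ua n).
have qE n : q (z_ n) = - ip (a_ n) (z_ n).
  by rewrite (ipC L (a_ n)); exact: (rbvp_skew (uz n) (proj1 (uiz n))).
have a_hold n x y : 0 <= x -> x <= y -> y <= L ->
    (a_ n y - a_ n x) ^+ 2 <= K * K * (y - x).
  move=> x0' xy yL.
  have [d0 d1 _ _] := rbvp_smooth (proj1 (uiz n)).
  apply: (le_trans (holder_half L_gt0 d0 (has_deriv_cont d1) x0' xy yL)).
  rewrite [leRHS]mulrC ler_wpM2l ?subr_ge0//.
  have [_ h1] := KP _ (proj1 (uiz n)); have [h2 _] := KP _ (proj1 (uz n)).
  rewrite intL_sqr; apply: (le_trans h1); rewrite ler_pM2l//.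
  by apply: (le_trans h2); rewrite -[leRHS]mulr1 ler_pM2l.
have a0 n : a_ n 0 = 0 by have [] := rbvp_bc (rbvp (z_ n)).
have [a [ac _ lim]] := equiholder_compact L_gt0 (mulr_gt0 K0 K0) a0 a_hold.
have ua' : unobservable a.
  apply: unobservable_limit ac ca _ lim => // m n _.
  by rewrite (proj2 (ua n)) expr0n/= invr_ge0.
exists a, M; split => //.
  apply: contrapT => a_eq0.
  have {}a_eq0 x : 0 <= x <= L -> a x = 0.
    by move=> xL; apply/eqP/negPn/negP => ax; apply: a_eq0; exists x.
  (* If a = 0, then q(z_n) = - <a_n, z_n> tends to 0, although it tends to M. *)
  have : M ^+ 2 <= 0.
    apply: (@le0_small _ _ (2 * L + 2)) => [|e e0 e1]; first by lra.
    have [n en ne] := lim e (Num.truncn e^-1) e0.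
    have h3 : n.+1%:R^-1 <= e.
      rewrite -[leRHS]invrK lef_pV2 ?posrE ?invr_gt0//.
      by apply: ltW; apply: (lt_le_trans (truncnS_gt _)); rewrite ler_nat ltnS.
    have small : ip (a_ n) (a_ n) <= e ^+ 2 * L.
      by apply: ip_small => // x xL; have := ne x xL; rewrite a_eq0// subr0.
    have cs := ip_cs L_gt0 (ca n) (proj1 (uz n)).
    have cs' : ip (a_ n) (z_ n) ^+ 2 <= e ^+ 2 * L.
      apply: (le_trans cs); apply: le_trans small.
      by rewrite -[leRHS]mulr1 ler_wpM2l ?ip_ge0.
    have q0 : 0 <= q (z_ n) by exact: ip_ge0.
    have qq : q (z_ n) ^+ 2 = ip (a_ n) (z_ n) ^+ 2 by rewrite qE sqrrN.
    have := zM n; move: q0 qq cs'; move: (q _) (ip _ _) => Q P Q0 QP PL MQ.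
    have Mle : M <= Q + e by move: MQ h3; move: (n.+1%:R^-1) => *; lra.
    have M2 : M ^+ 2 <= (Q + e) ^+ 2 by rewrite ler_sqr ?nnegrE// ?(ltW M0)//; lra.
    have e2 : e ^+ 2 <= e by rewrite expr2 ler_piMl// ltW.
    have eL : e ^+ 2 * L <= e * L by rewrite ler_pM2r.
    by have := sqr_ge0 (Q - e); move: M2 e2 eL QP PL; lra.
  by rewrite leNgt exprn_gt0.
pose T := shift_inv2 M.
have cT f : continuous f -> continuous (T f) by exact: shift_inv2_cont.
pose C := 2 * M ^+ 2 + 2 * (K * K).
have C0 : 0 <= C.
  by rewrite /C addr_ge0// mulr_ge0 ?sqr_ge0// mulr_ge0// ltW.
have Tb f : continuous f -> ip (T f) (T f) <= C * ip f f.
  move=> cf; have cif := rbvp_cont cf; have ciif := rbvp_cont cif.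
  have cMf : continuous (fun x => M * f x) by cont.
  apply: (le_trans (ip_sum2 L_gt0 cMf ciif)).
  have [h2 _] := KP _ cf; have [h1 _] := KP _ cif.
  have h3 : ip (rbvp (rbvp f)) (rbvp (rbvp f)) <= K * (K * ip f f).
    by apply: (le_trans h1); rewrite ler_pM2l.
  rewrite ipZ// ipC ipZ// /C.
  by move: (ip (rbvp (rbvp f)) _) (ip f f) h3 => X Y h3; lra.
(* Expanding the square gives M^2 |z_n|^2 - 2 M q(z_n) + |a_n|^2, and maximality applied to A^-1 z_n
   bounds |a_n|^2 by M q(z_n). *)
have Tz n : ip (T (z_ n)) (T (z_ n)) <= M * n.+1%:R^-1.
  rewrite ip_shift_inv2; last exact: (proj1 (uz n)).
  have h1 : ip (a_ n) (a_ n) <= M * q (z_ n) := qM _ (uiz n).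
  have h2 : M ^+ 2 * ip (z_ n) (z_ n) <= M ^+ 2.
    by rewrite -[leRHS]mulr1 ler_wpM2l ?sqr_ge0.
  have h3 : M * (M - n.+1%:R^-1) <= M * q (z_ n) by rewrite ler_pM2l// ltW.
  have h4 : ip (a_ n) (z_ n) = - q (z_ n) by rewrite qE opprK.
  rewrite -/(a_ n) h4; move: h1 h2 h3.
  by move: (q _) (ip _ _) (ip _ _) (n.+1%:R^-1) => X Y Z r h1 h2 h3; lra.
have Ta x : T a x = 0 \/ ~ (0 <= x <= L).
  have [xL|] := pselect (0 <= x <= L); [left|by right].
  apply: (ip_eq0 L_gt0 (cT _ ac) _ xL).
  apply/eqP; rewrite eq_le ip_ge0 andbT.
  apply: (@le0_small _ _ (2 * (C * L) + 2 * (K * (K * M)))).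
    have L0 := ltW L_gt0; have M0' := ltW M0.
    have K0' := ltW K0; by do ?[apply: addr_ge0 | apply: mulr_ge0].
  move=> e e0 e1.
  have [n en ne] := lim e (Num.truncn e^-1) e0.
  have h3 : n.+1%:R^-1 <= e.
    rewrite -[leRHS]invrK lef_pV2 ?posrE ?invr_gt0//.
    by apply: ltW; apply: (lt_le_trans (truncnS_gt _)); rewrite ler_nat ltnS.
  have cz := proj1 (uz n); have cTz := cT _ cz.
  pose dn x := -1 * a_ n x + a x.
  have cdn : continuous dn by have := ca n; rewrite /dn => ?; cont.
  have sd : ip dn dn <= e ^+ 2 * L by exact: (ip_sub_small L_gt0 (ca n) ac ne).
  (* [T a = T (a - a_n) + rbvp (rbvp (T z_n))] *)
  have iTz : rbvp (rbvp (T (z_ n))) = T (a_ n) by rewrite /T rbvp2_shift.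
  have TaE : T a = (fun x => T dn x + T (a_ n) x).
    apply/funext => y; rewrite /T /dn (@shift_inv2_linear M (a_ n) a)//.
    by move: (shift_inv2 _ _ y) (shift_inv2 _ _ y) => X Y; ring.
  rewrite TaE; apply: (le_trans (ip_sum2 L_gt0 (cT _ cdn) (cT _ (ca n)))).
  have b1 := Tb _ cdn.
  have b2 : ip (T (a_ n)) (T (a_ n)) <= K * (K * (M * e)).
    rewrite -iTz; have [g1 _] := KP _ (rbvp_cont cTz); have [g2 _] := KP _ cTz.
    apply: (le_trans g1); rewrite ler_pM2l//; apply: (le_trans g2).
    by rewrite ler_pM2l// (le_trans (Tz n))// ler_pM2l.
  have b3 : C * ip dn dn <= C * (e * L).
    rewrite ler_wpM2l//; apply: (le_trans sd); rewrite ler_pM2r//.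
    by rewrite expr2 ler_piMl// ltW.
  move: b1 b2 b3; move: (ip _ _) (ip _ _) (ip _ _) => *; lra.
move=> x xL; case: (Ta x) => //; rewrite /T /shift_inv2; move: (rbvp _ x) (a x) => X Y; lra.
Qed.

Hypothesis noncrit : ~ critical_length L.

Lemma unobservable0 z x : unobservable z -> 0 <= x <= L -> z x = 0.
Proof.
move=> uz xL; apply: contrapT => /eqP zx; apply: noncrit.
have [|a [M [ua M0 a_neq0 aE]]] := unobservable_eigen uz; first by exists x.
have [ub b10] := unobservable_rbvp ua; have [uc c10] := unobservable_rbvp ub.
(* The eigenvalue of A^-2 is - M, so A has the imaginary eigenvalues with modulus mu = 1 / sqrt M.
   The complex eigenfunction has real part A^-2 a and imaginary part - A^-1 a / mu; both have zero
   slope at 0, being images of unobservable functions. *)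
have [mu mu0 muE] : exists2 mu : R, 0 < mu & mu ^+ 2 * M = 1.
  exists (Num.sqrt M)^-1; first by rewrite invr_gt0 sqrtr_gt0.
  by rewrite exprVn sqr_sqrtr ?(ltW M0)// mulVf// gt_eqF.
have mu_neq0 : mu != 0 by rewrite gt_eqF.
have sc := rbvp_smooth (proj1 ub).
have [db db1 db2 cb3] := rbvp_smooth (proj1 ua).
have dZ f f' : has_deriv f f' ->
    has_deriv (fun x => - (mu^-1) * f x) (fun x => - (mu^-1) * f' x).
  by move=> df; eapply has_deriv_eq; [deriv|move=> t /=; ring].
have sv : smooth3 (fun x => - (mu^-1) * rbvp a x) (fun x => - (mu^-1) * rbvp1 a x)
    (fun x => - (mu^-1) * rbvp2 a x) (fun x => - (mu^-1) * rbvp3 a x).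
  by split; [exact: dZ|exact: dZ|exact: dZ|cont].
have [b0 bL b1L] := rbvp_bc a; have [c0 cL c1L] := rbvp_bc (rbvp a).
apply: (unobservable_critical L_gt0 sc sv (mu := mu)).
- by move=> y _; rewrite rbvp_eq; move: (rbvp a y) => X; field.
- move=> y yL; rewrite -mulrDr rbvp_eq aE//; move: (a y) => X.
  have -> : M = (mu ^+ 2)^-1.
    by apply: (mulfI (_ : mu ^+ 2 != 0)); rewrite ?muE ?mulfV ?expf_neq0.
  by field.
- by [].
- by rewrite b0 b10 bL b1L !mulr0.
- have [y yL ay] := a_neq0; exists y => //.
  by rewrite aE// mulf_neq0// oppr_eq0 gt_eqF.
Qed.

(** By contradiction: normalised counterexamples have bounded derivative in L2 and moments tending
    to 0, so a uniform limit is unobservable, hence zero, against the norm 1. *)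
Lemma chain_coercive : exists N (C : R), 0 < C /\
  forall w w1, has_deriv w w1 -> continuous w1 -> w 0 = 0 ->
  ip w w <= ip w1 w1 + C * \sum_(i < N) ip w (chain i) ^+ 2.
Proof.
apply: contrapT => no.
have ex n : exists w, [/\ continuous w, w 0 = 0, ip w w = 1,
    forall x y, 0 <= x -> x <= y -> y <= L -> (w y - w x) ^+ 2 <= 1 * (y - x) &
    \sum_(i < n.+1) ip w (chain i) ^+ 2 <= n.+1%:R^-1].
  (* Failure with n + 1 moments and constant n + 1 gives, after scaling to |w| = 1, both |w1| <= 1
     and a sum of squared moments at most 1 / (n + 1). *)
  apply: contrapT => non; apply: no; exists n.+1, n.+1%:R; split=> //.
  move=> w w1 dw cw1 w0; rewrite leNgt; apply/negP => lt; apply: non.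
  have cw := has_deriv_cont dw.
  have S0 : 0 <= \sum_(i < n.+1) ip w (chain i) ^+ 2.
    by apply: sumr_ge0 => i _; exact: sqr_ge0.
  have nS0 : 0 <= n.+1%:R * \sum_(i < n.+1) ip w (chain i) ^+ 2 by rewrite mulr_ge0.
  have w10 := ip_ge0 L w1.
  have ww : 0 < ip w w by lra.
  pose s := (Num.sqrt (ip w w))^-1.
  have sE : s ^+ 2 * ip w w = 1.
    by rewrite exprVn sqr_sqrtr ?(ltW ww)// mulVf// gt_eqF.
  have s0 : 0 < s ^+ 2 by rewrite exprn_gt0// invr_gt0 sqrtr_gt0.
  have ipss f : continuous f -> ip (fun x => s * f x) (fun x => s * f x) = s ^+ 2 * ip f f.
    move=> cf; have csf : continuous (fun x => s * f x) by cont.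
    by rewrite ipZ// ipC ipZ// mulrA.
  exists (fun x => s * w x); split.
  - by cont.
  - by rewrite w0 mulr0.
  - by rewrite ipss.
  - move=> x y x0 xy yL; rewrite -mulrBr exprMn mul1r.
    apply: (@le_trans _ _ (s ^+ 2 * ((y - x) * ip w1 w1))).
      by rewrite ler_pM2l// -intL_sqr; exact: holder_half.
    rewrite mulrCA -[leRHS]mulr1 ler_wpM2l ?subr_ge0//.
    by rewrite -sE ler_pM2l//; lra.
  - have -> : \sum_(i < n.+1) ip (fun x => s * w x) (chain i) ^+ 2 =
        \sum_(i < n.+1) s ^+ 2 * ip w (chain i) ^+ 2.
      by apply: eq_bigr => i _; rewrite ipZ// ?exprMn//; exact: chain_cont.
    rewrite -mulr_sumr -[leRHS]mul1r ler_pdivlMr// -mulrA -[leRHS]sE ler_pM2l// mulrC.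
    by apply: ltW; apply: le_lt_trans lt; rewrite lerDr.
pose w_ n := sval (cid (ex n)).
have w_P n : [/\ continuous (w_ n), w_ n 0 = 0, ip (w_ n) (w_ n) = 1,
    forall x y, 0 <= x -> x <= y -> y <= L -> (w_ n y - w_ n x) ^+ 2 <= 1 * (y - x) &
    \sum_(i < n.+1) ip (w_ n) (chain i) ^+ 2 <= n.+1%:R^-1].
  by rewrite /w_; case: (cid _).
have cw n : continuous (w_ n) by have [] := w_P n.
have [w [wc _ lim]] : exists w, [/\ continuous w, w 0 = 0 &
    forall (e : R) N, 0 < e -> exists2 n, (N <= n)%N &
      forall x, 0 <= x <= L -> `|w_ n x - w x| <= e].
  apply: (@equiholder_compact _ _ L_gt0 w_ 1) => // n; first by have [] := w_P n.
  by have [] := w_P n.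
have uw : unobservable w.
  apply: unobservable_limit wc cw _ lim => m n mn.
  have [_ _ _ _] := w_P n; apply: le_trans.
  rewrite (bigD1 (Ordinal (_ : m < n.+1)%N))//= lerDl.
  by apply: sumr_ge0 => i _; exact: sqr_ge0.
(* Chosen so that e^2 L <= e L <= 1 / 2. *)
pose e : R := Num.min 1 ((2 * L)^-1).
have e0 : 0 < e by rewrite lt_min ltr01 invr_gt0 mulr_gt0.
have [n _ ne] := lim e 0 e0.
have [_ _ n1 _ _] := w_P n.
have : ip (w_ n) (w_ n) <= e ^+ 2 * L.
  apply: ip_small => // x xL; have := ne x xL.
  by rewrite (unobservable0 uw xL) subr0.
have e1 : e <= 1 by rewrite ge_min lexx.
have e2 : e <= (2 * L)^-1 by rewrite ge_min lexx orbT.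
rewrite n1 leNgt => /negP; apply.
apply: (@le_lt_trans _ _ (e * L)); first by rewrite ler_pM2r// expr2 ler_piMl// ltW.
apply: (@le_lt_trans _ _ ((2 * L)^-1 * L)); first by rewrite ler_pM2r.
have -> : (2 * L)^-1 * L = 2^-1 by field; rewrite gt_eqF.
by lra.
Qed.

End observability.

(** * The inner product of L2(0, L) *)

Section L2_inner_product.
Variables (R : realType) (L : R).
Hypothesis L_gt0 : 0 < L.

Local Notation leb := (@lebesgue_measure R).
Local Notation mu := (interval_measure L).
Local Notation I := (`]0, L[%classic : set R).
Local Notation RR := (measurableTypeR R).

Let mI : measurable (I : set RR). Proof. exact: measurable_itv. Qed.

Let ae_filter : Filter (almost_everywhere mu).
Proof. exact: ae_filter_ringOfSetsType. Qed.
#[local] Existing Instance ae_filter.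

Lemma ae_interval_measure (P : R -> Prop) :
  (\forall x \ae mu, P x) <-> (\forall x \ae leb, I x -> P x).
Proof.
split.
  move=> [A [mA A0 PA]]; exists (A `&` I); split; first exact: measurableI.
    exact: A0.
  move=> x /= /not_implyP[Ix Px]; split=> //; exact: PA.
move=> [A [mA A0 PA]]; exists (A `|` ~` I); split.
- by apply: measurableU => //; exact: measurableC.
- rewrite /interval_measure /= /mrestr setIUl setICl setU0.
  apply/eqP; rewrite eq_le measure_ge0 andbT -A0 le_measure ?inE//.
  exact: measurableI.
- move=> x /= Px; have [Ix|] := pselect (I x); last by right.
  by left; apply: PA => /= /(_ Ix).
Qed.

Lemma integral_interval_measure (f : RR -> \bar R) : measurable_fun setT f ->
  (\int[mu]_x f x = \int[leb]_(x in I) f x)%E.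
Proof.
move=> mf; transitivity (\int[mu]_(x in I) f x)%E.
  rewrite [RHS]integral_mkcond; apply: ae_eq_integral => //.
    by apply/(measurable_restrictT _ mI); exact: measurable_funTS.
  apply/ae_interval_measure; apply: aeW => x Ix _.
  by rewrite patchE mem_set.
apply: eq_measure_integral => A mA AI; rewrite /interval_measure /= /mrestr.
by rewrite setIidl.
Qed.

Lemma Rintegral_interval_measure (f : RR -> R) : measurable_fun setT f ->
  \int[mu]_x f x = \int[leb]_(x in I) f x.
Proof.
move=> mf; rewrite /Rintegral integral_interval_measure//.
exact/measurable_EFinP.
Qed.

Lemma integrable_interval_measure (f : RR -> R) :
  mu.-integrable setT (EFin \o f) -> leb.-integrable I (EFin \o f).
Proof.
move=> /integrableP[mf fi]; apply/integrableP; split; first exact: measurable_funTS.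
by rewrite -integral_interval_measure//; exact: measurableT_comp.
Qed.

Lemma interval_measure_fin : (mu setT < +oo)%E.
Proof.
rewrite /interval_measure /= /mrestr setTI lebesgue_measure_itv /=.
by case: ifP => _; rewrite ltry.
Qed.

Lemma L2_Lfun (f : L2 L) : (f : RR -> R) \in Lfun mu 2%:E.
Proof. exact: Lspace_Lfun. Qed.

Lemma L2_measurable (f : L2 L) : measurable_fun setT (f : RR -> R).
Proof. by have := L2_Lfun f; rewrite inE => /andP[]; rewrite inE. Qed.

Lemma L2_integrableM (f g : L2 L) :
  mu.-integrable setT (EFin \o (fun x => f x * g x)).
Proof. exact/Lfun1_integrable/Lfun2_mul_Lfun1/L2_Lfun/L2_Lfun. Qed.

(** Stated for functions rather than classes, so that an L2 class can be paired directly with a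
    continuous function. *)
Definition ipm (f g : RR -> R) : R := \int[mu]_x (f x * g x).

Lemma L2_normE (f : L2 L) : `|f| ^+ 2 = ipm f f.
Proof.
have f0 : (0 <= \int[mu]_x (`|(EFin \o f) x| `^ 2))%E.
  by apply: integral_ge0 => x _; exact: poweR_ge0.
rewrite Lspace_normE /ipm.
have two : 2 != 0 :> R by rewrite pnatr_eq0.
have e := @powR_Lnorm _ _ _ mu (EFin \o (f : RR -> R)) 2 two.
have fin : Lnorm mu 2%:E (EFin \o (f : RR -> R)) \is a fin_num.
  by rewrite ge0_fin_numE ?Lnorm_ge0//; exact: (@Lebesgue_finite _ _ _ _ _ _ f).
rewrite -[LHS]powR_mulrn ?fine_ge0 ?Lnorm_ge0//.
rewrite -[LHS]/(fine (fine (Lnorm mu 2%:E (EFin \o (f : RR -> R))) `^ 2)%:E).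
rewrite -poweR_EFin fineK// e /Rintegral; congr fine; apply: eq_integral => x _.
by rewrite -[LHS]/(`|f x|%:E `^ 2)%E poweR_EFin powR_mulrn// real_normK ?num_real ?expr2.
Qed.

Lemma eq_ipm (f g u v : RR -> R) : measurable_fun setT f ->
  measurable_fun setT g -> measurable_fun setT u -> measurable_fun setT v ->
  f = u %[ae mu] -> g = v %[ae mu] -> ipm f g = ipm u v.
Proof.
move=> mf mg mu' mv fu gv; rewrite /ipm /Rintegral; congr fine.
apply: ae_eq_integral => //.
- by apply/measurable_EFinP; exact: measurable_funM.
- by apply/measurable_EFinP; exact: measurable_funM.
- by apply: filterS2 fu gv => x /(_ Logic.I) /= -> /(_ Logic.I) /= ->.
Qed.

Lemma ipmC f g : ipm f g = ipm g f.
Proof. by apply: eq_Rintegral => x _; rewrite mulrC. Qed.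

Lemma ipmDl (f g h : L2 L) : ipm (f + g) h = ipm f h + ipm g h.
Proof.
rewrite [RHS](_ : _ = \int[mu]_x (f x * h x + g x * h x)); last first.
  by rewrite RintegralD//; exact: L2_integrableM.
have -> : ipm (f + g) h = ipm (fun x => f x + g x) h.
  apply: eq_ipm => //; try exact: L2_measurable.
  - by apply: measurable_funD; exact: L2_measurable.
  - exact: LspaceDE.
  - exact: aeW.
by apply: eq_Rintegral => x _; rewrite mulrDl.
Qed.

Lemma ipmZl (a : R) (f h : L2 L) : ipm (a *: f) h = a * ipm f h.
Proof.
have -> : ipm (a *: f) h = ipm (fun x => a * f x) h.
  apply: eq_ipm => //; try exact: L2_measurable.
  - by apply: measurable_funM => //; exact: L2_measurable.
  - exact: LspaceZE.
  - exact: aeW.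
rewrite -RintegralZl//; last exact: L2_integrableM.
by apply: eq_Rintegral => x _; rewrite mulrA.
Qed.

Lemma ipmDr (f g h : L2 L) : ipm h (f + g) = ipm h f + ipm h g.
Proof. by rewrite ipmC ipmDl (ipmC f) (ipmC g). Qed.

Lemma ipmZr (a : R) (f h : L2 L) : ipm h (a *: f) = a * ipm h f.
Proof. by rewrite ipmC ipmZl (ipmC f). Qed.

Lemma ipm_cs (f g : L2 L) : ipm f g ^+ 2 <= ipm f f * ipm g g.
Proof.
have q (s t : R) : 0 <= s ^+ 2 * ipm f f + 2 * s * t * ipm f g + t ^+ 2 * ipm g g.
  have : 0 <= ipm (s *: f + t *: g) (s *: f + t *: g).
    by rewrite -L2_normE sqr_ge0.
  rewrite ipmDl 2!ipmZl 2!ipmDr 4!ipmZr (ipmC g f).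
  by move: (ipm f f) (ipm f g) (ipm g g) => X Y Z; lra.
by apply: discriminant_le0 q; rewrite -L2_normE sqr_ge0.
Qed.

Lemma Lfun2_of_sqr (f : RR -> R) : measurable_fun setT f ->
  mu.-integrable setT (EFin \o (fun x => f x ^+ 2)) -> f \in Lfun mu 2%:E.
Proof.
move=> mf /integrableP[_ fi]; rewrite inE; apply/andP; split; rewrite inE//=.
rewrite /finite_norm unlock poweR_lty//; apply: le_lt_trans fi.
rewrite le_eqVlt; apply/orP; left; apply/eqP; apply: eq_integral => x _.
rewrite -[LHS]/(`|f x|%:E `^ 2)%E -[RHS]/(`|f x ^+ 2|%:E).
by rewrite poweR_EFin powR_mulrn// real_normK ?num_real// ger0_norm ?sqr_ge0.
Qed.

Definition bounded_mult (r : RR -> R) :=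
  measurable_fun setT r /\ exists B : R, forall x, `|r x| <= B.

Lemma L2_mult_exists (r : RR -> R) (f : L2 L) : bounded_mult r ->
  exists h : L2 L, (h : R -> R) = (fun x => r x * f x) %[ae mu].
Proof.
move=> [mr [B rB]].
have B0 : 0 <= B by exact: le_trans (normr_ge0 _) (rB 0).
suff h : (fun x => r x * f x) \in Lfun mu 2%:E.
  by exists (Lclass (Lfun_Sub (lee1n 2) h)); exact: LclassE.
have mf := L2_measurable f.
apply: Lfun2_of_sqr; first exact: measurable_funM.
apply: (@le_integrable _ _ _ mu setT _ _ (EFin \o (fun x => B ^+ 2 * (f x * f x)))) => //.
- by apply/measurable_EFinP; apply: measurable_funX; exact: measurable_funM.
- move=> x _ /=; rewrite lee_fin exprMn normrM [leRHS]normrM ler_pM//.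
    by rewrite !normrX (ger0_norm B0) lerXn2r ?nnegrE.
- exact: (integrableZl _ (B ^+ 2) (L2_integrableM f f)).
Qed.

(** The product as a class, picked by choice and unique by [Lspace_eqP]; the default 0 is returned
    only when no class represents r f. *)
Definition mulL (r : RR -> R) (f : L2 L) : L2 L :=
  xget 0 [set h : L2 L | (h : R -> R) = (fun x => r x * f x) %[ae mu]].

Lemma mulLE r f : bounded_mult r ->
  (mulL r f : R -> R) = (fun x => r x * f x) %[ae mu].
Proof.
move=> /(L2_mult_exists f)[h hE]; rewrite /mulL.
by case: xgetP => [? -> //|/(_ h)].
Qed.

Lemma mulL_linear r (a : R) (f g : L2 L) : bounded_mult r ->
  mulL r (a *: f + g) = a *: mulL r f + mulL r g.
Proof.
move=> br; apply/Lspace_eqP.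
have h1 := mulLE (a *: f + g) br; have h2 := LspaceDE (a *: f) g.
have h3 := LspaceZE a f; have h4 := LspaceDE (a *: mulL r f) (mulL r g).
have h5 := LspaceZE a (mulL r f); have h6 := mulLE f br; have h7 := mulLE g br.
apply: filterS2 (filterI h1 (filterI h2 h3)) (filterI (filterI h4 h5) (filterI h6 h7)).
move=> x [e1 [e2 e3]] [[e4 e5] [e6 e7]] Tx; rewrite (e1 Tx) (e4 Tx) (e5 Tx).
apply: etrans (congr1 _ (etrans (e2 Tx) (congr1 (+%R^~ _) (e3 Tx)))) _.
rewrite (e6 Tx) (e7 Tx); ring.
Qed.

Lemma ipm_mulL r (f g : L2 L) : bounded_mult r ->
  ipm (mulL r f) g = ipm f (mulL r g).
Proof.
move=> br; have [mr _] := br.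
have mf := L2_measurable f; have mg := L2_measurable g.
have -> : ipm (mulL r f) g = ipm (fun x => r x * f x) g.
  apply: eq_ipm => //; try exact: L2_measurable; first exact: measurable_funM.
  - exact: mulLE.
  - exact: aeW.
have -> : ipm f (mulL r g) = ipm f (fun x => r x * g x).
  apply: eq_ipm => //; try exact: L2_measurable; first exact: measurable_funM.
  - exact: aeW.
  - exact: mulLE.
by apply: eq_Rintegral => x _; ring.
Qed.

Lemma mulL_bound (r : RR -> R) (B : R) (f : L2 L) : measurable_fun setT r ->
  (forall x, `|r x| <= B) -> `|mulL r f| <= B * `|f|.
Proof.
move=> mr rB; have br : bounded_mult r by split=> //; exists B.
have B0 : 0 <= B by exact: le_trans (normr_ge0 _) (rB 0).
rewrite -ler_sqr ?nnegrE// ?mulr_ge0// exprMn !L2_normE.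
have mf := L2_measurable f.
have -> : ipm (mulL r f) (mulL r f) = \int[mu]_x ((r x * f x) * (r x * f x)).
  apply: eq_ipm; try exact: L2_measurable; try exact: measurable_funM; exact: mulLE.
rewrite -RintegralZl//; last exact: L2_integrableM.
have ie : mu.-integrable setT (EFin \o (fun x => B ^+ 2 * (f x * f x))).
  exact: (integrableZl _ (B ^+ 2) (L2_integrableM f f)).
have le x : r x * f x * (r x * f x) <= B ^+ 2 * (f x * f x).
  rewrite -!expr2 exprMn ler_wpM2r ?sqr_ge0//.
  by rewrite -[X in X <= _]real_normK ?num_real// lerXn2r ?nnegrE.
apply: le_Rintegral => //.
apply: le_integrable ie => //.
  by apply/measurable_EFinP; apply: measurable_funM; exact: measurable_funM.
move=> x _ /=; rewrite lee_fin !ger0_norm ?le//.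
  by rewrite mulr_ge0 ?sqr_ge0// -expr2 sqr_ge0.
by rewrite -expr2 sqr_ge0.
Qed.

Lemma continuous_bound (g : R -> R) : continuous g ->
  exists B : R, forall x, 0 <= x <= L -> `|g x| <= B.
Proof.
move=> cg; have cn : continuous (fun x => `|g x|).
  by move=> x; apply: cvg_norm; exact: cg.
have [c _ cM] := EVT_max (ltW L_gt0) (continuous_subspaceT cn).
by exists `|g c| => x xL; apply: cM; rewrite in_itv.
Qed.

Lemma cont_measurable (g : R -> R) : continuous g ->
  measurable_fun setT (g : RR -> R).
Proof. exact: continuous_measurable_fun. Qed.

Lemma bounded_mult_patch (g : R -> R) : continuous g -> bounded_mult (g \_ I).
Proof.
move=> cg; split.
  by apply/(measurable_restrictT _ mI); apply: measurable_funTS; exact: cont_measurable.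
have [B gB] := continuous_bound cg.
have B0 : 0 <= B.
  by apply: le_trans (normr_ge0 _) (gB 0 _); rewrite lexx ltW.
exists B => x; rewrite patchE; case: ifPn => [|_]; last by rewrite normr0.
by rewrite inE/= in_itv/= => /andP[x0 xL]; apply: gB; rewrite !ltW.
Qed.

Lemma L2_one : (fun=> 1 : R) \in Lfun mu 2%:E.
Proof.
apply: Lfun2_of_sqr; first exact: measurable_cst.
apply/integrableP; split; first by apply/measurable_EFinP; exact: measurable_cst.
rewrite (eq_integral (cst 1%:E)) => [|x _]; last first.
  by rewrite /= expr1n normr1.
by rewrite integral_cst// mul1e interval_measure_fin.
Qed.

Definition L2one : L2 L := Lclass (Lfun_Sub (lee1n 2) L2_one).

Lemma L2oneE : (L2one : R -> R) = (fun=> 1) %[ae mu].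
Proof. exact: LclassE. Qed.

Implicit Types (g h : R -> R) (f : L2 L).

(** A continuous function on R is bounded only on [0, L]; cutting it off outside ]0, L[ yields a
    bounded multiplier without changing the class. *)
Definition cmul (g : R -> R) : L2 L -> L2 L := mulL (g \_ I).

Definition emb (g : R -> R) : L2 L := cmul g L2one.

Lemma ae_I : \forall x \ae mu, I x.
Proof. by apply/ae_interval_measure; exact: aeW. Qed.

Lemma cmulE g (f : L2 L) : continuous g ->
  (cmul g f : R -> R) = (fun x => g x * f x) %[ae mu].
Proof.
move=> cg; apply: filterS2 ae_I (mulLE f (bounded_mult_patch cg)) => x Ix e Tx.
by rewrite (e Tx) patchE mem_set.
Qed.

Lemma embE g : continuous g -> (emb g : R -> R) = g %[ae mu].
Proof.
move=> cg; apply: filterS2 (cmulE L2one cg) L2oneE => x e e1 Tx.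
by rewrite (e Tx) (e1 Tx) mulr1.
Qed.

Lemma cmul_linear g (a : R) (f1 f2 : L2 L) : continuous g ->
  cmul g (a *: f1 + f2) = a *: cmul g f1 + cmul g f2.
Proof. by move=> cg; exact/mulL_linear/bounded_mult_patch. Qed.

Lemma cmul_cancel g h f : continuous g -> continuous h ->
  (forall x, g x * h x = 1) -> cmul g (cmul h f) = f.
Proof.
move=> cg ch gh; apply/Lspace_eqP.
apply: filterS2 (cmulE (cmul h f) cg) (cmulE f ch) => x e1 e2 Tx.
by rewrite (e1 Tx) (e2 Tx) mulrA gh mul1r.
Qed.

Lemma cmul_bound g (B : R) f : continuous g -> 0 <= B ->
  (forall x, 0 <= x <= L -> `|g x| <= B) -> `|cmul g f| <= B * `|f|.
Proof.
move=> cg B0 gB; apply: mulL_bound; first by case: (bounded_mult_patch cg).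
move=> x; rewrite patchE; case: ifPn => [|_]; last by rewrite normr0.
by rewrite inE/= in_itv/= => /andP[x0 xL]; apply: gB; rewrite !ltW.
Qed.

Lemma ipm_cmul g (f1 f2 : L2 L) : continuous g ->
  ipm (cmul g f1) f2 = ipm f1 (cmul g f2).
Proof. by move=> cg; exact/ipm_mulL/bounded_mult_patch. Qed.

Lemma eq_emb (f : L2 L) g : continuous g -> (f : R -> R) = g %[ae mu] -> f = emb g.
Proof.
move=> cg fg; apply/Lspace_eqP; apply: filterS2 fg (embE cg) => x e1 e2 Tx.
by rewrite (e1 Tx) (e2 Tx).
Qed.

Lemma cmul_emb g h : continuous g -> continuous h ->
  cmul g (emb h) = emb (fun x => g x * h x).
Proof.
move=> cg ch; apply: eq_emb; first by cont.
apply: filterS2 (cmulE (emb h) cg) (embE ch) => x e1 e2 Tx.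
by rewrite (e1 Tx) (e2 Tx).
Qed.

Lemma embD g h (a : R) : continuous g -> continuous h ->
  emb (fun x => a * g x + h x) = a *: emb g + emb h.
Proof.
move=> cg ch; apply/esym/eq_emb; first by cont.
apply: filterS2 (filterI (LspaceDE (a *: emb g) (emb h)) (LspaceZE a (emb g)))
  (filterI (embE cg) (embE ch)) => x [e1 e2] [e3 e4] Tx.
by rewrite (e1 Tx) (e2 Tx) (e3 Tx) (e4 Tx).
Qed.

Lemma ipm_intL (g : R -> R) : continuous g ->
  \int[mu]_x g x = intL L g.
Proof.
move=> cg; rewrite Rintegral_interval_measure; last exact: cont_measurable.
have gi : leb.-integrable `[0, L] (EFin \o g).
  apply: continuous_compact_integrable; first exact: segment_compact.
  exact: continuous_subspaceT.
rewrite Rintegral_itv_obnd_cbnd; last first.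
  by apply: integrableS gi => //; exact: subset_itv_oo_cc.
rewrite Rintegral_itv_bndo_bndc//.
by apply: integrableS gi => //; exact: subset_itv_co_cc.
Qed.

Lemma ipm_embr (f : L2 L) g : continuous g -> ipm f (emb g) = ipm f g.
Proof.
move=> cg; apply: eq_ipm; try exact: L2_measurable.
- exact: cont_measurable.
- exact: aeW.
- exact: embE.
Qed.

Lemma ipm_emb g h : continuous g -> continuous h ->
  ipm (emb g) (emb h) = ip L g h.
Proof.
move=> cg ch; rewrite ipm_embr//.
have -> : ipm (emb g) h = ipm g h.
  apply: eq_ipm; try exact: L2_measurable; try exact: cont_measurable.
  - exact: embE.
  - exact: aeW.
by rewrite /ip -ipm_intL; [|cont].
Qed.

End L2_inner_product.

(** * Regular states are C^2 *)

Section L2_primitive.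
Variables (R : realType) (L : R).
Hypothesis L_gt0 : 0 < L.

Local Notation leb := (@lebesgue_measure R).
Local Notation mu := (interval_measure L).
Local Notation I := (`]0, L[%classic : set R).
Local Notation RR := (measurableTypeR R).
Implicit Types (f g h : L2 L) (k p q : R -> R).

Let mI : measurable (I : set RR). Proof. exact: measurable_itv. Qed.

Let step (x : R) : RR -> R := \1_(`]-oo, x]%classic : set RR).

Let step_bounded x : bounded_mult (step x).
Proof.
split; first exact: measurable_indic.
exists 1 => t; rewrite /step indicE; case: (_ \in _); rewrite ?normr1 ?normr0//.
Qed.

(** The primitive of an L2 function vanishing at 0, written as a pairing with a step function, so
    that Cauchy-Schwarz gives its Hoelder continuity. *)
Definition primL f (x : R) : R := \int[mu]_t (f t * step x t).

Let chi x : L2 L := mulL (step x) (L2one L).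

Let chiE x : (chi x : R -> R) = step x %[ae mu].
Proof.
have AF : Filter (almost_everywhere mu) by exact: ae_filter_ringOfSetsType.
apply: filterS2 (mulLE (L2one L) (step_bounded x)) (L2oneE L) => t e e1 Tt.
by rewrite (e Tt) (e1 Tt) mulr1.
Qed.

Let primL_ipm f x : primL f x = ipm L f (chi x).
Proof.
apply: eq_ipm; try exact: L2_measurable; try exact: aeW.
- by case: (step_bounded x).
- have AF : Filter (almost_everywhere mu) by exact: ae_filter_ringOfSetsType.
  by apply: filterS (chiE x) => t e Tt; rewrite e.
Qed.

Lemma primL_holder f x y : x <= y ->
  (primL f y - primL f x) ^+ 2 <= ipm L f f * (y - x).
Proof.
move=> xy; pose d := chi y + (-1) *: chi x.
have -> : primL f y - primL f x = ipm L f d.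
  by rewrite !primL_ipm /d ipmDr ipmZr mulN1r.
apply: (le_trans (ipm_cs f d)).
rewrite ler_wpM2l//; first by rewrite -L2_normE sqr_ge0.
pose J := (`]x, y]%classic : set RR).
have AF : Filter (almost_everywhere mu) by exact: ae_filter_ringOfSetsType.
have dE : (d : R -> R) = \1_J %[ae mu].
  apply: filterS2 (filterI (LspaceDE (chi y) ((-1) *: chi x)) (LspaceZE (-1) (chi x)))
    (filterI (chiE x) (chiE y)) => t [e1 e2] [e3 e4] Tt.
  rewrite (e1 Tt) (e2 Tt) (e3 Tt) (e4 Tt) /step !indicE /J !mem_setE !in_itv/=.
  have [tx|xt] := leP t x; first by rewrite (le_trans tx xy) mulr1 addrN.
  by rewrite mulr0 addr0.
have mJ' : measurable J by exact: measurable_itv.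
have mJ : measurable_fun setT (\1_J : RR -> R) by exact: measurable_indic.
rewrite (eq_ipm (L2_measurable d) (L2_measurable d) mJ mJ dE dE).
have -> : ipm L \1_J \1_J = fine (mu J).
  rewrite /ipm /Rintegral; congr fine.
  rewrite -[RHS]mul1e -(integral_cst mu _ 1%E); last exact: measurable_itv.
  rewrite [RHS]integral_mkcond; apply: eq_integral => t _.
  rewrite /= patchE indicE; case: (_ \in _); by rewrite ?mulr1 ?mulr0.
rewrite /interval_measure /= /mrestr.
have le : (leb (J `&` I) <= (y - x)%:E)%E.
  have -> : (y - x)%:E = leb J.
    rewrite lebesgue_measure_itv/= lte_fin; case: ltP => // yx.
    have -> : y = x by apply/eqP; rewrite eq_le yx.
    by rewrite subrr.
  apply: le_measure; rewrite ?inE; [exact: measurableI|exact: mJ'|].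
  by move=> t [].
rewrite -lee_fin fineK// ge0_fin_numE; last exact: measure_ge0.
exact: le_lt_trans le (ltry _).
Qed.

Lemma primL_cont f : continuous (primL f).
Proof.
apply: (@holder_continuous _ _ (ipm L f f + 1)).
  by rewrite ltr_wpDl// -L2_normE sqr_ge0.
move=> x y xy; apply: (le_trans (primL_holder f xy)).
by rewrite ler_wpM2r ?subr_ge0// lerDl.
Qed.

Lemma primL0 f : primL f 0 = 0.
Proof.
rewrite /primL Rintegral_interval_measure; last first.
  apply: measurable_funM; first exact: L2_measurable.
  by case: (step_bounded 0).
rewrite (@eq_Rintegral _ _ _ _ _ (fun=> 0)) ?Rintegral_cst ?mul0r//.
move=> t; rewrite inE/= in_itv/= => /andP[t0 _].
by rewrite /step indicE mem_setE in_itv/= leNgt t0 mulr0.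
Qed.

Let integrable_L2 f : mu.-integrable setT (EFin \o (f : RR -> R)).
Proof.
apply/Lfun1_integrable; apply: (@Lfun_subset _ _ _ mu 1 2%:E); rewrite ?lee1n//.
- by rewrite ge0_fin_numE// interval_measure_fin.
- exact: L2_Lfun.
Qed.

Lemma L1_approx f (e : R) : 0 < e -> exists2 k, continuous k &
  \int[mu]_x `|f x - k x| <= e.
Proof.
move=> e0; have fi := integrable_interval_measure (integrable_L2 f).
have mIfin : (leb I < +oo)%E.
  by rewrite lebesgue_measure_itv/=; case: ifP => _; rewrite ltry.
have [g_ [gc gi cvg]] := approximation_continuous_integrable mI mIfin fi.
have /fine_cvgP[_ fcvg] := cvg.
have [n ne] := filter_ex (cvgr_lt 0 fcvg e e0).
exists (g_ n) => //; apply: le_trans (ltW ne).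
rewrite Rintegral_interval_measure//; apply: measurableT_comp => //.
apply: measurable_funB; first exact: L2_measurable.
exact: cont_measurable.
Qed.

Let integrable_cont k : continuous k -> mu.-integrable setT (EFin \o (k : RR -> R)).
Proof.
move=> ck; have mk := cont_measurable ck.
have /integrableP[_ fi] := integrable_L2 (emb L k); apply/integrableP; split.
  exact/measurable_EFinP.
apply: le_lt_trans fi; rewrite le_eqVlt; apply/orP; left; apply/eqP.
have AF : Filter (almost_everywhere mu) by exact: ae_filter_ringOfSetsType.
apply: ae_eq_integral => //.
- by apply: measurableT_comp => //; exact/measurable_EFinP.
- apply: measurableT_comp => //; apply/measurable_EFinP; exact: L2_measurable.
- by apply: filterS (embE L_gt0 ck) => x e Tx /=; rewrite (e Tx).
Qed.

Lemma Rintegral_near (f : L2 L) k (r : RR -> R) (B e : R) : continuous k ->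
  measurable_fun setT r -> (forall x, I x -> `|r x| <= B) -> 0 <= B ->
  \int[mu]_x `|f x - k x| <= e ->
  `|\int[mu]_x (f x * r x) - \int[mu]_x (k x * r x)| <= B * e.
Proof.
move=> ck mr rB B0 fe.
have mk := cont_measurable ck; have mf := L2_measurable f.
pose r' : RR -> R := r \_ I.
have mr' : measurable_fun setT r'.
  by apply/(measurable_restrictT _ mI); exact: measurable_funTS.
have r'B x : `|r' x| <= B.
  rewrite /r' patchE; case: ifPn => [|_]; last by rewrite normr0.
  by rewrite inE => /rB.
have AF : Filter (almost_everywhere mu) by exact: ae_filter_ringOfSetsType.
have rr' : r = r' %[ae mu].
  by apply: filterS (ae_I L) => x Ix _; rewrite /r' patchE mem_set.
have -> : \int[mu]_x (f x * r x) = ipm L f r'.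
  by apply: eq_ipm => //; exact: aeW.
have -> : \int[mu]_x (k x * r x) = ipm L k r'.
  by apply: eq_ipm => //; exact: aeW.
have im (h : RR -> R) : measurable_fun setT h -> mu.-integrable setT (EFin \o h) ->
    mu.-integrable setT (EFin \o (fun x => h x * r' x)).
  move=> mh ih; apply: (@le_integrable _ _ _ mu setT _ _ (EFin \o (fun x => B * h x))) => //.
  - by apply/measurable_EFinP; exact: measurable_funM.
  - by move=> x _ /=; rewrite lee_fin !normrM mulrC ler_pM// (ger0_norm B0).
  - exact: (integrableZl _ B ih).
have if' := im _ mf (integrable_L2 f); have ik' := im _ mk (integrable_cont ck).
rewrite /ipm -RintegralB//.
have idif : mu.-integrable setT (EFin \o (fun x => f x - k x)).
  exact: (integrableB _ (integrable_L2 f) (integrable_cont ck)).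
have ina : mu.-integrable setT (EFin \o (fun x => `|f x - k x|)).
  exact: integrable_norm idif.
apply: (le_trans (le_normr_Rintegral _ (integrableB _ if' ik'))) => //.
apply: (@le_trans _ _ (\int[mu]_x (B * `|f x - k x|))).
  apply: le_Rintegral => //.
  - exact: integrable_norm (integrableB _ if' ik').
  - exact: (integrableZl _ B ina).
  - by move=> x _; rewrite -mulrBl normrM mulrC ler_wpM2r.
by rewrite RintegralZl// ler_wpM2l.
Qed.

Lemma Rintegral_step k x : continuous k -> 0 <= x <= L ->
  \int[mu]_t (k t * step x t) = prim k x.
Proof.
move=> ck /andP[x0 xL]; have mk := cont_measurable ck.
rewrite Rintegral_interval_measure; last first.
  by apply: measurable_funM => //; case: (step_bounded x).
have -> : \int[leb]_(t in I) (k t * step x t) =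
    \int[leb]_(t in I `&` `]-oo, x]) k t.
  rewrite Rintegral_mkcondr; apply: eq_Rintegral => t _.
  by rewrite patchE /step indicE; case: (_ \in _); rewrite ?mulr1 ?mulr0.
move: x0; rewrite le_eqVlt => /predU1P[<-|x0].
  rewrite prim0 [X in Rintegral _ X](_ : _ = set0) ?Rintegral_set0//.
  rewrite -subset0 => t [] /=; rewrite !in_itv/= => /andP[t0 _].
  by rewrite leNgt t0.
have ki y : leb.-integrable `[0, y] (EFin \o k).
  apply: continuous_compact_integrable; first exact: segment_compact.
  exact: continuous_subspaceT.
rewrite -(intL_prim x0).
move: xL; rewrite le_eqVlt => /predU1P[xL|xL].
  rewrite [X in Rintegral _ X](_ : _ = I); last first.
    apply/seteqP; split=> [t []//|t tI]; split=> //=.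
    by move: tI; rewrite /= !in_itv/= => /andP[_ /ltW]; rewrite xL.
  by rewrite xL -Rintegral_interval_measure// ipm_intL.
rewrite [X in Rintegral _ X](_ : _ = `]0, x]%classic); last first.
  apply/seteqP; split=> t /=; rewrite !in_itv/=; first by move=> [/andP[-> _] ->].
  by move=> /andP[-> tx]; rewrite tx (le_lt_trans tx xL).
rewrite Rintegral_itv_obnd_cbnd//.
by apply: integrableS (ki x) => //; exact: subset_itv_oc_cc.
Qed.

(** Classical when f is continuous; the general case follows by L1 approximation, since the
    primitives are then uniformly close. *)
Lemma primL_by_parts f p q : has_deriv p q -> continuous q ->
  ipm L f p = primL f L * p L - intL L (fun x => primL f x * q x).
Proof.
move=> dp cq; have cp := has_deriv_cont dp.
have [B pB] := continuous_bound L_gt0 cp; have [C qC] := continuous_bound L_gt0 cq.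
have L0 := ltW L_gt0.
have B0 : 0 <= B by apply: le_trans (normr_ge0 _) (pB 0 _); rewrite lexx.
have C0 : 0 <= C by apply: le_trans (normr_ge0 _) (qC 0 _); rewrite lexx.
apply/eqP; rewrite -subr_eq0 -normr_le0.
(* The pairing with p and the boundary term each contribute an error B e, the remaining integral C L
   e. *)
apply: (@le0_small _ _ (2 * B + C * L)) => [|e e0 _].
  by rewrite addr_ge0 ?mulr_ge0.
have [k ck fk] := L1_approx f e0.
have IE x : I x -> 0 <= x <= L by rewrite /= in_itv/= => /andP[/ltW-> /ltW->].
have h1 := Rintegral_near ck (cont_measurable cp) (fun x Ix => pB x (IE x Ix)) B0 fk.
have h2 x : 0 <= x <= L -> `|primL f x - prim k x| <= e.
  move=> xL; rewrite -(Rintegral_step ck xL) -[leRHS]mul1r.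
  apply: Rintegral_near fk => //; first by case: (step_bounded x).
  by move=> t _; rewrite /step indicE; case: (_ \in _); rewrite ?normr1 ?normr0.
have dk := has_deriv_prim ck.
have cG := @primL_cont f; have cK := has_deriv_cont dk.
have h3 : \int[mu]_x (k x * p x) =
    prim k L * p L - intL L (fun x => prim k x * q x).
  have d : has_deriv (fun x => prim k x * p x) (fun x => k x * p x + prim k x * q x).
    by eapply has_deriv_eq; [deriv|move=> t /=; ring].
  have := intL_FTC L_gt0 d; rewrite intLD//; [|cont|cont].
  rewrite -ipm_intL//; last by cont.
  rewrite prim0 mul0r subr0 => <-; last by cont.
  by rewrite addrK.
have h4 : `|intL L (fun x => primL f x * q x) - intL L (fun x => prim k x * q x)|
    <= C * L * e.
  rewrite -intLN//; last by cont.
  rewrite -intLD//; [|cont|cont].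
  have cd : continuous (fun x => primL f x * q x - prim k x * q x) by cont.
  have bd x : 0 <= x <= L -> `|primL f x * q x - prim k x * q x| <= C * e.
    by move=> xL; rewrite -mulrBl normrM mulrC ler_pM ?qC ?h2.
  have dlin : has_deriv (fun x => C * e * x) (fun=> C * e) by exact: has_deriv_lin.
  have int_cst : intL L (fun=> C * e) = C * L * e.
    by rewrite (intL_FTC L_gt0 dlin); [ring|cont].
  rewrite -int_cst ler_norml -intLN//; last by cont.
  apply/andP; split; apply: le_intL => //; try by cont.
  - by move=> x xL; move: (bd x xL); rewrite ler_norml => /andP[].
  - by move=> x xL; move: (bd x xL); rewrite ler_norml => /andP[].
have h5 : `|(primL f L - prim k L) * p L| <= e * B.
  by rewrite normrM ler_pM// ?h2 ?pB// L0 lexx.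
move: h1 h4 h5; rewrite h3 -/(ipm L f p).
move: (ipm L f p) (intL L _) (intL L _) (primL f L) (prim k L) (p L) => X Y Z P K' pL.
rewrite !ler_norml => /andP[? ?] /andP[? ?] /andP[? ?]; apply/andP; split; lra.
Qed.

Lemma has_deriv_const F (f : R -> R) x y : has_deriv F f -> x <= y ->
  (forall t, x <= t <= y -> f t = 0) -> F x = F y.
Proof.
move=> dF xy f0; apply/eqP; rewrite eq_le (has_deriv_nondecr dF xy); last first.
  by move=> t /f0 ->.
rewrite -lerN2; apply: (has_deriv_nondecr (has_derivN dF) xy) => t /f0 ->.
by rewrite oppr0.
Qed.

Lemma has_deriv_test p p' a b : has_deriv p p' -> continuous p' -> 0 < a -> b < L ->
  (forall x, x <= a -> p x = 0) -> (forall x, b <= x -> p x = 0) ->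
  test_function L p /\ p^`()%classic = p'.
Proof.
move=> dp cp a0 bL pa pb.
have e : p^`()%classic = p'.
  by apply/funext => x; rewrite derive1E; have [_ ->] := dp x.
split=> //; split; rewrite ?e//; first by move=> x; have [] := dp x.
exists a, b; split => // x; rewrite in_itv/= negb_and -!ltNge => /orP[/ltW|/ltW].
  exact: pa.
exact: pb.
Qed.

(** * The du Bois-Reymond lemma *)

Section du_bois_reymond.
Variable h : L2 L.
Hypothesis h_orth : forall p, test_function L p -> ipm L h p^`()%classic = 0.

Let H := primL h.

(* The test function has second derivative (H - l) q, for a weight q supported in
   [a, b] and the affine l which makes its support compact; integrating by parts,
   H is orthogonal to (H - l) q, and so is l, whence H = l where q > 0. *)
Let H_affine (a b : R) : 0 < a -> a < b -> b < L -> exists al be : R,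
  forall x, a < x < b -> H x = al + be * x.
Proof.
move=> a0 ab bL; have cH : continuous H := @primL_cont h.
have cabs p : continuous p -> continuous (fun x => `|p x|).
  by move=> cp x; apply: cvg_norm; exact: cp.
(* Four times the product of the positive parts of x - a and b - x: continuous, positive exactly on
   ]a, b[. *)
pose q x := (`|x - a| + (x - a)) * (`|b - x| + (b - x)).
have c1 : continuous (fun x : R => `|x - a|) by apply: cabs; cont.
have c2 : continuous (fun x : R => `|b - x|) by apply: cabs; cont.
have cq : continuous q by rewrite /q; cont.
have q0 x : 0 <= q x.
  rewrite mulr_ge0//; first by have := ler_norm (- (x - a)); rewrite normrN; lra.
  by have := ler_norm (- (b - x)); rewrite normrN; lra.
have qa x : x <= a -> q x = 0.
  by move=> xa; rewrite /q ler0_norm ?subr_le0// addNr mul0r.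
have qb x : b <= x -> q x = 0.
  by move=> bx; rewrite /q [`|b - x|]ler0_norm ?subr_le0// addNr mulr0.
have q_gt0 x : a < x < b -> 0 < q x.
  by move=> /andP[ax xb]; rewrite /q !gtr0_norm ?subr_gt0// mulr_gt0//; lra.
have intq_gt0 (p : R -> R) (z : R) : continuous p -> (forall x, 0 <= p x) ->
    a < z < b -> 0 < p z -> 0 < intL L (fun x => p x * q x).
  move=> cp p0 zab pz; rewrite lt_neqAle eq_sym intL_ge0 ?andbT; last first.
    by move=> x _; rewrite mulr_ge0.
  apply/eqP => i0; have cpq : continuous (fun x => p x * q x) by cont.
  have zL : 0 <= z <= L by move/andP: zab => [? ?]; apply/andP; split; lra.
  have := intL_eq0 L_gt0 cpq (fun x _ => mulr_ge0 (p0 x) (q0 x)) i0 zL.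
  by apply/eqP; rewrite gt_eqF// mulr_gt0// q_gt0.
(* The barycentre of q: 1 and x - m are orthogonal for this weight, so the two coefficients of l are
   found separately. *)
pose m := intL L (fun x => x * q x) / intL L q.
have J0 : 0 < intL L q.
  have := intq_gt0 (fun=> 1) ((a + b) / 2) (@contC _ 1) (fun=> ler01).
  rewrite (@eq_intL _ _ _ q) => [|x _]; last by rewrite mul1r.
  by apply; lra.
have Jx : intL L (fun x => (x - m) * q x) = 0.
  have -> : (fun x => (x - m) * q x) = (fun x => x * q x + - m * q x).
    by apply/funext => x; ring.
  rewrite intLD ?intLZ//; [|cont|cont].
  by rewrite /m; move: (intL L (fun x => x * q x)) (intL L q) J0 => X Y Y0; field; rewrite gt_eqF.
have Jxx : 0 < intL L (fun x => (x - m) ^+ 2 * q x).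
  have [z zab zm] : exists2 z, a < z < b & z != m.
    have [->|nm] := eqVneq m ((a + b) / 2); last first.
      by exists ((a + b) / 2); [lra|rewrite eq_sym].
    by exists ((3 * a + b) / 4); [lra|apply/eqP; lra].
  apply: (intq_gt0 (fun x => (x - m) ^+ 2) z) => //; first by cont.
    by move=> x; exact: sqr_ge0.
  by rewrite exprn_even_gt0//= subr_eq0.
pose J p := intL L (fun x => p x * q x).
pose al := J H / intL L q.
pose be := J (fun x => H x * (x - m)) / J (fun x => (x - m) ^+ 2).
pose l x := al + be * (x - m).
have cl : continuous l by rewrite /l; cont.
(* l is the least-squares affine fit of H for the weight q, hence rho is orthogonal to 1 and x; this
   is what makes its double primitive vanish beyond b. *)
pose rho x := (H x - l x) * q x.
have crho : continuous rho by rewrite /rho; cont.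
have rho1 : intL L rho = 0.
  have -> : rho = (fun x => H x * q x + - al * q x + - be * ((x - m) * q x)).
    by apply/funext => x; rewrite /rho /l; ring.
  rewrite !intLD ?intLZ//; try by cont.
  rewrite Jx /al /J; move: (intL L (fun x => H x * q x)) (intL L q) J0 => X Y Y0.
  by field; rewrite gt_eqF.
have rhox : intL L (fun x => (x - m) * rho x) = 0.
  have -> : (fun x => (x - m) * rho x) =
      (fun x => H x * (x - m) * q x + - al * ((x - m) * q x) +
        - be * ((x - m) ^+ 2 * q x)).
    by apply/funext => x; rewrite /rho /l; ring.
  rewrite !intLD ?intLZ//; try by cont.
  rewrite Jx /be /J.
  move: (intL L (fun x => H x * (x - m) * q x)) (intL L (fun x => (x - m) ^+ 2 * q x)) Jxx.
  by move=> X Y Y0; field; rewrite gt_eqF.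
have d1 := has_deriv_prim crho.
have c11 : continuous (prim rho) := has_deriv_cont d1.
have d2 := has_deriv_prim c11.
have prho_a x : x <= a -> prim rho x = 0.
  move=> xa; have /orP[x0|x0] := le_total x 0.
    rewrite -(prim0 rho); apply: (has_deriv_const d1 x0) => t /andP[_ t0].
    by rewrite /rho qa ?mulr0//; lra.
  rewrite -(prim0 rho); apply/esym/(has_deriv_const d1 x0) => t /andP[_ tx].
  by rewrite /rho qa ?mulr0//; lra.
have prho_b x : b <= x -> prim rho x = 0.
  move=> bx; rewrite -rho1 (intL_prim L_gt0); have /orP[xL|xL] := le_total x L.
    by apply: (has_deriv_const d1 xL) => t /andP[t0 _]; rewrite /rho qb ?mulr0//; lra.
  by apply/esym/(has_deriv_const d1 xL) => t /andP[t0 _]; rewrite /rho qb ?mulr0//; lra.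
have pp_a x : x <= a -> prim (prim rho) x = 0.
  move=> xa; have /orP[x0|x0] := le_total x 0.
    rewrite -(prim0 (prim rho)); apply: (has_deriv_const d2 x0) => t /andP[_ t0].
    by apply: prho_a; lra.
  rewrite -(prim0 (prim rho)); apply/esym/(has_deriv_const d2 x0) => t /andP[_ tx].
  by apply: prho_a; lra.
have ppL : prim (prim rho) L = 0.
  rewrite -(intL_prim L_gt0).
  have d3 : has_deriv (fun x => (x - m) * prim rho x)
      (fun x => prim rho x + (x - m) * rho x).
    by eapply has_deriv_eq; [deriv|move=> t /=; ring].
  have := intL_FTC L_gt0 d3; rewrite intLD//; [|cont].
  rewrite rhox addr0 => ->; last by cont.
  by rewrite prim0 prho_b ?(ltW bL)//; ring.
have pp_b x : b <= x -> prim (prim rho) x = 0.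
  move=> bx; rewrite -ppL; have /orP[xL|xL] := le_total x L.
    by apply: (has_deriv_const d2 xL) => t /andP[t0 _]; apply: prho_b; lra.
  by apply/esym/(has_deriv_const d2 xL) => t /andP[t0 _]; apply: prho_b; lra.
have [tf te] := has_deriv_test d2 c11 a0 bL pp_a pp_b.
have := h_orth tf; rewrite te (primL_by_parts h d1 crho) prho_b ?(ltW bL)//.
rewrite mulr0 sub0r => /eqP; rewrite oppr_eq0 => /eqP Hrho.
have sq0 : intL L (fun x => (H x - l x) ^+ 2 * q x) = 0.
  have -> : (fun x => (H x - l x) ^+ 2 * q x) =
      (fun x => H x * rho x + - al * rho x + - be * ((x - m) * rho x)).
    by apply/funext => x; rewrite /rho /l; ring.
  rewrite !intLD ?intLZ//; try by cont.
  by rewrite rho1 rhox Hrho; ring.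
have csq : continuous (fun x => (H x - l x) ^+ 2 * q x) by cont.
exists (al - be * m), be => x xab.
have xL : 0 <= x <= L by move/andP: xab => [? ?]; apply/andP; split; lra.
have := intL_eq0 L_gt0 csq (fun x _ => mulr_ge0 (sqr_ge0 _) (q0 x)) sq0 xL.
move=> /eqP; rewrite mulf_eq0 (gt_eqF (q_gt0 x xab)) orbF sqrf_eq0 subr_eq0 => /eqP ->.
by rewrite /l; ring.
Qed.

(** The primitive H is affine on ]0, L[; h minus its slope has a constant primitive there, hence
    vanishes almost everywhere by Lebesgue differentiation. *)
Lemma du_bois_reymond : exists c : R, (h : R -> R) = (fun=> c) %[ae mu].
Proof.
(* Every interval ]a, b[ used below contains L / 3 and 2 L / 3, so that the local affine functions
   all coincide. *)
pose be := (H (2 * L / 3) - H (L / 3)) / (L / 3).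
pose al := H (L / 3) - be * (L / 3).
have HE x : I x -> H x = al + be * x.
  rewrite /= in_itv/= => /andP[x0 xL].
  have [a [a0 ax aL]] : exists a, [/\ 0 < a, a < x & a < L / 3].
    have h1 : Num.min x (L / 3) <= x by rewrite ge_min lexx.
    have h2 : Num.min x (L / 3) <= L / 3 by rewrite ge_min lexx orbT.
    have h3 : 0 < Num.min x (L / 3) by rewrite lt_min x0 divr_gt0.
    exists (Num.min x (L / 3) / 2).
    by move: (Num.min _ _) h1 h2 h3 => M ? ? ?; split; lra.
  have [b [bL xb Lb]] : exists b, [/\ b < L, x < b & 2 * L / 3 < b].
    have h1 : x <= Num.max x (2 * L / 3) by rewrite le_max lexx.
    have h2 : 2 * L / 3 <= Num.max x (2 * L / 3) by rewrite le_max lexx orbT.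
    have h3 : Num.max x (2 * L / 3) < L by rewrite gt_max xL; lra.
    exists ((Num.max x (2 * L / 3) + L) / 2).
    by move: (Num.max _ _) h1 h2 h3 => M ? ? ?; split; lra.
  have ab : a < b by lra.
  have [al' [be' HE]] := H_affine a0 ab bL.
  have e1 := HE (L / 3); have e2 := HE (2 * L / 3); have e3 := HE x.
  have {}e1 : H (L / 3) = al' + be' * (L / 3) by apply: e1; apply/andP; split; lra.
  have {}e2 : H (2 * L / 3) = al' + be' * (2 * L / 3).
    by apply: e2; apply/andP; split; lra.
  have {}e3 : H x = al' + be' * x by apply: e3; apply/andP; split; lra.
  have beE : be = be' by rewrite /be e1 e2; field; rewrite gt_eqF.
  by rewrite e3 /al beE e1; ring.
exists be.
pose h' : L2 L := h + (- be) *: L2one L.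
have AF : Filter (almost_everywhere mu) by exact: ae_filter_ringOfSetsType.
suff h'0 : \forall x \ae mu, h' x = 0.
  apply: filterS2 (filterI h'0 (L2oneE L))
    (filterI (LspaceDE h ((- be) *: L2one L)) (LspaceZE (- be) (L2one L))).
  move=> x [e0 e1] [e2 e3] Tx.
  by move: (e2 Tx); rewrite e0 (e3 Tx) (e1 Tx) mulr1 => /eqP; rewrite eq_sym subr_eq0 => /eqP.
have h'E x : I x -> primL h' x = al.
  move=> Ix; rewrite primL_ipm ipmDl ipmZl -!primL_ipm -/H HE//.
  have -> : primL (L2one L) x = x.
    have xL : 0 <= x <= L by move: Ix; rewrite /= in_itv/= => /andP[/ltW-> /ltW->].
    have d1 := has_deriv_prim (@contC R 1).
    rewrite -[RHS](_ : prim (fun=> 1) x = x); last first.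
      by have := has_deriv_unique 0 x d1 (@has_deriv_id R); rewrite prim0; lra.
    rewrite -(Rintegral_step (@contC R 1) xL).
    apply: (eq_ipm (L2_measurable _)); last exact: aeW.
    - by case: (step_bounded x).
    - exact: measurable_cst.
    - by case: (step_bounded x).
    - exact: L2oneE.
  by ring.
(* Extension by zero turns the primitive from 0 into an integral from minus infinity, the form
   required by [FTC1Ny]. *)
pose f : RR -> R := (h' : RR -> R) \_ I.
have h'i := integrable_interval_measure (integrable_L2 h').
have fi : leb.-integrable setT (EFin \o f).
  by rewrite /f -restrict_EFin; apply/integrable_restrict => //=; rewrite setTI.
have fiy y : leb.-integrable `]-oo, y] (EFin \o f) by exact: integrableS fi.
have floc : locally_integrable setT f by exact: integrable_locally mI h'i.
have AF' : Filter (almost_everywhere leb) by exact: ae_filter_ringOfSetsType.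
apply/ae_interval_measure; apply: filterS (FTC1Ny fiy floc) => x [_ F'] Ix.
have FE y : \int[leb]_(t in `]-oo, y]) f t = primL h' y.
  rewrite /primL Rintegral_interval_measure; last first.
    apply: measurable_funM; first exact: L2_measurable.
    by case: (step_bounded y).
  rewrite /f -Rintegral_mkcondr setIC Rintegral_mkcondr.
  apply: eq_Rintegral => t _.
  by rewrite patchE /step indicE; case: (_ \in _); rewrite ?mulr1 ?mulr0.
move: F'; rewrite /f patchE mem_set// => <-.
rewrite derive1E.
have d : is_derive x (1 : R) (fun y => \int[leb]_(t in `]-oo, y]) f t) 0.
  apply: near_eq_is_derive (is_derive_cst al _ _).
  have : \forall y \near x, I y.
    by apply: open_nbhs_nbhs; split; [exact: interval_open|].
  by apply: filterS => y Iy; rewrite FE h'E.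
by have [_ ->] := d.
Qed.

End du_bois_reymond.

(** The du Bois-Reymond lemma applied to f minus the primitive of g, which is orthogonal to all
    derivatives of test functions. *)
Lemma weak_derivative_primitive f g : is_weak_derivative f g ->
  exists c : R, (f : R -> R) = (fun x => c + primL g x) %[ae mu].
Proof.
move=> fg; have cG : continuous (primL g) := @primL_cont g.
pose h : L2 L := f + (-1) *: emb L (primL g).
have AF : Filter (almost_everywhere mu) by exact: ae_filter_ringOfSetsType.
have orth p : test_function L p -> ipm L h p^`()%classic = 0.
  move=> tp; have [dp cp [a [b [a0 bL p0]]]] := tp.
  have dp' : has_deriv p p^`()%classic.
    by move=> x; apply: DeriveDef => //; rewrite derive1E.
  have c0 := has_deriv_cont dp'.
  have pL : p L = 0 by apply: p0; rewrite in_itv/= negb_and -!ltNge bL orbT.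
  rewrite -ipm_embr// ipmDl ipmZl ipm_embr//.
  rewrite ipm_emb//.
  have mf q : continuous q -> measurable_fun setT (fun x => f x * q x : R).
    by move=> cq; apply: measurable_funM; [exact: L2_measurable|exact: cont_measurable].
  have mg q : continuous q -> measurable_fun setT (fun x => g x * q x : R).
    by move=> cq; apply: measurable_funM; [exact: L2_measurable|exact: cont_measurable].
  have := fg p tp; rewrite -!Rintegral_interval_measure; [|exact: mg|exact: mf].
  rewrite -[X in X = _]/(ipm L f _) -[X in _ = - X]/(ipm L g p) => ->.
  by rewrite (primL_by_parts g dp' cp) pL mulr0; rewrite /ip; ring.
have [c hc] := du_bois_reymond orth.
exists c; apply: filterS2 (filterI hc (embE L_gt0 cG))
  (filterI (LspaceDE f ((-1) *: emb L (primL g))) (LspaceZE (-1) (emb L (primL g)))).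
move=> x [e1 e2] [e3 e4] Tx.
move: (e3 Tx); rewrite (e1 Tx) (e4 Tx) (e2 Tx) => ->; ring.
Qed.

(** Boundary values are prescribed through an arbitrary continuous representative; this identifies
    it with the smooth one up to the endpoints. A difference at x would persist on a subinterval of
    positive length. *)
Lemma ae_eq_within (u v : R -> R) : {within `[0, L], continuous u} ->
  {within `[0, L], continuous v} -> u = v %[ae mu] ->
  forall x, 0 <= x <= L -> u x = v x.
Proof.
move=> /subspace_continuousP cu /subspace_continuousP cv uv x xL.
have Ax : `[0, L]%classic x by rewrite /= in_itv.
apply/eqP; rewrite -subr_eq0; apply/negPn/negP; rewrite -normr_gt0 => D0.
have cD : `|u t - v t| @[t --> within `[0, L] (nbhs x)] --> `|u x - v x|.
  by apply: cvg_norm; apply: cvgB; [exact: cu|exact: cv].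
have : \forall t \near within `[0, L] (nbhs x), 0 < `|u t - v t|.
  exact: cvgr_gt _ cD _ D0.
rewrite near_withinE => /nbhs_ballP[e /= e0 De].
move: xL => /andP[x0 xL].
pose a := Num.max 0 (x - e); pose b := Num.min L (x + e).
have ab : a < b.
  rewrite /a /b gt_max !lt_min L_gt0/=; apply/andP; split; first by lra.
  by apply/andP; split; lra.
have aE : 0 <= a /\ x - e <= a by rewrite /a !le_max !lexx orbT.
have bE : b <= L /\ b <= x + e by rewrite /b !ge_min !lexx orbT.
have [N [mN N0 sN]] := (ae_interval_measure L _).1 uv.
have : (leb `]a, b[%classic <= leb N)%E.
  apply: le_measure; rewrite ?inE//.
  move=> t /=; rewrite in_itv/= => /andP[ta tb]; apply: sN => /= h.
  have tI : I t by rewrite /= in_itv/=; apply/andP; split; lra.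
  have : 0 < `|u t - v t|.
    apply: De; last by rewrite /= in_itv/=; apply/andP; split; lra.
    by rewrite /ball/= ltr_norml; apply/andP; split; lra.
  by rewrite (h tI Logic.I) subrr normr0 ltxx.
rewrite [X in (_ <= X)%E -> _]N0 lebesgue_measure_itv/= lte_fin ab lee_fin.
by rewrite leNgt subr_gt0 ab.
Qed.

Lemma primL_cont_eq f k : continuous k -> (f : R -> R) = k %[ae mu] ->
  forall x, 0 <= x <= L -> primL f x = prim k x.
Proof.
move=> ck fk x xL; rewrite -(Rintegral_step ck xL).
have ms : measurable_fun setT (step x) by case: (step_bounded x).
apply: (eq_ipm (L2_measurable _) ms (cont_measurable ck) ms fk).
exact: aeW.
Qed.

Lemma weak_derivative_cont f g k : continuous k -> (g : R -> R) = k %[ae mu] ->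
  is_weak_derivative f g -> exists u, has_deriv u k /\ (f : R -> R) = u %[ae mu].
Proof.
move=> ck gk /weak_derivative_primitive[c fc].
exists (fun x => c + prim k x); split.
  have dk := has_deriv_prim ck.
  by eapply has_deriv_eq; [deriv|move=> t /=; ring].
have AF : Filter (almost_everywhere mu) by exact: ae_filter_ringOfSetsType.
apply: filterS2 (ae_I L) fc => x Ix e Tx; rewrite (e Tx) (primL_cont_eq ck gk)//.
by move: Ix; rewrite /= in_itv/= => /andP[/ltW-> /ltW->].
Qed.

(** Going down from w3 in L2, w2 is continuous, w1 is C^1 and w is C^2. As w3 has no pointwise
    meaning, it survives only through its pairing with C^1 functions. *)
Lemma regular_classical (w w1 w2 w3 : L2 L) (d : R) :
  regular_state w w1 w2 w3 d -> exists u u1 u2 : R -> R,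
  [/\ [/\ has_deriv u u1, has_deriv u1 u2 & continuous u2],
      (w : R -> R) = u %[ae mu] /\ (w1 : R -> R) = u1 %[ae mu],
      [/\ u 0 = 0, u L = 0 & u1 L = d] &
      forall p q, has_deriv p q -> continuous q ->
      ipm L w3 p = u2 L * p L - u2 0 * p 0 - intL L (fun x => u2 x * q x)].
Proof.
move=> [[d1 d2 d3] [[v0 [cv0 wv0 v00]] [vL [cvL wvL vLL]] [vd [cvd wvd vdL]]]].
have [c wc] := weak_derivative_primitive d3.
have cG : continuous (primL w3) := @primL_cont w3.
pose u2 x := c + primL w3 x; have cu2 : continuous u2 by rewrite /u2; cont.
have [u1 [du1 w1u]] := weak_derivative_cont cu2 wc d2.
have [u [du wu]] := weak_derivative_cont (has_deriv_cont du1) w1u d1.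
exists u, u1, u2; split => //.
  have AF : Filter (almost_everywhere mu) by exact: ae_filter_ringOfSetsType.
  have cu := continuous_subspaceT (A := `[0, L]%classic) (has_deriv_cont du).
  have cu1 := continuous_subspaceT (A := `[0, L]%classic) (has_deriv_cont du1).
  have tr (f1 : L2 L) (a b : R -> R) : (f1 : R -> R) = a %[ae mu] ->
      (f1 : R -> R) = b %[ae mu] -> a = b %[ae mu].
    by apply: filterS2 => x e1 e2 Tx; rewrite -(e1 Tx) -(e2 Tx).
  have L0 := ltW L_gt0.
  split.
  - by rewrite (ae_eq_within cu cv0 (tr _ _ _ wu wv0)) ?lexx.
  - by rewrite (ae_eq_within cu cvL (tr _ _ _ wu wvL)) ?lexx ?L0.
  - by rewrite (ae_eq_within cu1 cvd (tr _ _ _ w1u wvd)) ?lexx ?L0.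
move=> p q dp cq; rewrite (primL_by_parts w3 dp cq) /u2.
have -> : (fun x => (c + primL w3 x) * q x) = (fun x => c * q x + primL w3 x * q x).
  by apply/funext => x; rewrite mulrDl.
rewrite intLD//; [|cont|cont].
rewrite intLZ// (intL_FTC L_gt0 dp cq) primL0.
by move: (intL L _) (primL w3 L) (p L) (p 0) => X Y Z T; ring.
Qed.

End L2_primitive.

(** * Rates of change along the flow *)

Section dissipation.
Variables (R : realType) (L : R).
Hypothesis L_gt0 : 0 < L.

Local Notation leb := (@lebesgue_measure R).
Local Notation mu := (interval_measure L).
Local Notation RR := (measurableTypeR R).
Local Notation ip := (ip L).
Local Notation ipm := (@ipm R L).
Local Notation emb := (@emb R L).
Local Notation cmul := (@cmul R L).

Lemma ipm_le_norm (f g : L2 L) : `|ipm f g| <= `|f| * `|g|.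
Proof.
rewrite -ler_sqr ?nnegrE ?mulr_ge0// exprMn !L2_normE.
by rewrite real_normK ?num_real// ipm_cs.
Qed.

(* [flow 0] is the linear and [flow 1] the nonlinear equation, tested against
   C^1 functions; u, u1, u2 are the classical derivatives of the state w. *)
Definition flow (th : R) (w d1 : L2 L) (d2 : R) (wt : L2 L) (u u1 u2 : R -> R) :=
  [/\ [/\ has_deriv u u1, has_deriv u1 u2 & continuous u2],
      (w : R -> R) = u %[ae mu],
      [/\ u 0 = 0, u L = 0 & u1 L = d2] &
      forall p q, has_deriv p q -> continuous q ->
      ipm wt p = - ip u1 p - (u2 L * p L - u2 0 * p 0) + ip u2 q
                 - th * ip (fun x => u x * u1 x) p + ipm d1 p].

Lemma regular_flow (th : R) (w w1 w2 w3 d1 : L2 L) (d2 : R) (wt : L2 L) :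
  regular_state w w1 w2 w3 d2 ->
  (wt : R -> R) = (fun x => - w1 x - w3 x - th * (w x * w1 x) + d1 x) %[ae mu] ->
  exists u u1 u2, flow th w d1 d2 wt u u1 u2.
Proof.
move=> /(regular_classical L_gt0)[u [u1 [u2 [[du du1 cu2] [wu w1u] bc w3p]]]] wtE.
exists u, u1, u2; split => // p q dp cq.
have cu := has_deriv_cont du; have cu1 := has_deriv_cont du1.
have cp := has_deriv_cont dp; have cuu : continuous (fun x => u x * u1 x) by cont.
have -> : wt = (- 1) *: w1 + ((- 1) *: w3 + ((- th) *: emb (fun x => u x * u1 x) + d1)).
  apply/Lspace_eqP.
  have AF : Filter (almost_everywhere mu) by exact: ae_filter_ringOfSetsType.
  pose f1 := (- th) *: emb (fun x => u x * u1 x) + d1.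
  pose f2 := (- 1) *: w3 + f1.
  have h1 : ((- 1) *: w1 + f2 : R -> R) = (fun x => (- 1) * w1 x + f2 x) %[ae mu].
    apply: filterS2 (LspaceDE ((- 1) *: w1) f2) (LspaceZE (- 1) w1) => x e1 e2 Tx.
    by rewrite (e1 Tx) (e2 Tx).
  have h2 : (f2 : R -> R) = (fun x => (- 1) * w3 x + f1 x) %[ae mu].
    apply: filterS2 (LspaceDE ((- 1) *: w3) f1) (LspaceZE (- 1) w3) => x e1 e2 Tx.
    by rewrite (e1 Tx) (e2 Tx).
  have h3 : (f1 : R -> R) = (fun x => (- th) * (u x * u1 x) + d1 x) %[ae mu].
    apply: filterS2 (filterI (LspaceDE ((- th) *: emb (fun x => u x * u1 x)) d1)
      (LspaceZE (- th) (emb (fun x => u x * u1 x)))) (embE L_gt0 cuu) => x [e1 e2] e3 Tx.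
    by rewrite (e1 Tx) (e2 Tx) (e3 Tx).
  apply: filterS2 (filterI (filterI wtE h1) h2) (filterI h3 (filterI wu w1u)).
  move=> x [[e1 e2] e3] [e4 [e5 e6]] Tx.
  rewrite (e1 Tx) (e2 Tx) (e3 Tx) (e4 Tx) (e5 Tx) (e6 Tx).
  by move: (u x) (u1 x) (w3 x) (d1 x) => *; ring.
rewrite -(ipm_embr L_gt0 _ cp) 3!ipmDl 3!ipmZl (ipm_emb L_gt0 cuu cp).
rewrite !(ipm_embr L_gt0 _ cp) (w3p _ _ dp cq).
have -> : ipm w1 p = ip u1 p.
  rewrite -(ipm_embr L_gt0 _ cp) (eq_emb L_gt0 cu1 w1u); exact: ipm_emb.
rewrite /ip/=.
move: (intL L _) (intL L _) (intL L _) (ipm d1 p) (u2 L * p L) (u2 0 * p 0) => *.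
ring.
Qed.

Lemma linear_flow (w d1 : L2 L) (d2 : R) (wt : L2 L) :
  kdv_linear w d1 d2 wt -> exists u u1 u2, flow 0 w d1 d2 wt u u1 u2.
Proof.
move=> [w1 [w2 [w3 [reg wtE]]]]; apply: (regular_flow reg).
have AF : Filter (almost_everywhere mu) by exact: ae_filter_ringOfSetsType.
by apply: filterS wtE => x e Tx; rewrite (e Tx) mul0r subr0.
Qed.

Lemma nonlinear_flow (w d1 : L2 L) (d2 : R) (wt : L2 L) :
  kdv_nonlinear w d1 d2 wt -> exists u u1 u2, flow 1 w d1 d2 wt u u1 u2.
Proof.
move=> [w1 [w2 [w3 [reg wtE]]]]; apply: (regular_flow reg).
have AF : Filter (almost_everywhere mu) by exact: ae_filter_ringOfSetsType.
by apply: filterS wtE => x e Tx; rewrite (e Tx) mul1r.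
Qed.

Section along_a_flow.
Variables (th : R) (w d1 : L2 L) (d2 : R) (wt : L2 L) (u u1 u2 : R -> R).
Hypothesis fl : flow th w d1 d2 wt u u1 u2.

Let du : has_deriv u u1. Proof. by case: fl => [[]]. Qed.
Let du1 : has_deriv u1 u2. Proof. by case: fl => [[]]. Qed.
Let cu2 : continuous u2. Proof. by case: fl => [[]]. Qed.
Let cu : continuous u. Proof. exact: has_deriv_cont du. Qed.
Let cu1 : continuous u1. Proof. exact: has_deriv_cont du1. Qed.

Lemma flow_emb : w = emb u.
Proof. by case: fl => _ wu _ _; exact: eq_emb. Qed.

Lemma flow_ipm (p : R -> R) : continuous p -> ipm w p = ip u p.
Proof. by move=> cp; rewrite -ipm_embr// flow_emb ipm_emb. Qed.

Lemma flow_sqr : `|w| ^+ 2 = ip u u.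
Proof. by rewrite L2_normE flow_emb ipm_emb. Qed.

(** All derivatives are moved onto g, with w w_x = (w^2 / 2)_x; since w and g vanish at both ends,
    only the boundary terms with w' survive. With g = g_n this is the equation of the moments. *)
Lemma rate_dirichlet g g1 g2 g3 : smooth3 g g1 g2 g3 -> dirichlet L g ->
  ipm wt g = ip u (fun x => g1 x + g3 x) + (g1 L * d2 - g1 0 * u1 0)
    + th / 2 * ip u (fun x => u x * g1 x) + ipm d1 g.
Proof.
move=> [dg dg1 dg2 cg3] [g0 gL]; case: fl => _ _ [u0 uL u1L] /(_ _ _ dg (has_deriv_cont dg1)) ->.
have cg := has_deriv_cont dg; have cg1 := has_deriv_cont dg1.
have cg2 := has_deriv_cont dg2.
rewrite g0 gL !mulr0 subrr subr0.
pose k x := u x * u1 x * g x + u x * u x * g1 x / 2.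
pose h x := - (u1 x * g x) + u2 x * g1 x - (u x * (g1 x + g3 x)).
have e1 : intL L k = 0.
  rewrite (@intL_FTC _ _ L_gt0 (fun x => u x * u x * g x / 2)).
  - by rewrite g0 gL !mulr0 !mul0r subrr.
  - by eapply has_deriv_eq; [deriv|move=> x /=; rewrite /k; field].
  - by rewrite /k; cont.
have e2 : intL L h = g1 L * d2 - g1 0 * u1 0.
  rewrite (@intL_FTC _ _ L_gt0 (fun x => - (u x * g x) + u1 x * g1 x - u x * g2 x)).
  - rewrite u0 uL u1L g0 gL; move: (g1 L) (g1 0) (u1 0) (g2 0) (g2 L) => *; ring.
  - by eapply has_deriv_eq; [deriv|move=> x /=; rewrite /h; ring].
  - by rewrite /h; cont.
have e3 : intL L k = ip (fun x => u x * u1 x) g + 2^-1 * ip u (fun x => u x * g1 x).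
  rewrite /ip -intLZ//; last by cont.
  rewrite -intLD//; [|cont|cont].
  by apply: eq_intL => x _; rewrite /k; ring.
have e4 : intL L h = - ip u1 g + ip u2 g1 - ip u (fun x => g1 x + g3 x).
  rewrite /ip -!intLN//; try cont.
  rewrite -!intLD//; try cont.
rewrite e1 in e3; rewrite e2 in e4.
move: e3 e4; move: (ip _ _) (ip u1 g) (ip u2 g1) (ip u _) (ip u _) (ipm d1 g).
move: (g1 L * d2) (g1 0 * u1 0) => p q A B C D E F e3 e4.
have -> : A = - (2^-1 * E) by lra.
have -> : p - q = - B + C - D by lra.
by field.
Qed.

(** The energy identity for the density rho w^2. A constant second derivative removes the term in
    rho''' w^2. *)
Lemma rate_multiplier (rho rho1 : R -> R) (c : R) :
    has_deriv rho rho1 -> has_deriv rho1 (fun=> c) ->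
  2 * ipm wt (fun x => rho x * u x) =
    intL L (fun x => rho1 x * u x ^+ 2) - 3 * intL L (fun x => rho1 x * u1 x ^+ 2)
    + rho L * d2 ^+ 2 - rho 0 * u1 0 ^+ 2
    + 2 / 3 * th * intL L (fun x => rho1 x * u x ^+ 3)
    + 2 * ipm d1 (fun x => rho x * u x).
Proof.
move=> dr dr1; case: fl => _ _ [u0 uL u1L] w3p.
have cr := has_deriv_cont dr; have cr1 := has_deriv_cont dr1.
have dp : has_deriv (fun x => rho x * u x) (fun x => rho1 x * u x + rho x * u1 x).
  by eapply has_deriv_eq; [deriv|move=> x /=; ring].
rewrite (w3p _ _ dp); last by cont.
rewrite u0 uL !mulr0 subrr subr0.
pose A x := rho1 x * u x ^+ 2; pose B x := rho1 x * u1 x ^+ 2.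
pose C x := rho1 x * u x ^+ 3; pose D x := u1 x * (rho x * u x).
pose E x := u2 x * (rho1 x * u x + rho x * u1 x).
pose F x := u x * u1 x * (rho x * u x).
have [cA cB cC] : [/\ continuous A, continuous B & continuous C].
  by split; rewrite ?/A ?/B ?/C; cont.
have [cD cE cF] : [/\ continuous D, continuous E & continuous F].
  by split; rewrite ?/D ?/E ?/F; cont.
pose k x := 3 * F x + C x.
have e1 : intL L k = 0.
  rewrite (@intL_FTC _ _ L_gt0 (fun x => rho x * u x ^+ 3)).
  - by rewrite u0 uL !expr0n /= !mulr0 subrr.
  - by eapply has_deriv_eq; [deriv|move=> x /=; rewrite /k /F /C; ring].
  - by rewrite /k; cont.
pose h x := 2 * (- D x + E x) + (3 * B x - A x).
have e2 : intL L h = rho L * d2 ^+ 2 - rho 0 * u1 0 ^+ 2.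
  rewrite (@intL_FTC _ _ L_gt0 (fun x => - (rho x * u x ^+ 2)
    + 2 * (rho1 x * (u x * u1 x)) + rho x * u1 x ^+ 2 - c * u x ^+ 2)).
  - rewrite u0 uL u1L; move: (rho L) (rho 0) (u1 0) (rho1 L) (rho1 0) => *; ring.
  - by eapply has_deriv_eq; [deriv|move=> x /=; rewrite /h /A /B /D /E; ring].
  - by rewrite /h; cont.
have e3 : intL L k = 3 * intL L F + intL L C.
  by rewrite -intLZ// -intLD//; cont.
have e4 : intL L h = 2 * (- intL L D + intL L E) + (3 * intL L B - intL L A).
  rewrite -intLN// -intLD//; try cont.
  rewrite -!intLZ//; try cont.
  rewrite -intLN// -!intLD//; try cont.
rewrite e1 in e3; rewrite e2 in e4.
rewrite /ip -/D -/E -/F -/A -/B -/C; move: e3 e4; move: (ipm d1 _).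
move: (intL L A) (intL L B) (intL L C) (intL L D) (intL L E) (intL L F).
move: (rho L * d2 ^+ 2) (rho 0 * u1 0 ^+ 2).
move=> p q A' B' C' D' E' F' x e3 e4.
have -> : F' = - (3^-1 * C') by lra.
have -> : p = q + (2 * (- D' + E') + (3 * B' - A')) by lra.
by field.
Qed.

End along_a_flow.

(** The slope w'(0) counts as an input: it is not controlled by |w|, but the energy identity
    dissipates it. *)
Definition input_size (d1 : L2 L) (d2 : R) (u1 : R -> R) : R :=
  `|u1 0| + `|d1| + `|d2|.

Lemma input_size_ge0 d1 d2 u1 : 0 <= input_size d1 d2 u1.
Proof. by rewrite /input_size !addr_ge0. Qed.

Lemma weight_bound g : continuous g -> exists2 K, 0 < K &
  forall th w d1 d2 wt u u1 u2, flow th w d1 d2 wt u u1 u2 ->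
  `|ip u g| <= K * `|w|.
Proof.
move=> cg; exists (`|emb g| + 1); first by rewrite ltr_wpDl.
move=> th w d1 d2 wt u u1 u2 fl; rewrite -(flow_ipm fl cg) -ipm_embr//.
rewrite mulrC; apply: le_trans (ipm_le_norm _ _) _.
by rewrite ler_wpM2l// lerDl.
Qed.

Lemma square_weight_bound g : continuous g -> exists2 K, 0 < K &
  forall th w d1 d2 wt u u1 u2, flow th w d1 d2 wt u u1 u2 ->
  `|ip u (fun x => u x * g x)| <= K * `|w| ^+ 2.
Proof.
move=> cg; have [B gB] := continuous_bound L_gt0 cg.
have gB1 x : 0 <= x <= L -> `|g x| <= `|B| + 1.
  by move=> /gB; move: (ler_norm B); move: `|_| `|_| => *; lra.
exists (`|B| + 1); first by rewrite ltr_wpDl.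
move=> th w d1 d2 wt u u1 u2 fl.
have cu : continuous u by case: fl => [[/has_deriv_cont]].
have -> : ip u (fun x => u x * g x) = ipm w (cmul g w).
  rewrite (flow_emb fl) cmul_emb// ipm_emb//; last by cont.
  by rewrite /ip; congr intL; apply/funext => x; rewrite (mulrC (g x)).
apply: le_trans (ipm_le_norm _ _) _.
rewrite expr2 mulrCA ler_wpM2l//; exact: cmul_bound.
Qed.

Lemma rate_error g g1 g2 g3 : smooth3 g g1 g2 g3 -> dirichlet L g ->
  exists2 K, 0 < K &
  forall th w d1 d2 wt u u1 u2, 0 <= th -> flow th w d1 d2 wt u u1 u2 ->
  `|ipm wt g - ip u (fun x => g1 x + g3 x)| <=
    K * (input_size d1 d2 u1 + th * `|w| ^+ 2).
Proof.
move=> sg dg; have [dg0 dg1 _ _] := sg.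
have cg := has_deriv_cont dg0; have cg1 := has_deriv_cont dg1.
have [C C0 CP] := square_weight_bound cg1.
pose K := `|emb g| + `|g1 0| + `|g1 L| + C.
have K0 : 0 < K by rewrite ltr_wpDl// !addr_ge0.
exists K => // th w d1 d2 wt u u1 u2 th0 fl.
rewrite (rate_dirichlet fl sg dg); have /= := CP _ _ _ _ _ _ _ _ fl.
have := ipm_le_norm d1 (emb g); rewrite ipm_embr//.
rewrite /K /input_size.
have : 0 <= `|w| ^+ 2 by rewrite exprn_ge0.
move: (ip u _) (ip u _) (ipm d1 g) (`|w| ^+ 2) => X Y Z S S0.
have : 0 <= `|emb g| by []. have : 0 <= `|d1| by [].
move: `|emb g| `|d1| => G E E0 G0 hZ hY.
have -> : X + (g1 L * d2 - g1 0 * u1 0) + th / 2 * Y + Z - X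
  = g1 L * d2 - g1 0 * u1 0 + th / 2 * Y + Z by ring.
apply: le_trans (ler_normD _ _) _; apply: le_trans (lerD (ler_normD _ _) (lexx _)) _.
apply: le_trans (lerD (lerD (ler_normB _ _) (lexx _)) (lexx _)) _.
rewrite !normrM (ger0_norm th0) [`|2^-1|]ger0_norm ?invr_ge0//.
have hthY : th * `|Y| <= th * (C * S) by rewrite ler_wpM2l.
have : 0 <= C * S by rewrite mulr_ge0// ltW.
have := C0; have := normr_ge0 d2; have := normr_ge0 (g1 0).
have := normr_ge0 (g1 L); have := normr_ge0 (u1 0).
move: `|Y| hY hthY `|Z| hZ `|d2| `|g1 0| `|g1 L| `|u1 0| C0.
move=> Y' hY hthY Z' hZ a b c d {}C0 d0 c0 b0 a0 _ CS0.
have h1 : 0 <= (G + b + c) * (th * S) by rewrite mulr_ge0 ?addr_ge0// mulr_ge0.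
have h2 : 0 <= c * (d + E) by rewrite mulr_ge0 ?addr_ge0.
have h3 : 0 <= b * (E + a) by rewrite mulr_ge0 ?addr_ge0.
have h4 : 0 <= (G + C) * (d + E + a) by rewrite !mulr_ge0 ?addr_ge0// ltW.
have h5 : 0 <= th * (C * S) by rewrite mulr_ge0.
have h6 : 0 <= C * E + G * (d + a).
  by rewrite addr_ge0// mulr_ge0 ?addr_ge0// ltW.
nra.
Qed.

Lemma rate_bound g g1 g2 g3 : smooth3 g g1 g2 g3 -> dirichlet L g ->
  exists2 K, 0 < K &
  forall th w d1 d2 wt u u1 u2, 0 <= th -> flow th w d1 d2 wt u u1 u2 ->
  `|ipm wt g| <= K * (`|w| + input_size d1 d2 u1 + th * `|w| ^+ 2).
Proof.
move=> sg dg; have [dg0 dg1 dg2 cg3] := sg.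
have cs : continuous (fun x => g1 x + g3 x).
  by have cg1 := has_deriv_cont dg1; cont.
have [K K0 KP] := rate_error sg dg; have [K' K'0 KP'] := weight_bound cs.
exists (K + K'); first by rewrite addr_gt0.
move=> th w d1 d2 wt u u1 u2 th0 fl.
have := KP _ _ _ _ _ _ _ _ th0 fl; have := KP' _ _ _ _ _ _ _ _ fl.
have := input_size_ge0 d1 d2 u1; have : 0 <= `|w| by [].
move: (ip u _) (ipm wt g) (input_size _ _ _) `|w| => X Y D B B0 D0 hX hY.
have tB0 : 0 <= th * B ^+ 2 by rewrite mulr_ge0// exprn_ge0.
have h0 : `|Y| <= `|Y - X| + `|X| by rewrite -{1}(subrK X Y) ler_normD.
have h1 : 0 <= K * B by rewrite mulr_ge0// ltW.
have h2 : 0 <= K' * (D + th * B ^+ 2) by rewrite mulr_ge0 ?addr_ge0// ltW.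
move: (th * _) tB0 h2 hY => T T0 h2 hY.
move: `|Y - X| `|X| `|Y| hX h0 hY => n1 n2 n3 hX h0 hY; nra.
Qed.

Hypothesis cosL : cos L != 1.

Lemma chain_rate n : exists2 K, 0 < K &
  forall th w d1 d2 wt u u1 u2, 0 <= th -> flow th w d1 d2 wt u u1 u2 ->
  `|ipm wt (chain L n) - (if n is k.+1 then ip u (chain L k) else 0)| <=
    K * (input_size d1 d2 u1 + th * `|w| ^+ 2).
Proof.
have [K K0 KP] := rate_error (chain_smooth L n) (chain_dirichlet cosL n).
exists K => // th w d1 d2 wt u u1 u2 th0 fl.
have := KP _ _ _ _ _ _ _ _ th0 fl.
have -> : ip u (fun x => chain1 L n x + chain3 L n x) =
    (if n is k.+1 then ip u (chain L k) else 0) => //.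
rewrite /ip; under eq_intL => x _ do rewrite chain_eq.
by case: n {K K0 KP} => [|k//]; under eq_intL => x _ do rewrite mulr0; rewrite intL0.
Qed.

Lemma young (a b t : R) : 0 < t -> 2 * a * b <= t * a ^+ 2 + b ^+ 2 / t.
Proof.
move=> t0; rewrite -subr_ge0.
have -> : t * a ^+ 2 + b ^+ 2 / t - 2 * a * b = t * (a - b / t) ^+ 2.
  by field; rewrite gt_eqF.
by rewrite mulr_ge0 ?sqr_ge0// ltW.
Qed.

(** One product of consecutive moments: b and c stand for m_n and m_(n+1), with derivatives a + e
    and b + e', where a is m_(n-1) and e, e' are errors; B, D, T stand for |w|, the inputs and th
    |w|^2. Young's inequality trades the product a c for a multiple of a^2 and a small multiple of
    B^2. *)
Lemma chain_step (tau Gam K B D T a b c e e' : R) :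
  0 < tau -> 0 < Gam -> 0 < K -> 0 <= B -> 0 <= D -> 0 <= T ->
  `|b| <= K * B -> `|c| <= K * B ->
  `|e| <= K * (D + T) -> `|e'| <= K * (D + T) ->
  - (2 * Gam * ((a + e) * c + b * (b + e'))) <=
    - (2 * Gam * b ^+ 2) + 4 * Gam ^+ 2 * K ^+ 2 / tau * a ^+ 2 + tau / 2 * B ^+ 2
    + 16 * Gam ^+ 2 * K ^+ 4 / tau * D ^+ 2 + 4 * Gam * K ^+ 2 * (T * B).
Proof.
move=> tau0 Gam0 K0 B0 D0 T0 hb hc he he'.
have t4 : 0 < tau / 4 by rewrite divr_gt0.
have y1 := young B (Gam * K * `|a|) t4.
have y2 := young B (2 * Gam * K ^+ 2 * D) t4.
have ne : - (e * c) <= K * (D + T) * (K * B).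
  by rewrite (le_trans (ler_norm _))// normrN normrM ler_pM.
have nb : - (b * e') <= K * B * (K * (D + T)).
  by rewrite (le_trans (ler_norm _))// normrN normrM ler_pM.
have na : - (a * c) <= `|a| * (K * B).
  by rewrite (le_trans (ler_norm _))// normrN normrM ler_pM.
have e1 : (Gam * K * `|a|) ^+ 2 / (tau / 4) = 4 * Gam ^+ 2 * K ^+ 2 / tau * a ^+ 2.
  by rewrite !exprMn -normrX ger0_norm ?sqr_ge0//; field; rewrite gt_eqF.
have e2 : (2 * Gam * K ^+ 2 * D) ^+ 2 / (tau / 4) = 16 * Gam ^+ 2 * K ^+ 4 / tau * D ^+ 2.
  by field; rewrite gt_eqF.
rewrite e1 in y1; rewrite e2 in y2.
have n3 : 2 * Gam * (- (a * c) - e * c - b * e') <=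
    2 * Gam * (`|a| * (K * B) + K * (D + T) * (K * B) + K * B * (K * (D + T))).
  have g0 : 0 <= 2 * Gam by rewrite mulr_ge0// ltW.
  apply: ler_wpM2l => //; move: ne nb na; move: (e * c) (b * e') (a * c) => X Y Z; lra.
move: y1 y2 n3; move: (4 * Gam ^+ 2 * _ / tau * _) (16 * Gam ^+ 2 * K ^+ 4 / tau * D ^+ 2) `|a|.
by move=> X Y Z y1 y2 n3; nra.
Qed.

(** The last product receives the weight [Gam] and costs a multiple A of the previous squared
    moment; the induction hypothesis is therefore used with [Gam] increased by A and half of [tau].
    The weights are thus fixed from the highest index down. *)
Lemma chain_control N (tau Gam : R) : 0 < tau -> 0 < Gam ->
  exists gam : nat -> R, exists2 C, 0 < C &
  forall th w d1 d2 wt u u1 u2, 0 <= th -> flow th w d1 d2 wt u u1 u2 ->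
  - (2 * \sum_(n < N) gam n * (ipm wt (chain L n) * ip u (chain L n.+1)
        + ip u (chain L n) * ipm wt (chain L n.+1))) <=
    - (Gam * \sum_(n < N) ip u (chain L n) ^+ 2) + tau * `|w| ^+ 2
    + C * (input_size d1 d2 u1 ^+ 2 + th * `|w| ^+ 3).
Proof.
elim: N tau Gam => [|N IH] tau Gam tau0 Gam0.
  exists (fun=> 0); exists 1 => // th w d1 d2 wt u u1 u2 th0 fl.
  have := ltW tau0; rewrite !big_ord0 !mulr0 oppr0 add0r mul1r => tau1.
  by rewrite !addr_ge0 ?mulr_ge0 ?exprn_ge0 ?input_size_ge0.
have [k1 k10 k1P] := chain_rate N; have [k2 k20 k2P] := chain_rate N.+1.
have [k3 k30 k3P] := weight_bound (has_deriv_cont (let: And4 h _ _ _ := chain_smooth L N in h)).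
have [k4 k40 k4P] := weight_bound (has_deriv_cont (let: And4 h _ _ _ := chain_smooth L N.+1 in h)).
pose K := k1 + k2 + k3 + k4.
have [l1 l2 l3 l4] : [/\ k1 <= K, k2 <= K, k3 <= K & k4 <= K].
  by split; rewrite /K; move: k10 k20 k30 k40; lra.
have K0 : 0 < K by exact: lt_le_trans l1.
have [tau1 Gam1 K1] : [/\ 0 <= tau, 0 <= Gam & 0 <= K] by split; exact: ltW.
pose A := 4 * Gam ^+ 2 * K ^+ 2 / tau.
have A0 : 0 <= A by rewrite divr_ge0 ?mulr_ge0 ?exprn_ge0.
have [gam [C C0 CP]] := IH _ _ (divr_gt0 tau0 (ltr0Sn _ 1)) (ltr_wpDr A0 Gam0).
pose C1 := 16 * Gam ^+ 2 * K ^+ 4 / tau; pose C2 := 4 * Gam * K ^+ 2.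
have C10 : 0 <= C1 by rewrite divr_ge0 ?mulr_ge0 ?exprn_ge0.
have C20 : 0 <= C2 by rewrite ?mulr_ge0 ?exprn_ge0.
exists (fun n => if n == N then Gam else gam n).
exists (C + C1 + C2); first by rewrite ltr_wpDr// ltr_wpDr.
move=> th w d1 d2 wt u u1 u2 th0 fl.
rewrite !big_ord_recr/= eqxx.
under eq_bigr => i _ do rewrite (ltn_eqF (ltn_ord i)).
have := CP _ _ _ _ _ _ _ _ th0 fl.
set S1 := \sum_(i < N) _ * _; set S2 := \sum_(i < N) _.
have hN := k1P _ _ _ _ _ _ _ _ th0 fl; have hN1 := k2P _ _ _ _ _ _ _ _ th0 fl.
have hm := k3P _ _ _ _ _ _ _ _ fl; have hm1 := k4P _ _ _ _ _ _ _ _ fl.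
set a : R := if N is k.+1 then ip u (chain L k) else 0 in hN.
have aS : a ^+ 2 <= S2.
  rewrite /a /S2; case: (N) => [|k]; first by rewrite big_ord0 expr0n.
  by rewrite big_ord_recr/= lerDr sumr_ge0// => i _; rewrite sqr_ge0.
have D0 := input_size_ge0 d1 d2 u1; have B0 : 0 <= `|w| by [].
have T0 : 0 <= th * `|w| ^+ 2 by rewrite mulr_ge0 ?exprn_ge0.
have DT0 := addr_ge0 D0 T0.
have st := chain_step a tau0 Gam0 K0 B0 D0 T0 (le_trans hm (ler_wpM2r B0 l3))
  (le_trans hm1 (ler_wpM2r B0 l4)) (le_trans hN (ler_wpM2r DT0 l1))
  (le_trans hN1 (ler_wpM2r DT0 l2)).
move: st; rewrite 2![_ + (ipm wt _ - _)]addrC 2!subrK.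
rewrite -[bvp L _]/(chain L N.+1) -/A -/C1 -/C2.
have -> : th * `|w| ^+ 2 * `|w| = th * `|w| ^+ 3 by rewrite -mulrA -exprSr.
rewrite -[2 * Gam * (_ + _)]mulrA.
have T30 : 0 <= th * `|w| ^+ 3 by rewrite mulr_ge0 ?exprn_ge0.
have D20 : 0 <= input_size d1 d2 u1 ^+ 2 by rewrite exprn_ge0.
have GY : 0 <= Gam * ip u (chain L N) ^+ 2 by rewrite mulr_ge0 ?sqr_ge0.
have AS : A * a ^+ 2 <= A * S2 by rewrite ler_wpM2l.
have CC1 : 0 <= C1 * (th * `|w| ^+ 3) by rewrite mulr_ge0.
have CC2 : 0 <= C2 * input_size d1 d2 u1 ^+ 2 by rewrite mulr_ge0.
move: (th * _ ^+ 3) (input_size _ _ _ ^+ 2) (A * a ^+ 2) T30 D20 AS CC1 CC2 GY.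
move: (ipm wt _ * _ + _) (ip u _ ^+ 2) (`|w| ^+ 2) => X Y Z P Q U P0 Q0 AS CC1 CC2 GY s1 s2.
move: S1 S2 s2 AS {aS} => S1 S2 s2 AS.
clear -s1 s2 AS CC1 CC2 GY P0 Q0; nra.
Qed.

End dissipation.

(** * The transformation Pi *)

Section feedback_operator.
Variables (R : realType) (L : R).
Hypothesis L_gt0 : 0 < L.
Hypothesis cosL : cos L != 1.

Local Notation mu := (interval_measure L).
Local Notation ip := (ip L).
Local Notation ipm := (@ipm R L).
Local Notation emb := (@emb R L).
Local Notation cmul := (@cmul R L).
Local Notation chain := (chain L).
Local Notation input_size := (@input_size R L).
Local Notation flow := (@flow R L).

Let cont_chain n : continuous (chain n).
Proof. by case: (chain_smooth L n) => /has_deriv_cont. Qed.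

Definition feedback (gam : nat -> R) (N : nat) (w : L2 L) : L2 L :=
  - \sum_(n < N) (gam n * ipm w (chain n)) *: emb (chain n.+1).

(* The weight 1 + eps |x| is 1 + eps x on (0, L), and is invertible on R. *)
Definition transform (eps : R) (gam : nat -> R) (N : nat) (w : L2 L) : L2 L :=
  cmul (fun x => 1 + eps * `|x|) w + eps *: feedback gam N w.

Lemma ipm_feedback gam N (w f : L2 L) :
  ipm f (feedback gam N w) =
  - \sum_(n < N) gam n * (ipm w (chain n) * ipm f (chain n.+1)).
Proof.
rewrite /feedback -scaleN1r ipmZr mulN1r; congr (- _).
elim: N => [|N IH]; first by rewrite !big_ord0 -(scale0r (0 : L2 L)) ipmZr mul0r.
rewrite 2!big_ord_recr ipmDr IH ipmZr (ipm_embr L_gt0); last exact: cont_chain.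
by rewrite mulrA.
Qed.

Definition feedback_gain (gam : nat -> R) (N : nat) : R :=
  \sum_(n < N) `|gam n| * `|emb (chain n.+1)|.

Lemma feedback_gain_ge0 gam N : 0 <= feedback_gain gam N.
Proof. by apply: sumr_ge0 => n _; rewrite mulr_ge0. Qed.

Lemma feedback_norm gam N (w : L2 L) (s : R) :
  (forall n, (n < N)%N -> `|ipm w (chain n)| <= s) ->
  `|feedback gam N w| <= feedback_gain gam N * s.
Proof.
move=> ws; rewrite /feedback normrN; apply: le_trans (ler_norm_sum _ _ _) _.
rewrite /feedback_gain mulr_suml; apply: ler_sum => n _.
rewrite normrZ normrM -!mulrA ler_wpM2l// mulrC ler_wpM2l//.
exact: ws.
Qed.

Lemma eq_cmul g h (f : L2 L) : (forall x, 0 < x < L -> g x = h x) ->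
  cmul g f = cmul h f.
Proof.
move=> gh; rewrite /cmul; congr mulL; apply/funext => x; rewrite !patchE.
by case: ifPn => //; rewrite inE/= in_itv/= => /gh.
Qed.

Let affine_cont (eps : R) : continuous (fun x : R => 1 + eps * x).
Proof. by cont. Qed.

Lemma transformE eps gam N (w : L2 L) :
  transform eps gam N w = cmul (fun x => 1 + eps * x) w + eps *: feedback gam N w.
Proof.
rewrite /transform; congr (_ + _); apply: eq_cmul => x /andP[x0 _].
by rewrite gtr0_norm.
Qed.

Lemma ipm_affine (eps : R) (f : L2 L) (g : R -> R) : continuous g ->
  ipm (cmul (fun x => 1 + eps * x) f) g = ipm f g + eps * ipm f (fun x => x * g x).
Proof.
move=> cg; rewrite -(ipm_embr L_gt0 _ cg) ipm_cmul// cmul_emb//.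
have ch : continuous (fun x : R => x * g x) by cont.
have -> : (fun x => (1 + eps * x) * g x) = (fun x => eps * (x * g x) + g x).
  by apply/funext => x; ring.
by rewrite embD// ipmDr ipmZr !ipm_embr// addrC.
Qed.

(** The factor 1 + eps x in the transformation produces moments against x g_n; these functions also
    vanish at both ends, so their moments have bounded rates. *)
Lemma chain_weighted n : exists g1 g2 g3,
  smooth3 (fun x => x * chain n x) g1 g2 g3 /\ dirichlet L (fun x => x * chain n x).
Proof.
have [d0 d1 d2 c3] := chain_smooth L n; have [z0 zL] := chain_dirichlet cosL n.
exists (fun x => chain n x + x * chain1 L n x),
  (fun x => 2 * chain1 L n x + x * chain2 L n x),
  (fun x => 3 * chain2 L n x + x * chain3 L n x); split; last first.
  by split; rewrite ?mul0r// zL mulr0.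
have c2 := has_deriv_cont d2.
by split; [eapply has_deriv_eq; [deriv|move=> x /=; ring]..|cont].
Qed.

Definition rate_size (th : R) (w d1 : L2 L) (d2 : R) (u1 : R -> R) : R :=
  `|w| + input_size d1 d2 u1 + th * `|w| ^+ 2.

Lemma rate_size_ge0 th w d1 d2 u1 : 0 <= th -> 0 <= rate_size th w d1 d2 u1.
Proof.
by move=> th0; rewrite /rate_size !addr_ge0 ?input_size_ge0 ?mulr_ge0 ?exprn_ge0.
Qed.

Lemma chain_bounds N : exists2 K, 0 < K &
  forall th w d1 d2 wt u u1 u2, 0 <= th -> flow th w d1 d2 wt u u1 u2 ->
  forall n, (n <= N)%N ->
  [/\ `|ipm w (chain n)| <= K * `|w|,
      `|ipm w (fun x => x * chain n x)| <= K * `|w|,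
      `|ipm wt (chain n)| <= K * rate_size th w d1 d2 u1 &
      `|ipm wt (fun x => x * chain n x)| <= K * rate_size th w d1 d2 u1].
Proof.
pose Q n K := forall th w d1 d2 wt u u1 u2, 0 <= th -> flow th w d1 d2 wt u u1 u2 ->
  [/\ `|ipm w (chain n)| <= K * `|w|,
      `|ipm w (fun x => x * chain n x)| <= K * `|w|,
      `|ipm wt (chain n)| <= K * rate_size th w d1 d2 u1 &
      `|ipm wt (fun x => x * chain n x)| <= K * rate_size th w d1 d2 u1].
have Qle n K K' : K <= K' -> Q n K -> Q n K'.
  move=> KK QK th w d1 d2 wt u u1 u2 th0 fl.
  have r0 := rate_size_ge0 w d1 d2 u1 th0; have w0 : 0 <= `|w| by [].
  have [h1 h2 h3 h4] := QK _ _ _ _ _ _ _ _ th0 fl.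
  split; [apply: le_trans h1 _|apply: le_trans h2 _|apply: le_trans h3 _
         |apply: le_trans h4 _]; exact: ler_wpM2r.
have Q1 n : exists2 K, 0 < K & Q n K.
  have cx : continuous (fun x : R => x * chain n x).
    by have cn := @cont_chain n; cont.
  have [g1 [g2 [g3 [sg dg]]]] := chain_weighted n.
  have [a a0 aP] := weight_bound L_gt0 (@cont_chain n).
  have [b b0 bP] := weight_bound L_gt0 cx.
  have [c c0 cP] := rate_bound L_gt0 (chain_smooth L n) (chain_dirichlet cosL n).
  have [d d0 dP] := rate_bound L_gt0 sg dg.
  exists (a + b + c + d); first by rewrite !addr_gt0.
  move=> th w d1 d2 wt u u1 u2 th0 fl.
  have r0 := rate_size_ge0 w d1 d2 u1 th0; have w0 : 0 <= `|w| by [].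
  rewrite !(flow_ipm L_gt0 fl)//.
  split.
  - apply: le_trans (aP _ _ _ _ _ _ _ _ fl) _.
    by apply: ler_wpM2r => //; move: a0 b0 c0 d0; lra.
  - apply: le_trans (bP _ _ _ _ _ _ _ _ fl) _.
    by apply: ler_wpM2r => //; move: a0 b0 c0 d0; lra.
  - apply: le_trans (cP _ _ _ _ _ _ _ _ th0 fl) _.
    by apply: ler_wpM2r => //; move: a0 b0 c0 d0; lra.
  - apply: le_trans (dP _ _ _ _ _ _ _ _ th0 fl) _.
    by apply: ler_wpM2r => //; move: a0 b0 c0 d0; lra.
suff [K K0 KP] : exists2 K, 0 < K & forall n, (n <= N)%N -> Q n K.
  by exists K => // th w d1 d2 wt u u1 u2 th0 fl n nN; exact: (KP n nN _ _ _ _ _ _ _ _ th0 fl).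
elim: N => [|N [K K0 KP]].
  by have [K K0 QK] := Q1 0%N; exists K => // n; rewrite leqn0 => /eqP->.
have [K' K'0 QK] := Q1 N.+1; exists (K + K') => [|n]; first by rewrite addr_gt0.
rewrite leq_eqVlt => /predU1P[->|nN].
  by apply: Qle QK; rewrite lerDr ltW.
by apply: Qle (KP _ nN); rewrite lerDl ltW.
Qed.

(** Expansion of <Pi w, Pi w_t>. Apart from the weighted energy and the first-order terms of the
    feedback, everything carries eps^2 and is built from moments of w and w_t against g_n and x g_n,
    hence bounded without |w_t|. *)
Lemma transform_rate gam N : exists2 K, 0 < K &
  forall eps th w d1 d2 wt u u1 u2, 0 <= th -> flow th w d1 d2 wt u u1 u2 ->
  `|ipm (transform eps gam N w) (transform eps gam N wt)
    - ipm wt (fun x => (1 + eps * x) ^+ 2 * u x)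
    + eps * \sum_(n < N) gam n * (ipm wt (chain n) * ip u (chain n.+1)
        + ip u (chain n) * ipm wt (chain n.+1))| <=
  eps ^+ 2 * (K * (`|w| * rate_size th w d1 d2 u1)).
Proof.
have [K K0 KP] := chain_bounds N.
pose G := \sum_(n < N) `|gam n|; pose H := feedback_gain gam N.
have G0 : 0 <= G by exact: sumr_ge0.
have H0 : 0 <= H by exact: feedback_gain_ge0.
exists (2 * (K ^+ 2 * G) + H ^+ 2 * K ^+ 2 + 1).
  by rewrite ltr_wpDl// addr_ge0 ?mulr_ge0 ?exprn_ge0// ltW.
move=> eps th w d1 d2 wt u u1 u2 th0 fl.
have cu : continuous u by case: fl => [[/has_deriv_cont]].
have bd := KP _ _ _ _ _ _ _ _ th0 fl.
have r0 := rate_size_ge0 w d1 d2 u1 th0.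
set r := rate_size _ _ _ _ _ in bd r0 *.
have mE n : ip u (chain n) = ipm w (chain n).
  by rewrite (flow_ipm L_gt0 fl).
pose aw : L2 L := cmul (fun x => 1 + eps * x) w.
pose at_ : L2 L := cmul (fun x => 1 + eps * x) wt.
have e1 : ipm aw at_ = ipm wt (fun x => (1 + eps * x) ^+ 2 * u x).
  rewrite /aw /at_ ipmC ipm_cmul// (flow_emb L_gt0 fl) cmul_emb//.
  have cv : continuous (fun x : R => (1 + eps * x) * u x) by cont.
  rewrite cmul_emb// ipm_embr; [|by []|by cont].
  by congr ipm; apply/funext => x; rewrite mulrA.
pose S (f g : nat -> R) : R := \sum_(n < N) gam n * (f n * g n).
pose m n := ipm w (chain n); pose l n := ipm wt (chain n).
pose p n := ipm w (fun x => x * chain n x); pose k n := ipm wt (fun x => x * chain n x).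
have eF (f : L2 L) (a b : nat -> R) : (forall n, ipm f (chain n.+1) = a n + eps * b n) ->
    forall v, ipm f (feedback gam N v) = - S (fun n => ipm v (chain n)) a
      - eps * S (fun n => ipm v (chain n)) b.
  move=> fE v; rewrite ipm_feedback mulr_sumr -opprD -big_split/=; congr (- _).
  by apply: eq_bigr => n _; rewrite fE; ring.
have e2 : ipm aw (feedback gam N wt) =
    - S l (fun n => m n.+1) - eps * S l (fun n => p n.+1).
  by apply: eF => n; rewrite /aw ipm_affine.
have e3 : ipm at_ (feedback gam N w) =
    - S m (fun n => l n.+1) - eps * S m (fun n => k n.+1).
  by apply: eF => n; rewrite /at_ ipm_affine.
rewrite !transformE -/aw -/at_ ipmDl 2!ipmDr 2!ipmZl 2!ipmZr e1 e2.
rewrite [ipm _ at_]ipmC e3.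
have -> : \sum_(n < N) gam n * (ipm wt (chain n) * ip u (chain n.+1)
    + ip u (chain n) * ipm wt (chain n.+1)) =
    S l (fun n => m n.+1) + S m (fun n => l n.+1).
  rewrite -big_split; apply: eq_bigr => n _.
  by rewrite [ip u _]mE [ip u _]mE; exact: mulrDr.
have bS f g a b : 0 <= a -> (forall n, (n < N)%N -> `|f n| <= a) ->
    (forall n, (n < N)%N -> `|g n| <= b) -> `|S f g| <= G * (a * b).
  move=> a0 fa gb; apply: le_trans (ler_norm_sum _ _ _) _.
  rewrite mulr_suml; apply: ler_sum => n _; rewrite 2!normrM ler_wpM2l//.
  by rewrite ler_pM ?fa ?gb.
have Kr0 : 0 <= K * r by rewrite mulr_ge0// ltW.
have Kw0 : 0 <= K * `|w| by rewrite mulr_ge0// ltW.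
have b1 : `|S l (fun n => p n.+1)| <= G * (K * r * (K * `|w|)).
  by apply: bS => // n nN; [case: (bd _ (ltnW nN))|case: (bd _ nN)].
have b2 : `|S m (fun n => k n.+1)| <= G * (K * `|w| * (K * r)).
  by apply: bS => // n nN; [case: (bd _ (ltnW nN))|case: (bd _ nN)].
have b3 : `|ipm (feedback gam N w) (feedback gam N wt)| <= H * (K * `|w|) * (H * (K * r)).
  apply: le_trans (ipm_le_norm _ _) _; rewrite ler_pM//.
    by apply: feedback_norm => n nN; case: (bd _ (ltnW nN)).
  by apply: feedback_norm => n nN; case: (bd _ (ltnW nN)).
move: b1 b2 b3; move: (S l _) (S m _) (ipm (feedback _ _ _) _) => X Y Z b1 b2 b3.
move: (S l _) (S m _) (ipm wt _) => A B C.
have -> : C + eps * (- A - eps * X) + (eps * (- B - eps * Y) + eps * (eps * Z)) - C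
    + eps * (A + B) = eps ^+ 2 * (Z - X - Y) by ring.
rewrite normrM ger0_norm ?sqr_ge0// ler_wpM2l ?sqr_ge0//.
apply: le_trans (ler_normB _ _) _; apply: le_trans (lerD (ler_normB _ _) (lexx _)) _.
have h0 : 0 <= `|w| * r by rewrite mulr_ge0.
move: b1 b2 b3; move: `|X| `|Y| `|Z| `|w| h0 => x y z b h0 b1 b2 b3.
clear -h0 b1 b2 b3; nra.
Qed.

End feedback_operator.

(** * Dissipation *)

Section lyapunov.
Variables (R : realType) (L : R).
Hypothesis L_gt0 : 0 < L.
Hypothesis noncrit : ~ critical_length L.

Local Notation mu := (interval_measure L).
Local Notation ip := (ip L).
Local Notation ipm := (@ipm R L).
Local Notation emb := (@emb R L).
Local Notation cmul := (@cmul R L).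
Local Notation chain := (chain L).
Local Notation flow := (@flow R L).

Lemma noncritical_cos : cos L != 1.
Proof. by apply/eqP => /(critical_cos L_gt0). Qed.

Lemma coercive : exists N (C : R), 0 < C /\ forall th w d1 d2 wt u u1 u2,
  flow th w d1 d2 wt u u1 u2 ->
  ip u u <= ip u1 u1 + C * \sum_(i < N) ip u (chain i) ^+ 2.
Proof.
have cosL := noncritical_cos.
have [N [C [C0 CP]]] := chain_coercive L_gt0 (@rbvp_smooth R L) (@rbvp_eq R L)
  (rbvp_bc cosL) (@rbvp_linear R L) (rbvp_bound L_gt0) (chain_smooth L)
  (chain_dirichlet cosL) (chain1_0 cosL) (chain_eq L) noncrit.
exists N, C; split => // th w d1 d2 wt u u1 u2 [[du du1 _] _ [u0 _ _] _].
exact: CP du (has_deriv_cont du1) u0.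
Qed.

Lemma flow_sup th w d1 d2 wt (u u1 u2 : R -> R) (x : R) : flow th w d1 d2 wt u u1 u2 ->
  0 <= x <= L -> u x <= Num.sqrt (L * ip u1 u1).
Proof.
move=> [[du du1 _] _ [u0 _ _] _] /andP[x0 xL].
have cu1 := has_deriv_cont du1.
have := @holder_half _ _ L_gt0 u u1 0 x du cu1 (lexx _) x0 xL.
rewrite u0 !subr0 -intL_sqr -/(ip u1 u1) => h.
have a0 : 0 <= ip u1 u1 by exact: ip_ge0.
apply: le_trans (ler_norm _) _; rewrite -sqrtr_sqr ler_sqrt.
  by apply: le_trans h _; rewrite ler_wpM2r.
by rewrite mulr_ge0// ltW.
Qed.

(** Real arithmetic of the final estimate: b = |w|^2, a = |w_x|^2, S the sum of squared moments, y =
    |w'(0)|, Q the feedback sum. Coercivity replaces - 4 Cs S by 4 (a - b). The coefficients then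
    add up to 9/4 + 3/16 + 1/4 - 7/2 + 1/5 < - 1/2 for eps b, to - 6 + 3/4 + 4 < 0 for eps a, and to
    - 2 + 3 (1/4 + 1/20) < 0 for y^2. *)
Lemma dissipation_arith (eps K C Cs eta th B b a S y d1 d2 rate cub dw err Q Lc : R) :
  0 < eps -> 0 < K -> 0 < C -> 0 < Cs -> 0 < eta -> 0 <= th -> 0 < Lc ->
  b = B ^+ 2 -> 0 <= B -> 0 <= a -> 0 <= d1 ->
  eps <= 1 -> 20 * (eps * K) <= 1 -> 4 * (eps * C) <= 1 ->
  4 * eta <= 1 -> 4 * (C * eta) <= 1 -> Lc * eta <= 1 -> th * B <= eta ->
  b <= a + Cs * S ->
  rate <= 9 / 4 * eps * b - 6 * eps * a + 3 * d2 ^+ 2 - 2 * y ^+ 2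
          + 2 / 3 * th * cub + 2 * dw ->
  cub <= 9 / 4 * eps * Num.sqrt (Lc * a) * b ->
  dw <= 3 * (d1 * B) ->
  - (2 * Q) <= - (4 * Cs * S) + 1 / 4 * b + C * ((y + d1 + d2) ^+ 2 + th * B ^+ 3) ->
  err <= eps ^+ 2 * (K * (B * (B + (y + d1 + d2) + th * B ^+ 2))) ->
  rate + 2 * (err - eps * Q) <= - (eps / 2) * b + (36 / eps + 6) * (d1 ^+ 2 + d2 ^+ 2).
Proof.
move=> eps0 K0 C0 Cs0 eta0 th0 Lc0 bE B0 a0 d10 eps1 epsK epsC eta1 etaC etaL thB.
move=> hb hrate hcub hdw hQ herr.
set D := y + d1 + d2 in hQ herr *.
have b0 : 0 <= b by rewrite bE exprn_ge0.
have DD : D ^+ 2 <= 3 * (y ^+ 2 + d1 ^+ 2 + d2 ^+ 2).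
  have := sqr_ge0 (y - d1); have := sqr_ge0 (y - d2); have := sqr_ge0 (d1 - d2).
  by rewrite /D; clear; nra.
have thB3 : th * B ^+ 3 <= eta * b.
  by rewrite bE exprSr [B ^+ 2 * B]mulrC mulrA ler_wpM2r ?exprn_ge0.
have cub1 : th * cub <= 9 / 8 * (eps * (eta * (Lc * a + b))).
  set M := Num.sqrt (Lc * a) in hcub.
  have M0 : 0 <= M by exact: sqrtr_ge0.
  have ME : M ^+ 2 = Lc * a by rewrite sqr_sqrtr// mulr_ge0// ltW.
  have h1 : th * cub <= th * (9 / 4 * eps * M * b) by rewrite ler_wpM2l.
  have h2 : eps * (M * B) * (th * B) <= eps * (M * B) * eta.
    by rewrite ler_wpM2l// mulr_ge0 ?mulr_ge0// ltW.
  have h3 : 0 <= eps * eta * (M - B) ^+ 2.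
    by rewrite mulr_ge0 ?sqr_ge0// mulr_ge0// ltW.
  rewrite -ME bE in h1 *; move: h1 h2 h3; clear; nra.
have e0 : 0 <= eps by exact: ltW.
have eb0 : 0 <= eps * b by rewrite mulr_ge0.
have ea0 : 0 <= eps * a by rewrite mulr_ge0.
have p2 : 2 / 3 * th * cub <= 3 / 4 * (eps * a) + 3 / 16 * (eps * b).
  have h1 : eps * a * (Lc * eta) <= eps * a * 1 by rewrite ler_wpM2l.
  have h2 : eps * b * (4 * eta) <= eps * b * 1 by rewrite ler_wpM2l.
  move: h1 h2 cub1; clear; nra.
have p3 : 2 * dw <= 1 / 4 * (eps * b) + 36 / eps * d1 ^+ 2.
  have := young B (3 * d1) (divr_gt0 eps0 (ltr0Sn _ 3)).
  have -> : (3 * d1) ^+ 2 / (eps / 4) = 36 / eps * d1 ^+ 2 by field; rewrite gt_eqF.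
  by move: hdw; rewrite bE; move: (_ / eps * _) => t; clear; nra.
have p4 : - (2 * (eps * Q)) <= 4 * (eps * a) - 7 / 2 * (eps * b) + 1 / 4 * D ^+ 2.
  have h1 : eps * (- (2 * Q)) <= eps * (4 * (a - b) + 1 / 4 * b + C * (D ^+ 2 + eta * b)).
    rewrite ler_wpM2l// (le_trans hQ)//.
    have h : C * (D ^+ 2 + th * B ^+ 3) <= C * (D ^+ 2 + eta * b).
      by rewrite ler_wpM2l ?lerD2l// ltW.
    by move: h hb; move: (C * _) (C * _) => s t; clear; nra.
  have h2 : D ^+ 2 * (4 * (eps * C)) <= D ^+ 2 * 1 by rewrite ler_wpM2l ?sqr_ge0.
  have h3 : eps * b * (4 * (C * eta)) <= eps * b * 1 by rewrite ler_wpM2l.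
  by move: h1 h2 h3; clear; nra.
have p5 : 2 * err <= 1 / 5 * (eps * b) + 1 / 20 * D ^+ 2.
  have h1 : B * (B + D + th * B ^+ 2) <= 2 * b + 1 / 2 * D ^+ 2.
    have h : eta * b <= 1 / 4 * b by rewrite ler_wpM2r//; lra.
    have := sqr_ge0 (B - D); move: h thB3; rewrite bE; clear; nra.
  have h2 : eps ^+ 2 * (K * (B * (B + D + th * B ^+ 2))) <=
      eps ^+ 2 * (K * (2 * b + 1 / 2 * D ^+ 2)).
    by rewrite ler_wpM2l ?sqr_ge0// ler_wpM2l// ltW.
  have h3 : eps * b * (20 * (eps * K)) <= eps * b * 1 by rewrite ler_wpM2l.
  have h4 : D ^+ 2 * (20 * (eps * K)) <= D ^+ 2 * 1 by rewrite ler_wpM2l ?sqr_ge0.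
  have h5 : D ^+ 2 * (20 * (eps * K)) * eps <= D ^+ 2 * 1 * 1.
    have K1 := ltW K0.
    apply: ler_pM => //; apply: mulr_ge0; rewrite ?sqr_ge0//.
    by apply: mulr_ge0 => //; exact: mulr_ge0.
  by move: (le_trans herr h2) h3 h5; clear; nra.
have d20 := sqr_ge0 d2; have y20 := sqr_ge0 y; have d120 := sqr_ge0 d1.
have ie : 0 <= 36 / eps * d2 ^+ 2 by rewrite mulr_ge0// divr_ge0.
have -> : (36 / eps + 6) * (d1 ^+ 2 + d2 ^+ 2) =
    36 / eps * d1 ^+ 2 + 36 / eps * d2 ^+ 2 + 6 * (d1 ^+ 2 + d2 ^+ 2) by ring.
move: (36 / eps * d1 ^+ 2) (36 / eps * d2 ^+ 2) ie p3 => s t ie p3.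
move: (D ^+ 2) (d1 ^+ 2) (d2 ^+ 2) (y ^+ 2) d20 y20 d120 DD p4 p5 p3 hrate.
move=> D' d1' d2' y' d20 y20 d120 DD p4 p5 p3 hrate.
have hr : rate <= 9 / 4 * (eps * b) - 6 * (eps * a) + 3 * d2' - 2 * y'
    + 2 / 3 * th * cub + 2 * dw by move: hrate; rewrite !mulrA.
have -> : - (eps / 2) * b = - (1 / 2 * (eps * b)) by field.
move: (2 / 3 * th * cub) p2 hr => c' p2 hr.
move: (eps * b) (eps * a) (eps * Q) eb0 ea0 p2 p3 p4 p5 hr => b' a' q' eb0 ea0 p2 p3 p4 p5 hr.
clear -ie d20 y20 d120 DD p2 p3 p4 p5 hr eb0 ea0; lra.
Qed.

Lemma multiplier_rate eps th w d1 d2 wt (u u1 u2 : R -> R) :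
    0 < eps -> 8 * (eps * L) <= 1 -> 0 <= th -> flow th w d1 d2 wt u u1 u2 ->
  exists cub dw,
  [/\ 2 * ipm w wt + 2 * ipm wt (fun x => (1 + eps * x) ^+ 2 * u x) <=
        9 / 4 * eps * `|w| ^+ 2 - 6 * eps * ip u1 u1 + 3 * `|d2| ^+ 2
        - 2 * `|u1 0| ^+ 2 + 2 / 3 * th * cub + 2 * dw,
      cub <= 9 / 4 * eps * Num.sqrt (L * ip u1 u1) * `|w| ^+ 2 &
      dw <= 3 * (`|d1| * `|w|)].
Proof.
move=> eps0 epsL th0 fl; have [[du du1 cu2] _ _ _] := fl.
have cu := has_deriv_cont du; have cu1 := has_deriv_cont du1.
(* Plain and weighted energies together. As eps L <= 1/8, the derivative of rho lies between 2 eps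
   and 9/4 eps, and rho is at most 3. *)
pose rho (x : R) := 1 + (1 + eps * x) ^+ 2.
pose rho1 (x : R) := 2 * eps * (1 + eps * x).
have dr : has_deriv rho rho1.
  by rewrite /rho; eapply has_deriv_eq; [deriv|move=> x /=; rewrite /rho1; ring].
have dr1 : has_deriv rho1 (fun=> 2 * eps ^+ 2).
  by rewrite /rho1; eapply has_deriv_eq; [deriv|move=> x /=; ring].
have cr := has_deriv_cont dr; have cr1 := has_deriv_cont dr1.
have ex x : 0 <= x <= L -> 0 <= eps * x <= 1 / 8.
  move=> /andP[x0 xL]; rewrite mulr_ge0 ?(ltW eps0)//=.
  have : eps * x <= eps * L by rewrite ler_wpM2l// ltW.
  by move: epsL; move: (eps * x) (eps * L) => *; lra.
have r1 x : 0 <= x <= L -> 2 * eps <= rho1 x <= 9 / 4 * eps.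
  move=> /ex; rewrite /rho1; move: (eps * x) => z /andP[z0 z1].
  have h0 : 0 <= eps * z by rewrite mulr_ge0// ltW.
  have h1 : 0 <= eps * (1 / 8 - z) by rewrite mulr_ge0 ?subr_ge0// ltW.
  by apply/andP; split; nra.
have r0 x : 0 <= x <= L -> 0 <= rho x <= 3.
  move=> /ex; rewrite /rho; move: (eps * x) => z /andP[z0 z1].
  have hz : 0 <= z * (1 / 8 - z) by rewrite mulr_ge0 ?subr_ge0.
  by apply/andP; split; nra.
exists (intL L (fun x => rho1 x * u x ^+ 3)), (ipm d1 (fun x => rho x * u x)).
have L00 : 0 <= L <= L by rewrite lexx ltW.
have bE := flow_sqr L_gt0 fl.
have cru : continuous (fun x => rho x * u x) by cont.
split.
- have -> : 2 * ipm w wt + 2 * ipm wt (fun x => (1 + eps * x) ^+ 2 * u x)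
      = 2 * ipm wt (fun x => rho x * u x).
    have ck : continuous (fun x : R => (1 + eps * x) ^+ 2 * u x) by cont.
    rewrite -(ipm_embr L_gt0 wt ck) -(ipm_embr L_gt0 wt cru).
    have -> : emb (fun x => rho x * u x) = w + emb (fun x => (1 + eps * x) ^+ 2 * u x).
      rewrite (flow_emb L_gt0 fl) -[emb u]scale1r -embD//.
      by congr emb; apply/funext => x; rewrite /rho; ring.
    by rewrite ipmDr [in RHS]mulrDr (ipmC _ w).
  rewrite (rate_multiplier L_gt0 fl dr dr1) bE real_normK ?num_real// real_normK ?num_real//.
  have h1 : intL L (fun x => rho1 x * u x ^+ 2) <= 9 / 4 * eps * ip u u.
    rewrite /ip -intLZ//; last by cont.
    apply: le_intL => //; [by cont|by cont|move=> x /r1/andP[_ rx]].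
    by rewrite -expr2 ler_wpM2r ?sqr_ge0.
  have h2 : 2 * eps * ip u1 u1 <= intL L (fun x => rho1 x * u1 x ^+ 2).
    rewrite /ip -intLZ//; last by cont.
    apply: le_intL => //; [by cont|by cont|move=> x /r1/andP[rx _]].
    by rewrite -expr2 ler_wpM2r ?sqr_ge0.
  have h3 : rho L * d2 ^+ 2 <= 3 * d2 ^+ 2.
    by rewrite ler_wpM2r ?sqr_ge0//; case/andP: (r0 L L00).
  have h4 : rho 0 = 2 by rewrite /rho mulr0 addr0 expr1n.
  rewrite h4; move: h1 h2 h3; move: (intL _ _) (intL _ _) (intL _ _) (ipm _ _).
  move: (rho L * d2 ^+ 2) => t A B C D; move: (ip u u) (ip u1 u1) => E F.
  by move=> *; lra.
- rewrite bE; set M := Num.sqrt _; have M0 : 0 <= M by exact: sqrtr_ge0.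
  rewrite -[ip u u]/(intL L _) -intLZ//; last by cont.
  apply: le_intL => //; [by cont|by cont|move=> x xL].
  have uM := flow_sup fl xL; have /andP[rx rx'] := r1 x xL.
  have -> : rho1 x * u x ^+ 3 = rho1 x * u x * (u x * u x) by ring.
  rewrite -expr2 ler_wpM2r ?sqr_ge0//.
  have rx0 : 0 <= rho1 x by apply: le_trans rx; rewrite mulr_ge0// ltW.
  apply: le_trans (ler_wpM2l rx0 uM) _.
  by rewrite ler_wpM2r.
- have -> : ipm d1 (fun x => rho x * u x) = ipm d1 (cmul rho w).
    by rewrite (flow_emb L_gt0 fl) cmul_emb// ipm_embr.
  apply: le_trans (ler_norm _) _; apply: le_trans (ipm_le_norm _ _) _.
  rewrite mulrCA ler_wpM2l//; apply: cmul_bound => // x /r0/andP[rx rx'].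
  by rewrite ger0_norm.
Qed.

(** The order of the choices matters: coercivity gives N and Cs, then the weights are taken with
    [Gam] = 4 Cs and [tau] = 1/4, and only then comes eps, so that the constant in front of eps^2
    does not depend on eps. *)
Lemma dissipation : exists N gam (eps0 : R), 0 < eps0 /\
  forall eps, 0 < eps -> eps <= eps0 -> exists eta s : R,
  [/\ 0 < eta, 0 < s & forall th w d1 d2 wt u u1 u2,
    0 <= th -> flow th w d1 d2 wt u u1 u2 -> th * `|w| <= eta ->
    2 * ipm w wt + 2 * ipm (transform eps gam N w) (transform eps gam N wt) <=
      - (eps / 2) * `|w| ^+ 2 + s * (`|d1| ^+ 2 + `|d2| ^+ 2)].
Proof.
have [N [Cs [Cs0 CsP]]] := coercive.
have [gam [C C0 CP]] := chain_control L_gt0 noncritical_cos N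
  (divr_gt0 ltr01 (ltr0Sn R 3)) (mulr_gt0 (ltr0Sn R 3) Cs0).
have [K K0 KP] := transform_rate L_gt0 noncritical_cos gam N.
(* A single sum, so that eps M <= 1 implies the four smallness conditions on eps; H below plays the
   same part for the bound on th |w|. *)
pose M := 1 + 8 * L + 20 * K + 4 * C.
have M0 : 0 < M by rewrite !addr_gt0 ?mulr_gt0.
exists N, gam, M^-1; split; first by rewrite invr_gt0.
move=> eps eps0 epsM.
have eM : eps * M <= 1 by rewrite -(mulVf (lt0r_neq0 M0)) ler_wpM2r// ltW.
have eL : 0 <= eps * L by rewrite mulr_ge0// ltW.
have eK : 0 <= eps * K by rewrite mulr_ge0// ltW.
have eC : 0 <= eps * C by rewrite mulr_ge0// ltW.
have eME : eps * M = eps + 8 * (eps * L) + 20 * (eps * K) + 4 * (eps * C).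
  by rewrite /M; ring.
pose H := 4 + 4 * C + L.
have H0 : 0 < H by rewrite !addr_gt0 ?mulr_gt0.
have HE : H * H^-1 = 4 * H^-1 + 4 * (C * H^-1) + L * H^-1 by rewrite /H; ring.
rewrite mulfV ?gt_eqF// in HE.
have H1 : 0 < H^-1 by rewrite invr_gt0.
have CH : 0 <= C * H^-1 by rewrite mulr_ge0// ltW.
have LH : 0 <= L * H^-1 by rewrite mulr_ge0// ltW.
have [s1 s2 s3 epsL] : [/\ eps <= 1, 20 * (eps * K) <= 1, 4 * (eps * C) <= 1 &
    8 * (eps * L) <= 1] by split; lra.
have [s4 s5 s6] : [/\ 4 * H^-1 <= 1, 4 * (C * H^-1) <= 1 & L * H^-1 <= 1].
  by split; lra.
exists H^-1, (36 / eps + 6); split => //; first by rewrite addr_gt0// divr_gt0.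
move=> th w d1 d2 wt u u1 u2 th0 fl thB.
have [cub [dw [h1 h2 h3]]] := multiplier_rate eps0 epsL th0 fl.
have hQ := CP _ _ _ _ _ _ _ _ th0 fl.
have herr := le_trans (ler_norm _) (KP eps _ _ _ _ _ _ _ _ th0 fl).
have hb := CsP _ _ _ _ _ _ _ _ fl; rewrite -(flow_sqr L_gt0 fl) in hb.
have a0 := ip_ge0 L u1.
have := dissipation_arith eps0 K0 C0 Cs0 H1 th0 L_gt0 erefl (normr_ge0 w) a0
  (normr_ge0 d1) s1 s2 s3 s4 s5 s6 thB hb h1 h2 h3 hQ herr.
move: (\sum_(n < N) _) (ipm w wt) (ipm wt _) (ipm (transform _ _ _ _) _) => A B D E.
by apply: le_trans; rewrite le_eqVlt; apply/orP; left; apply/eqP; ring.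
Qed.

End lyapunov.

(** * Quadratic functionals and finite rank perturbations *)

Section quadratic_functional.
Variables (R : realType) (V : normedModType R).

Lemma lipschitz0_continuous (W : normedModType R) (f : V -> W) (M : R) :
  (forall x y, `|f x - f y| <= M * `|x - y|) -> continuous f.
Proof.
move=> fM x; apply/cvgrPdist_le => /= e e0.
have M0 : 0 < `|M| + 1 by rewrite ltr_wpDl.
near=> t; apply: le_trans (fM _ _) _.
have : `|x - t| <= e / (`|M| + 1).
  near: t; apply: cvgr_dist_le; first exact: cvg_id.
  by rewrite divr_gt0.
rewrite ler_pdivlMr// mulrC; apply: le_trans; rewrite ler_wpM2r//.
by rewrite (le_trans (ler_norm _))// lerDl.
Unshelve. all: by end_near. Qed.

Lemma bounded_linear_lipschitz (W : normedModType R) (f : {linear V -> W}) (M : R) :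
  (forall x, `|f x| <= M * `|x|) -> forall x y, `|f x - f y| <= M * `|x - y|.
Proof. by move=> fM x y; rewrite -linearB. Qed.

Lemma quadratic_differential (f : V -> R) (x : V) (df : V -> R) (K M : R) :
  (forall (a : R) h k, df (a *: h + k) = a * df h + df k) ->
  (forall h, `|df h| <= K * `|h|) ->
  (forall h, `|f (h + x) - (f x + df h)| <= M * `|h| ^+ 2) ->
  differentiable f x /\ 'd f x = df :> (V -> R).
Proof.
move=> dfl dfK fM.
pose G : {linear V -> R} := HB.pack df (GRing.isLinear.Build R V R *%R df dfl).
have cG : continuous (G : V -> R).
  exact: (lipschitz0_continuous (@bounded_linear_lipschitz R G K dfK)).
have o : f \o shift x = cst (f x) + (G : V -> R) +o_ (0 : V) id.
  apply/eqaddoP => _/posnumP[e].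
  near=> h; rewrite -[(f \o shift x - _) h]/(f (h + x) - (f x + df h)).
  apply: le_trans (fM h) _; rewrite expr2 mulrA ler_wpM2r//.
  have : `|h| <= e%:num / (`|M| + 1).
    near: h; apply: (@cvgr0_norm_le _ _ _ _ _ id); first exact: cvg_id.
    by rewrite divr_gt0// ltr_wpDl.
  rewrite ler_pdivlMr ?ltr_wpDl// mulrC; apply: le_trans; rewrite ler_wpM2r//.
  by rewrite (le_trans (ler_norm _))// lerDl.
have dE : 'd f x = df :> (V -> R) := diff_unique cG o.
split=> //; apply/diff_locallyP; split; last by rewrite dE.
by have -> : ('d f x : V -> R) = df by [].
Unshelve. all: by end_near. Qed.

(** Fredholm alternative for the identity minus a finite rank map: a solution is sought as f plus a
    combination of the v_n, which is an N by N linear system; a vector in the kernel of its matrix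
    would give a nonzero fixed point. *)
Lemma finite_rank_surjective (N : nat) (phi : 'I_N -> V -> R) (v : 'I_N -> V) :
  (forall n (a : R) h k, phi n (a *: h + k) = a * phi n h + phi n k) ->
  (forall w, w = \sum_n phi n w *: v n -> w = 0) ->
  forall f, exists w, w - \sum_n phi n w *: v n = f.
Proof.
move=> lin inj f.
have phi_sum n (c : 'I_N -> R) (s : V) :
    phi n (s + \sum_i c i *: v i) = phi n s + \sum_i c i * phi n (v i).
  have -> : \sum_i c i *: v i = \sum_(i <- index_enum 'I_N) c i *: v i by [].
  elim/big_rec2: _ (s) => [|i y z _ IH t]; first by move=> t; rewrite !addr0.
  by rewrite addrCA lin IH addrCA.
pose A : 'M[R]_N := \matrix_(i, j) ((i == j)%:R - phi j (v i)).
have AE (c : 'rV[R]_N) j : (c *m A) 0 j = c 0 j - \sum_i c 0 i * phi j (v i).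
  rewrite mxE; under eq_bigr => i _ do rewrite mxE mulrBr.
  rewrite sumrB; congr (_ - _); rewrite (bigD1 j)//= eqxx mulr1 big1 ?addr0//.
  by move=> i /negPf ij; rewrite ij mulr0.
have Au : A \in unitmx.
  rewrite -row_free_unit -kermx_eq0; apply/rowV0P => c /sub_kermxP cA.
  have cE j : c 0 j = \sum_i c 0 i * phi j (v i).
    by apply/eqP; rewrite -subr_eq0 -AE cA mxE.
  have phi0 j : phi j 0 = 0 by have := lin j (- 1) 0 0; rewrite scaler0 addr0 mulN1r addNr.
  pose w := \sum_i c 0 i *: v i.
  have wc j : phi j w = c 0 j by rewrite cE -[w]add0r phi_sum phi0 add0r.
  have w0 : w = 0 by apply: inj; rewrite {1}/w; apply: eq_bigr => i _; rewrite wc.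
  by apply/rowP => j; rewrite -wc w0 phi0 mxE.
pose b : 'rV[R]_N := \row_j phi j f; pose c := b *m invmx A.
have cA : c *m A = b by rewrite /c mulmxKV.
exists (f + \sum_i c 0 i *: v i).
have wc j : phi j (f + \sum_i c 0 i *: v i) = c 0 j.
  rewrite phi_sum; have := AE c j; rewrite cA mxE => ->.
  by rewrite subrK.
under [X in _ - X]eq_bigr => i _ do rewrite wc.
by rewrite addrK.
Qed.

End quadratic_functional.

(** * Invertibility of Pi *)

Section transform_bijective.
Variables (R : realType) (L : R).
Hypothesis L_gt0 : 0 < L.

Local Notation leb := (@lebesgue_measure R).
Local Notation mu := (interval_measure L).
Local Notation ipm := (@ipm R L).
Local Notation emb := (@emb R L).
Local Notation cmul := (@cmul R L).
Local Notation chain := (chain L).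

Let cont_chain n : continuous (chain n).
Proof. by case: (chain_smooth L n) => /has_deriv_cont. Qed.

Lemma energy_normE (w : L2 L) : energy w = `|w| ^+ 2.
Proof.
rewrite L2_normE /ipm Rintegral_interval_measure; last first.
  by apply: measurable_funM; exact: L2_measurable.
have mw : measurable_fun setT (fun x => (w x ^+ 2)%:E).
  by apply/measurable_EFinP; apply: measurable_funX; exact: L2_measurable.
rewrite /energy /Rintegral -integral_itv_obnd_cbnd; last exact: measurable_funTS.
rewrite -integral_itv_bndo_bndc; last exact: measurable_funTS.
by congr fine; apply: eq_integral => x _; rewrite expr2.
Qed.

Lemma ipm_linear (a : R) (f g : L2 L) (h : R -> R) : continuous h ->
  ipm (a *: f + g) h = a * ipm f h + ipm g h.
Proof. by move=> ch; rewrite -!(ipm_embr L_gt0 _ ch) ipmDl ipmZl. Qed.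

Lemma feedback_linear gam N (a : R) (f g : L2 L) :
  feedback gam N (a *: f + g) = a *: feedback gam N f + feedback gam N g.
Proof.
rewrite /feedback scalerN -opprD scaler_sumr -big_split/=; congr (- _).
apply: eq_bigr => n _; rewrite ipm_linear// mulrDr scalerDl scalerA mulrCA.
by [].
Qed.

Lemma feedback_bounded gam N : exists2 k, 0 <= k &
  forall w : L2 L, `|feedback gam N w| <= k * `|w|.
Proof.
pose k := \sum_(n < N) `|emb (chain n)|.
exists (feedback_gain L gam N * k).
  by rewrite mulr_ge0 ?feedback_gain_ge0// sumr_ge0.
move=> w; rewrite -mulrA; apply: feedback_norm => n nN.
rewrite -(ipm_embr L_gt0 w (@cont_chain n)); apply: le_trans (ipm_le_norm _ _) _.
rewrite mulrC ler_wpM2r// /k (bigD1 (Ordinal nN))//= lerDl.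
by rewrite sumr_ge0.
Qed.

Lemma weight_cont (eps : R) : continuous (fun x : R => 1 + eps * `|x|).
Proof.
have cn : continuous (fun x : R => `|x|) by exact: norm_continuous.
by cont.
Qed.

Lemma weight_ge1 (eps x : R) : 0 < eps -> 1 <= 1 + eps * `|x|.
Proof. by move=> e0; rewrite lerDl mulr_ge0// ltW. Qed.

Lemma inv_weight_cont (eps : R) : 0 < eps -> continuous (fun x : R => (1 + eps * `|x|)^-1).
Proof.
move=> e0 x; apply: cvgV; last exact: weight_cont.
by rewrite gt_eqF// (lt_le_trans ltr01)// weight_ge1.
Qed.

Lemma weight_cancel (eps : R) (w : L2 L) : 0 < eps ->
  cmul (fun x => (1 + eps * `|x|)^-1) (cmul (fun x => 1 + eps * `|x|) w) = w.
Proof.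
move=> e0; apply: cmul_cancel => // [||x].
- exact: inv_weight_cont.
- exact: weight_cont.
- by rewrite mulVf// gt_eqF// (lt_le_trans ltr01)// weight_ge1.
Qed.

Lemma inv_weight_cancel (eps : R) (w : L2 L) : 0 < eps ->
  cmul (fun x => 1 + eps * `|x|) (cmul (fun x => (1 + eps * `|x|)^-1) w) = w.
Proof.
move=> e0; apply: cmul_cancel => // [||x].
- exact: weight_cont.
- exact: inv_weight_cont.
- by rewrite mulfV// gt_eqF// (lt_le_trans ltr01)// weight_ge1.
Qed.

Lemma transform_linear eps gam N (a : R) (f g : L2 L) :
  transform eps gam N (a *: f + g) = a *: transform eps gam N f + transform eps gam N g.
Proof.
rewrite /transform cmul_linear//; last exact: weight_cont.
rewrite feedback_linear 2!scalerDr 2!scalerA (mulrC a eps) addrACA.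
by [].
Qed.

Lemma transform_bounded eps gam N : 0 < eps -> exists M : R,
  forall w : L2 L, `|transform eps gam N w| <= M * `|w|.
Proof.
move=> e0; have [k k0 kP] := feedback_bounded gam N.
exists (1 + eps * L + eps * k) => w; rewrite mulrDl.
have eL : 0 <= 1 + eps * L by rewrite addr_ge0// mulr_ge0// ltW.
apply: le_trans (ler_normD _ _) _; apply: lerD.
  apply: cmul_bound => //; first exact: weight_cont.
  move=> x /andP[x0 xL]; rewrite ger0_norm; last first.
    by rewrite (le_trans ler01)// weight_ge1.
  by rewrite ger0_norm// lerD2l ler_wpM2l// ltW.
rewrite normrZ gtr0_norm// -mulrA ler_wpM2l//; exact: ltW.
Qed.

(** The weight is at least 1, so multiplication by it does not shrink norms, and the feedback takes
    away at most eps k |w| <= |w| / 2. *)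
Lemma transform_coercive gam N : exists2 eps1, 0 < eps1 &
  forall eps, 0 < eps -> eps <= eps1 -> forall w : L2 L,
  `|w| <= 2 * `|transform eps gam N w|.
Proof.
have [k k0 kP] := feedback_bounded gam N.
have k2 : 0 < 2 * k + 1 by rewrite ltr_wpDl// mulr_ge0.
exists (2 * k + 1)^-1 => [|eps e0 e1 w]; first by rewrite invr_gt0.
have ek : 2 * (eps * k) <= 1.
  have : eps * (2 * k + 1) <= 1.
    by rewrite -ler_pdivlMr// div1r.
  by rewrite mulrDr mulr1 mulrCA; move: (eps * k) => t; lra.
set v := cmul (fun x => 1 + eps * `|x|) w.
have h1 : `|w| <= `|v|.
  rewrite -{1}(weight_cancel w e0) -[leRHS]mul1r; apply: cmul_bound => //.
    exact: inv_weight_cont.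
  move=> x _; have := weight_ge1 x e0; move: (1 + _) => t t1.
  have t0 : 0 < t by exact: lt_le_trans t1.
  by rewrite ger0_norm ?invr_ge0 ?(ltW t0)// invf_le1.
have h2 : `|v| <= `|transform eps gam N w| + eps * (k * `|w|).
  have -> : v = transform eps gam N w - eps *: feedback gam N w by rewrite addrK.
  apply: le_trans (ler_normB _ _) _; rewrite lerD2l normrZ gtr0_norm//.
  by rewrite ler_wpM2l// ltW.
have h3 : 2 * (eps * k) * `|w| <= 1 * `|w| by rewrite ler_wpM2r.
move: h1 h2 h3; move: (transform _ _ _ _) => tw; move: `|tw| `|v| `|w| => A B C.
by move=> h1 h2 h3; nra.
Qed.

(** The invertible weight is factored out, leaving the identity minus a finite rank map; it is
    injective by the lower bound, hence onto. *)
Lemma transform_surjective eps gam N : 0 < eps ->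
  (forall w : L2 L, `|w| <= 2 * `|transform eps gam N w|) ->
  forall f : L2 L, exists w : L2 L, transform eps gam N w = f.
Proof.
move=> e0 low f.
pose r (g : L2 L) := cmul (fun x => (1 + eps * `|x|)^-1) g.
pose phi (n : 'I_N) (w : L2 L) : R := eps * gam n * ipm w (chain n).
pose v (n : 'I_N) := r (emb (chain n.+1)).
have phil n (a : R) h k : phi n (a *: h + k) = a * phi n h + phi n k.
  by rewrite /phi ipm_linear// mulrDr mulrCA.
have cw := @weight_cont eps.
have cmulN (s t : L2 L) : cmul (fun x => 1 + eps * `|x|) (s - t) =
    cmul (fun x => 1 + eps * `|x|) s - cmul (fun x => 1 + eps * `|x|) t.
  by rewrite -scaleN1r addrC cmul_linear// scaleN1r addrC.
have c0 : cmul (fun x => 1 + eps * `|x|) 0 = 0 by have := cmulN 0 0; rewrite !subrr.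
have sumE w : cmul (fun x => 1 + eps * `|x|) (\sum_n phi n w *: v n) =
    - (eps *: feedback gam N w).
  rewrite /feedback scalerN opprK scaler_sumr.
  elim/big_rec2: _ => // i y1 y2 _ <-; rewrite cmul_linear//.
  by rewrite /v /r inv_weight_cancel// scalerA mulrA.
have trE w : transform eps gam N w =
    cmul (fun x => 1 + eps * `|x|) (w - \sum_n phi n w *: v n).
  by rewrite cmulN sumE opprK.
have inj w : w = \sum_n phi n w *: v n -> w = 0.
  move=> wE; apply/eqP; rewrite -normr_le0; apply: le_trans (low w) _.
  by rewrite trE -wE subrr c0 normr0 mulr0.
have [w wE] := finite_rank_surjective phil inj (r f).
by exists w; rewrite trE wE /r inv_weight_cancel.
Qed.

(** V is a quadratic form, so the remainder of its first-order expansion at x is exactly |T h|^2 +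
    |h|^2. *)
Lemma square_norm_differential (T : L2 L -> L2 L) (M : R) (x : L2 L) :
  (forall (a : R) h k, T (a *: h + k) = a *: T h + T k) ->
  (forall h, `|T h| <= M * `|h|) ->
  let V := fun w : L2 L => `|T w| ^+ 2 + energy w in
  differentiable V x /\ forall h : L2 L, 'd V x h = 2 * ipm x h + 2 * ipm (T x) (T h).
Proof.
move=> Tl TM V.
pose df (h : L2 L) : R := 2 * ipm x h + 2 * ipm (T x) (T h).
have dfl (a : R) (h k : L2 L) : df (a *: h + k) = a * df h + df k.
  rewrite /df Tl 2!ipmDr 2!ipmZr.
  move: (ipm x h) (ipm x k) (ipm (T x) (T h)) (ipm (T x) (T k)) => A B C D.
  by clear; ring.
have dfK (h : L2 L) : `|df h| <= (2 * `|x| + 2 * (`|T x| * M)) * `|h|.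
  have n1 : `|2 * ipm x h| <= 2 * (`|x| * `|h|).
    by rewrite normrM normr_nat ler_wpM2l// ipm_le_norm.
  have n2 : `|2 * ipm (T x) (T h)| <= 2 * (`|T x| * (M * `|h|)).
    rewrite normrM normr_nat ler_wpM2l//; apply: le_trans (ipm_le_norm _ _) _.
    by rewrite ler_wpM2l.
  apply: le_trans (ler_normD _ _) (le_trans (lerD n1 n2) _).
  rewrite le_eqVlt; apply/orP; left; apply/eqP.
  by move: `|x| `|h| `|T x| => a b c; clear; ring.
have fM (h : L2 L) : `|V (h + x) - (V x + df h)| <= (M ^+ 2 + 1) * `|h| ^+ 2.
  have TE : T (h + x) = T h + T x by rewrite -[h]scale1r Tl !scale1r.
  have -> : V (h + x) - (V x + df h) = `|T h| ^+ 2 + `|h| ^+ 2.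
    rewrite /V TE !energy_normE !L2_normE 2!ipmDl 4!ipmDr /df.
    rewrite (ipmC _ (T h) (T x)) (ipmC _ h x).
    move: (ipm (T h) (T h)) (ipm (T x) (T h)) (ipm (T x) (T x)) => a b c.
    by move: (ipm h h) (ipm x h) (ipm x x) => p q r; clear; ring.
  rewrite ger0_norm ?addr_ge0 ?sqr_ge0// mulrDl mul1r lerD2r -exprMn.
  have := TM h; move: (normr_ge0 (T h)) => t0 tM.
  by rewrite lerXn2r ?nnegrE// (le_trans t0).
have [dV dE] := quadratic_differential dfl dfK fM.
by split => // h; rewrite dE.
Qed.

End transform_bijective.

(** * From the dissipation inequality to the Lyapunov properties *)

Lemma ISS_Lyapunov_of_dissipation (R : realType) (L : R) (P : L2 L -> L2 L -> R -> Prop)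
    (S : control_system L) (V : L2 L -> R) (T : L2 L -> L2 L) (M a s : R) :
  0 < a -> 0 < s ->
  (forall w, `|T w| <= M * `|w|) ->
  (forall w, V w = `|T w| ^+ 2 + energy w) ->
  (forall x, differentiable V x /\
     forall h : L2 L, 'd V x h = 2 * ipm L x h + 2 * ipm L (T x) (T h)) ->
  (forall w d1 d2 wt, P w d1 d2 -> S w d1 d2 wt ->
    2 * ipm L w wt + 2 * ipm L (T w) (T wt) <=
      - a * `|w| ^+ 2 + s * (`|d1| ^+ 2 + `|d2| ^+ 2)) ->
  ISS_Lyapunov_on P S V.
Proof.
move=> a0 s0 TM VE dV diss; exists 1, (M ^+ 2 + 1), a, s, s; split => //.
- by split => //; rewrite ltr_wpDl// sqr_ge0.
- move=> w; rewrite VE energy_normE mul1r mulrDl mul1r lerD2r lerDr sqr_ge0 -exprMn.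
  by rewrite lerXn2r ?nnegrE// (le_trans (normr_ge0 _) (TM w)).
- by move=> w; case: (dV w).
- move=> w d1 d2 wt Pw Sw; have [_ ->] := dV w.
  by rewrite -addrA -[s * _ + _]mulrDr; exact: diss.
Qed.

Theorem theorem2p3 (R : realType) (L : R) (L_gt0 : 0 < L)
    (L_noncrit : ~ critical_length L) :
  exists W : L2 L -> R,
  [/\ forall w, 0 <= W w,
      exp_ISS_Lyapunov (@kdv_linear R L) (fun w => W w + energy w),
      local_exp_ISS_Lyapunov (@kdv_nonlinear R L) (fun w => W w + energy w) &
      exists Pi : {linear L2 L -> L2 L},
      [/\ continuous Pi,
          exists Pi' : L2 L -> L2 L,
            [/\ continuous Pi', cancel Pi Pi' & cancel Pi' Pi] &
          forall w, W w = `|Pi w| ^+ 2]].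
Proof.
have [N [gam [eps0 [eps00 diss]]]] := dissipation L_gt0 L_noncrit.
have [eps1 eps10 low1] := transform_coercive L_gt0 gam N.
(* Small enough both for the dissipation inequality and for the invertibility of Pi. *)
pose eps := Num.min eps0 eps1.
have e0 : 0 < eps by rewrite lt_min eps00.
have [le0 le1] : eps <= eps0 /\ eps <= eps1 by split; rewrite ge_min lexx ?orbT.
have [eta [s [eta0 s0 ineq]]] := diss eps e0 le0.
have low := low1 eps e0 le1.
have [M TM] := transform_bounded L_gt0 gam N e0.
pose T := transform eps gam N : L2 L -> L2 L.
have Tl : forall (a : R) (h k : L2 L), T (a *: h + k) = a *: T h + T k.
  exact: transform_linear.
have dV x := square_norm_differential x Tl TM.
have a0 : 0 < eps / 2 by rewrite divr_gt0.
exists (fun w => `|T w| ^+ 2); split => [w|||]; first exact: sqr_ge0.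
- apply: (ISS_Lyapunov_of_dissipation (T := T) a0 s0 TM) => // w d1 d2 wt _.
  move=> /(linear_flow L_gt0)[u [u1 [u2 fl]]].
  apply: (ineq _ _ _ _ _ _ _ _ (lexx 0) fl).
  by rewrite mul0r ltW.
(* The bound 3 delta in the local property is then eta, and |w| is one of the summands. *)
- exists (eta / 3); first by rewrite divr_gt0.
  apply: (ISS_Lyapunov_of_dissipation (T := T) a0 s0 TM) => // w d1 d2 wt small.
  move=> /(nonlinear_flow L_gt0)[u [u1 [u2 fl]]].
  apply: (ineq _ _ _ _ _ _ _ _ ler01 fl).
  rewrite mul1r; apply: le_trans (_ : `|w| + `|d1| + `|d2| <= _).
    by rewrite -addrA lerDl addr_ge0.
  by apply: le_trans small _; rewrite mulrC divfK.
pose Pi : {linear L2 L -> L2 L} :=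
  HB.pack T (GRing.isLinear.Build R (L2 L) (L2 L) *:%R T Tl).
exists Pi; split => //.
  exact: (lipschitz0_continuous (@bounded_linear_lipschitz _ _ _ Pi _ TM)).
have surj f : exists w, T w == f.
  by have [w <-] := transform_surjective L_gt0 e0 low f; exists w.
(* A preimage chosen for each f; the bound |w| <= 2 |Pi w| makes it unique and makes the inverse
   Lipschitz with constant 2. *)
pose Pi' f := xchoose (surj f).
have Pi'K : cancel Pi' Pi by move=> f; exact/eqP/(xchooseP (surj f)).
have lowPi x y : `|x - y| <= 2 * `|Pi x - Pi y|.
  by rewrite -linearB; exact: low.
exists Pi'; split => //.
  by apply: (@lipschitz0_continuous _ _ _ _ 2) => x y; rewrite -{2}(Pi'K x) -{2}(Pi'K y).
move=> x; apply/eqP; rewrite -subr_eq0 -normr_le0; apply: le_trans (lowPi _ _) _.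
by rewrite Pi'K subrr normr0 mulr0.
Qed.
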